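(* For any $n\ge1$, there is an isomorphism $\langle B_3\rangle\simeq\langle B_3\rangle_n$ of $\mathbb Q$-group schemes, which is compatible with the maps from $B_3$ to both sides.
   Context: For a finitely generated group $\Gamma$, $\mathrm{Lie}\,\Gamma$ is the Lie algebra of its $\mathbb Q$-prounipotent completion, and $\underline{\mathrm{Aut}\Gamma}(-)$ is the $\mathbb Q$-group scheme $\mathbf k\mapsto\mathrm{Aut}(\mathrm{Lie}\,\Gamma\hat\otimes\mathbf k)$ with $\mathrm{Lie}\,\Gamma\hat\otimes\mathbf k=\varprojlim_m(\mathrm{Lie}\,\Gamma/(\mathrm{Lie}\,\Gamma)^{\ge m})\otimes\mathbf k$ (lower central series filtration); there is a natural morphism $\mathrm{Aut}\,\Gamma\to\underline{\mathrm{Aut}\Gamma}(\mathbb Q)$. The Zariski closure of a group morphism to the $\mathbb Q$-points of a group scheme is the intersection of all group subschemes whose $\mathbb Q$-points contain its image. $B_3=\langle\Psi_+,\Psi_-\mid\Psi_+\Psi_-\Psi_+=\Psi_-\Psi_+\Psi_-\rangle$. It acts on the free group $F_2$ on $X,Y$ by $\Psi_+:X\mapsto X,\ Y\mapsto YX$ and $\Psi_-:X\mapsto XY^{-1},\ Y\mapsto Y$. $\langle B_3\rangle\subset\underline{\mathrm{Aut}F_2}(-)$ is the Zariski closure of the composite morphism $B_3\to\mathrm{Aut}F_2\to\underline{\mathrm{Aut}F_2}(\mathbb Q)$. For $n\ge1$, the reduced elliptic braid group $B_{1,n}$ has generators $\sigma_1,\dots,\sigma_{n-1},X_1^+,X_1^-$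 and relations (those that make sense for the given $n$): the Artin relations for the $\sigma_i$; $(\sigma_1^{\pm1}X_1^\pm)^2=(X_1^\pm\sigma_1^{\pm1})^2$; $X_1^\pm$ commutes with $\sigma_i$ for $i\ge2$; $X_1^-(X_2^+)^{-1}(X_1^-)^{-1}X_2^+=\sigma_1^2$; $X_1^\pm\cdots X_n^\pm=1$, where $X_{i+1}^\pm=\sigma_i^{\pm1}X_i^\pm\sigma_i^{\pm1}$. $P_{1,n}=\ker(B_{1,n}\to S_n)$ ($\sigma_i\mapsto(i,i+1)$, $X_1^\pm\mapsto1$). $B_3$ acts on $B_{1,n}$ by $\Psi_+:X_1^+\mapsto X_1^+,\ X_1^-\mapsto X_1^-X_1^+,\ \sigma_i\mapsto\sigma_i$ and $\Psi_-:X_1^+\mapsto X_1^+(X_1^-)^{-1},\ X_1^-\mapsto X_1^-,\ \sigma_i\mapsto\sigma_i$; this restricts to an action on $P_{1,n}$. $\langle B_3\rangle_n\subset\underline{\mathrm{Aut}P_{1,n}}(-)$ is the Zariski closure of the composite morphism $B_3\to\mathrm{Aut}P_{1,n}\to\underline{\mathrm{Aut}P_{1,n}}(\mathbb Q)$.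
   Formalization: The theorem is stated for n ≥ 2 instead of n ≥ 1: for n = 1 the relations X_1^± = 1 make P_{1,1} trivial, so ⟨B_3⟩_1 is trivial, while ⟨B_3⟩ is not, since Ψ_+ acts nontrivially on Lie F_2. *)

(* Defs.v *)
(* MathComp, with the classical axioms of mathcomp.classical.boolp.

   Conventions.
   - Q-group schemes are treated through their functors of points on commutative
     Q-algebras (K : comAlgType rat; in MathComp these are nonzero rings), with
     Q itself being rat^o.
   - Lie Gamma is the Lie algebra of the Q-prounipotent completion of Gamma, i.e.
     its tangent space at 1 (malcev Gamma below).
   - Automorphism groups multiply by composition: (f * g) x = f (g x).          *)
From HB Require Import structures.
From mathcomp Require Import all_boot all_order all_algebra all_fingroup.
From mathcomp Require Import generic_quotient boolp functions ring.

Set Implicit Arguments.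
Unset Strict Implicit.
Unset Printing Implicit Defensive.

Import GRing.Theory.

Local Open Scope quotient_scope.
Local Open Scope ring_scope.

Inductive gterm (T : Type) : Type :=
  | GVar of T | GOne | GMul of gterm T & gterm T | GInv of gterm T.
Arguments GOne {T}.

HB.instance Definition _ T := gen_eqMixin (gterm T).
HB.instance Definition _ T := gen_choiceMixin (gterm T).

Section Presentation.
Variables (T : Type) (R : gterm T -> gterm T -> Prop).

Fixpoint geval (G : groupType) (f : T -> G) (t : gterm T) : G :=
  match t with
  | GVar x => f x
  | GOne => 1%g
  | GMul u v => (geval f u * geval f v)%g
  | GInv u => (geval f u)^-1%g
  end.

Definition satisfies (G : groupType) (f : T -> G) : Prop :=
  forall u v, R u v -> geval f u = geval f v.

Definition gterm_eqv (u v : gterm T) : bool :=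
  `[< forall (G : groupType) (f : T -> G),
        satisfies f -> geval f u = geval f v >].

Lemma gterm_eqv_is_equiv : equiv_class_of gterm_eqv.
Proof.
split=> [u|u v|v u w]; first exact/asboolP.
  by apply/asboolP/asboolP => uv G f Rf; rewrite uv.
by move=> /asboolP uv /asboolP vw; apply/asboolP => G f Rf; rewrite uv ?vw.
Qed.

Canonical gterm_equiv := EquivRelPack gterm_eqv_is_equiv.

Definition presented : Type := {eq_quot gterm_equiv}.
HB.instance Definition _ := Choice.on presented.

Local Notation pi t := (\pi_{eq_quot gterm_equiv} t : presented).
Local Notation rep x := (repr (x : {eq_quot gterm_equiv})).

Lemma pres_eqP u v : pi u = pi v <-> forall (G : groupType) (f : T -> G),
  satisfies f -> geval f u = geval f v.
Proof. by split=> [/eqmodP/asboolP //|H]; apply/eqmodP/asboolP. Qed.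

Lemma geval_repr (G : groupType) (f : T -> G) t :
  satisfies f -> geval f (rep (pi t)) = geval f t.
Proof.
have /pres_eqP e : pi (rep (pi t)) = pi t by rewrite reprK.
exact: e.
Qed.

Definition pres_mul (x y : presented) : presented := pi (GMul (rep x) (rep y)).
Definition pres_inv (x : presented) : presented := pi (GInv (rep x)).
Definition pres_one : presented := pi GOne.

Lemma pres_ind (P : presented -> Prop) : (forall t, P (pi t)) -> forall x, P x.
Proof. by move=> H x; rewrite -[x](@reprK _ {eq_quot gterm_equiv}). Qed.

Lemma pres_mulE u v : pres_mul (pi u) (pi v) = pi (GMul u v).
Proof. by apply/pres_eqP => G f Rf /=; rewrite !geval_repr. Qed.
Lemma pres_invE u : pres_inv (pi u) = pi (GInv u).
Proof. by apply/pres_eqP => G f Rf /=; rewrite !geval_repr. Qed.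

Fact pres_mulA : associative pres_mul.
Proof.
elim/pres_ind=> x; elim/pres_ind=> y; elim/pres_ind=> z.
by rewrite !pres_mulE; apply/pres_eqP => G f Rf /=; rewrite mulgA.
Qed.
Fact pres_mul1 : left_id pres_one pres_mul.
Proof.
by elim/pres_ind=> x; rewrite pres_mulE; apply/pres_eqP=> G f _ /=; rewrite mul1g.
Qed.
Fact pres_mulr1 : right_id pres_one pres_mul.
Proof.
by elim/pres_ind=> x; rewrite pres_mulE; apply/pres_eqP=> G f _ /=; rewrite mulg1.
Qed.
Fact pres_mulV : left_inverse pres_one pres_inv pres_mul.
Proof.
elim/pres_ind=> x; rewrite pres_invE pres_mulE.
by apply/pres_eqP=> G f _ /=; rewrite mulVg.
Qed.
Fact pres_mulrV : right_inverse pres_one pres_inv pres_mul.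
Proof.
elim/pres_ind=> x; rewrite pres_invE pres_mulE.
by apply/pres_eqP=> G f _ /=; rewrite mulgV.
Qed.
HB.instance Definition _ :=
  isGroup.Build presented pres_mulA pres_mul1 pres_mulr1 pres_mulV pres_mulrV.

Definition pres_gen (x : T) : presented := pi (GVar x).

Lemma geval_pres_gen t : geval pres_gen t = pi t.
Proof.
elim: t => //= [u -> v ->|u ->]; [exact: pres_mulE | exact: pres_invE].
Qed.

Lemma pres_genP : satisfies pres_gen.
Proof. by move=> u v Ruv; rewrite !geval_pres_gen; apply/pres_eqP => G f; apply. Qed.

Definition pres_lift (G : groupType) (f : T -> G) (_ : satisfies f)
  (x : presented) : G := geval f (rep x).

Section Lift.
Variables (G : groupType) (f : T -> G) (Rf : satisfies f).

Fact pres_lift_mul : {morph pres_lift Rf : x y / (x * y)%g}.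
Proof.
elim/pres_ind=> x; elim/pres_ind=> y.
by rewrite [(_ * _)%g]pres_mulE /pres_lift !geval_repr.
Qed.
HB.instance Definition _ := isMultiplicative.Build presented G (pres_lift Rf) pres_lift_mul.
Fact pres_lift_one : pres_lift Rf 1%g = 1%g.
Proof. by rewrite /pres_lift geval_repr. Qed.
HB.instance Definition _ :=
  Multiplicative_isUMagmaMorphism.Build presented G (pres_lift Rf) pres_lift_one.

Lemma pres_lift_gen x : pres_lift Rf (pres_gen x) = f x.
Proof. exact: geval_repr. Qed.
End Lift.

Lemma morph_geval (G H : groupType) (h : G -> H) (f : T -> G) t :
  {morph h : x y / (x * y)%g} -> h (geval f t) = geval (h \o f) t.
Proof.
move=> hM; have h1 : h 1%g = 1%g by apply: (@mulgI _ (h 1%g)); rewrite -hM !mulg1.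
have hV x : h (x^-1)%g = (h x)^-1%g.
  by apply: (@mulgI _ (h x)); rewrite -hM !mulgV.
by elim: t => //= [u <- v <-|u <-]; rewrite ?hM ?hV.
Qed.

Lemma pres_hom_eq (G : groupType) (h k : presented -> G) :
  {morph h : x y / (x * y)%g} -> {morph k : x y / (x * y)%g} ->
  (forall x, h (pres_gen x) = k (pres_gen x)) -> h =1 k.
Proof.
move=> hM kM hk; elim/pres_ind=> t; rewrite -geval_pres_gen !morph_geval //.
by elim: t => //= [u -> v ->|u ->].
Qed.

End Presentation.

Section Bijections.
Variable T : Type.

Record bij := Bij {
  bij_fun :> T -> T; bij_inv : T -> T;
  bijK : cancel bij_fun bij_inv; bijKV : cancel bij_inv bij_fun }.

HB.instance Definition _ := gen_eqMixin bij.
HB.instance Definition _ := gen_choiceMixin bij.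

Lemma bijP (f g : bij) : f =1 g -> f = g.
Proof.
case: f g => f f' fK f'K [g g' gK g'K] /= fg.
have {}fg : f = g by apply/funext.
have fg' : f' = g'.
  by apply/funext => x; rewrite -[x in LHS]g'K -fg fK.
by rewrite {}fg {}fg' in fK f'K gK g'K *; congr Bij; exact: Prop_irrelevance.
Qed.

Definition bij_one : bij := @Bij id id (fun=> erefl) (fun=> erefl).
Definition bij_mul (f g : bij) : bij :=
  Bij (can_comp (bijK f) (bijK g)) (can_comp (bijKV g) (bijKV f)).
Definition bij_opp (f : bij) : bij := Bij (bijKV f) (bijK f).

Fact bij_mulA : associative bij_mul. Proof. by move=> f g h; exact: bijP. Qed.
Fact bij_mul1 : left_id bij_one bij_mul. Proof. by move=> f; exact: bijP. Qed.
Fact bij_mulr1 : right_id bij_one bij_mul. Proof. by move=> f; exact: bijP. Qed.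
Fact bij_mulV : left_inverse bij_one bij_opp bij_mul.
Proof. by move=> f; apply: bijP => x /=; rewrite bijK. Qed.
Fact bij_mulrV : right_inverse bij_one bij_opp bij_mul.
Proof. by move=> f; apply: bijP => x /=; rewrite bijKV. Qed.
HB.instance Definition _ :=
  isGroup.Build bij bij_mulA bij_mul1 bij_mulr1 bij_mulV bij_mulrV.

Lemma bij_mulE (f g : bij) x : (f * g)%g x = f (g x). Proof. by []. Qed.
Lemma bij_invE (f : bij) x : (f^-1)%g x = bij_inv f x. Proof. by []. Qed.
Lemma bij_oneE x : (1%g : bij) x = x. Proof. by []. Qed.
End Bijections.

Section GroupAut.
Variable G : groupType.

Definition is_gaut : {pred bij G} :=
  fun f => `[< {morph f : x y / (x * y)%g} >].

Fact is_gaut_closed : group_closed is_gaut.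
Proof.
split; first exact/asboolP.
move=> f g /asboolP fM /asboolP gM; apply/asboolP => x y.
rewrite -!/(f (bij_inv g _)) -fM; congr (f _).
by apply: (can_inj (bijK g)); rewrite gM !bijKV.
Qed.

Definition gaut : Type := {f : bij G | is_gaut f}.
HB.instance Definition _ := SubChoice.on gaut.
HB.instance Definition _ :=
  SubChoice_isSubGroup.Build (bij G) is_gaut gaut is_gaut_closed.
End GroupAut.

HB.mixin Record Lmodule_isLie (R : comNzRingType) L of GRing.Lmodule R L := {
  lie : L -> L -> L;
  lie_linearl : forall z, linear (lie^~ z);
  lie_linearr : forall z, linear (lie z);
  liexx : forall x, lie x x = 0;
  jacobi : forall x y z,
    lie x (lie y z) + lie y (lie z x) + lie z (lie x y) = 0 }.

#[short(type="lieAlgType")]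
HB.structure Definition LieAlgebra (R : comNzRingType) :=
  {L of GRing.Lmodule R L & Lmodule_isLie R L}.

Section LieTheory.
Variables (R : comNzRingType) (L : lieAlgType R).
Implicit Types x y z : L.

Lemma lieDl x y z : lie (x + y) z = lie x z + lie y z.
Proof. by have := lie_linearl z 1 x y; rewrite !scale1r. Qed.
Lemma lieDr x y z : lie z (x + y) = lie z x + lie z y.
Proof. by have := lie_linearr z 1 x y; rewrite !scale1r. Qed.
Lemma lie0l z : lie 0 z = 0.
Proof. by apply: (addrI (lie 0 z)); rewrite -lieDl !addr0. Qed.
Lemma lie0r z : lie z 0 = 0.
Proof. by apply: (addrI (lie z 0)); rewrite -lieDr !addr0. Qed.
Lemma lieZl a x z : lie (a *: x) z = a *: lie x z.
Proof. by have := lie_linearl z a x 0; rewrite lie0l !addr0. Qed.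
Lemma lieZr a x z : lie z (a *: x) = a *: lie z x.
Proof. by have := lie_linearr z a x 0; rewrite lie0r !addr0. Qed.
Lemma lieBl x y z : lie (x - y) z = lie x z - lie y z.
Proof. by rewrite -scaleN1r lieDl lieZl scaleN1r. Qed.
Lemma lieBr x y z : lie z (x - y) = lie z x - lie z y.
Proof. by rewrite -scaleN1r lieDr lieZr scaleN1r. Qed.
Lemma lieC x y : lie x y = - lie y x.
Proof.
apply/eqP; rewrite -addr_eq0; have := liexx (x + y).
by rewrite lieDl !lieDr !liexx add0r addr0 => ->.
Qed.

(* lcs m is the term of index m.+1 of the lower central series:
   lcs 0 = L, lcs m.+1 = [L, lcs m]. *)
Fixpoint lcs (m : nat) (x : L) : Prop :=
  if m is m'.+1 then
    exists s : seq (L * L),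
      (forall p, p \in s -> lcs m' p.2) /\ x = \sum_(p <- s) lie p.1 p.2
  else True.

Lemma lcs0 m : lcs m 0.
Proof. by case: m => [//|m]; exists [::]; rewrite big_nil. Qed.
Lemma lcsD m x y : lcs m x -> lcs m y -> lcs m (x + y).
Proof.
case: m => [//|m] /= [s [sm ->]] [t [tm ->]]; exists (s ++ t).
by rewrite big_cat; split=> // p; rewrite mem_cat => /orP[/sm|/tm].
Qed.
Lemma lcsZ m a x : lcs m x -> lcs m (a *: x).
Proof.
case: m => [//|m] /= [s [sm ->]]; exists [seq (a *: p.1, p.2) | p <- s].
rewrite big_map scaler_sumr; split; first by move=> _ /mapP[p /sm pm ->].
by apply: eq_bigr => p _; rewrite lieZl.
Qed.
Lemma lcsN m x : lcs m x -> lcs m (- x).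
Proof. by rewrite -scaleN1r; exact: lcsZ. Qed.
Lemma lcsB m x y : lcs m x -> lcs m y -> lcs m (x - y).
Proof. by move=> xm ym; apply/lcsD/lcsN. Qed.
Lemma lcs_le m x : lcs m.+1 x -> lcs m x.
Proof.
elim: m x => [//|m IH] x [s [sm ->]]; exists s; split=> // p ps.
exact/IH/sm.
Qed.
Lemma lcs_lier m x y : lcs m y -> lcs m (lie x y).
Proof.
move=> ym; apply: lcs_le; exists [:: (x, y)].
by split=> [p|]; rewrite ?big_seq1 // inE => /eqP->.
Qed.
Lemma lcs_liel m x y : lcs m x -> lcs m (lie x y).
Proof. by move=> xm; rewrite lieC; apply/lcsN/lcs_lier. Qed.

Section Quotient.
Variable m : nat.

Definition lcs_eqv (x y : L) : bool := `[< lcs m (x - y) >].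

Lemma lcs_eqv_is_equiv : equiv_class_of lcs_eqv.
Proof.
split=> [x|x y|y x z]; first by apply/asboolP; rewrite subrr; exact: lcs0.
  by apply/asboolP/asboolP => /lcsN; rewrite opprB.
move=> /asboolP xy /asboolP yz; apply/asboolP.
by rewrite -(subrKA y); exact: lcsD.
Qed.

Canonical lcs_equiv := EquivRelPack lcs_eqv_is_equiv.

(* L / L^{>= m+1} *)
Definition lieq : Type := {eq_quot lcs_equiv}.
HB.instance Definition _ := Choice.on lieq.

Definition lieq_pi (x : L) : lieq := \pi_{eq_quot lcs_equiv} x.
Definition lieq_repr (x : lieq) : L := repr (x : {eq_quot lcs_equiv}).

Lemma lieq_reprK : cancel lieq_repr lieq_pi. Proof. exact: reprK. Qed.
Lemma lieq_eqP x y : lieq_pi x = lieq_pi y <-> lcs m (x - y).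
Proof. by split=> [/eqmodP/asboolP //|xy]; apply/eqmodP/asboolP. Qed.
Lemma lieq_ind (P : lieq -> Prop) :
  (forall x, P (lieq_pi x)) -> forall x : lieq, P x.
Proof. by move=> H x; rewrite -[x]lieq_reprK. Qed.
Lemma lcs_repr x : lcs m (lieq_repr (lieq_pi x) - x).
Proof. by apply/lieq_eqP; rewrite lieq_reprK. Qed.

Definition lieq_add (x y : lieq) := lieq_pi (lieq_repr x + lieq_repr y).
Definition lieq_opp (x : lieq) := lieq_pi (- lieq_repr x).
Definition lieq_scale (a : R) (x : lieq) := lieq_pi (a *: lieq_repr x).
Definition lieq_lie (x y : lieq) := lieq_pi (lie (lieq_repr x) (lieq_repr y)).

Lemma lieq_addE x y : lieq_add (lieq_pi x) (lieq_pi y) = lieq_pi (x + y).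
Proof. by apply/lieq_eqP; rewrite opprD addrACA; apply: lcsD; exact: lcs_repr. Qed.
Lemma lieq_oppE x : lieq_opp (lieq_pi x) = lieq_pi (- x).
Proof. by apply/lieq_eqP; rewrite -opprD; apply/lcsN/lcs_repr. Qed.
Lemma lieq_scaleE a x : lieq_scale a (lieq_pi x) = lieq_pi (a *: x).
Proof. by apply/lieq_eqP; rewrite -scalerBr; apply/lcsZ/lcs_repr. Qed.
Lemma lieq_lieE x y : lieq_lie (lieq_pi x) (lieq_pi y) = lieq_pi (lie x y).
Proof.
apply/lieq_eqP; rewrite -(subrKA (lie x (lieq_repr (lieq_pi y)))) -lieBl -lieBr.
by apply: lcsD; [apply: lcs_liel | apply: lcs_lier]; exact: lcs_repr.
Qed.

Fact lieq_addA : associative lieq_add.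
Proof.
elim/lieq_ind=> x; elim/lieq_ind=> y; elim/lieq_ind=> z.
by rewrite !lieq_addE addrA.
Qed.
Fact lieq_addC : commutative lieq_add.
Proof. by elim/lieq_ind=> x; elim/lieq_ind=> y; rewrite !lieq_addE addrC. Qed.
Fact lieq_add0 : left_id (lieq_pi 0) lieq_add.
Proof. by elim/lieq_ind=> x; rewrite lieq_addE add0r. Qed.
Fact lieq_addN : left_inverse (lieq_pi 0) lieq_opp lieq_add.
Proof. by elim/lieq_ind=> x; rewrite lieq_oppE lieq_addE addNr. Qed.
HB.instance Definition _ := GRing.isZmodule.Build lieq
  lieq_addA lieq_addC lieq_add0 lieq_addN.

Lemma lieq_piD x y : lieq_pi (x + y) = lieq_pi x + lieq_pi y.
Proof. by rewrite [RHS]lieq_addE. Qed.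

Fact lieq_scaleA a b (x : lieq) : lieq_scale a (lieq_scale b x) = lieq_scale (a * b) x.
Proof. by elim/lieq_ind: x => x; rewrite !lieq_scaleE scalerA. Qed.
Fact lieq_scale1 : left_id 1 lieq_scale.
Proof. by elim/lieq_ind=> x; rewrite lieq_scaleE scale1r. Qed.
Fact lieq_scaleDr : right_distributive lieq_scale +%R.
Proof.
move=> a; elim/lieq_ind=> x; elim/lieq_ind=> y.
by rewrite -lieq_piD !lieq_scaleE scalerDr lieq_piD.
Qed.
Fact lieq_scaleDl (x : lieq) : {morph lieq_scale^~ x : a b / a + b}.
Proof.
by move=> a b; elim/lieq_ind: x => x; rewrite !lieq_scaleE scalerDl lieq_piD.
Qed.
HB.instance Definition _ := GRing.Zmodule_isLmodule.Build R lieq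
  lieq_scaleA lieq_scale1 lieq_scaleDr lieq_scaleDl.

Lemma lieq_piZ a x : lieq_pi (a *: x) = a *: lieq_pi x.
Proof. by rewrite [RHS]lieq_scaleE. Qed.

Fact lieq_pi_linear : linear lieq_pi.
Proof. by move=> a x y; rewrite lieq_piD lieq_piZ. Qed.
HB.instance Definition _ := GRing.isLinear.Build R L lieq _ lieq_pi lieq_pi_linear.

Fact lieq_linearl (z : lieq) : linear (lieq_lie^~ z).
Proof.
move=> a; elim/lieq_ind: z => z; elim/lieq_ind=> x; elim/lieq_ind=> y.
by rewrite -linearP /= !lieq_lieE -linearP lie_linearl.
Qed.
Fact lieq_linearr (z : lieq) : linear (lieq_lie z).
Proof.
move=> a; elim/lieq_ind: z => z; elim/lieq_ind=> x; elim/lieq_ind=> y.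
by rewrite -linearP /= !lieq_lieE -linearP lie_linearr.
Qed.
Fact lieq_liexx (x : lieq) : lieq_lie x x = 0.
Proof. by elim/lieq_ind: x => x; rewrite lieq_lieE liexx linear0. Qed.
Fact lieq_jacobi (x y z : lieq) :
  lieq_lie x (lieq_lie y z) + lieq_lie y (lieq_lie z x) +
  lieq_lie z (lieq_lie x y) = 0.
Proof.
elim/lieq_ind: x => x; elim/lieq_ind: y => y; elim/lieq_ind: z => z.
by rewrite !lieq_lieE -!lieq_piD jacobi linear0.
Qed.
HB.instance Definition _ := Lmodule_isLie.Build R lieq
  lieq_linearl lieq_linearr lieq_liexx lieq_jacobi.

Lemma lieq_piL x y : lieq_pi (lie x y) = lie (lieq_pi x) (lieq_pi y).
Proof. by rewrite [RHS]lieq_lieE. Qed.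

End Quotient.

(* L / L^{>= m+2} -> L / L^{>= m+1} *)
Definition lieq_proj m (x : lieq m.+1) : lieq m := lieq_pi m (lieq_repr x).

Lemma lieq_projE m x : lieq_proj (lieq_pi m.+1 x) = lieq_pi m x.
Proof. by apply/lieq_eqP/lcs_le/lcs_repr. Qed.
Fact lieq_proj_linear m : linear (@lieq_proj m).
Proof.
by move=> a; elim/lieq_ind=> x; elim/lieq_ind=> y; rewrite -linearP !lieq_projE linearP.
Qed.
HB.instance Definition _ m :=
  GRing.isLinear.Build R (lieq m.+1) (lieq m) _ (@lieq_proj m) (@lieq_proj_linear m).

End LieTheory.

Arguments lieq {R} L m.
Arguments lieq_pi {R L} m x.
Arguments lieq_proj {R L} m x.

Section Tensor.
Variables (V : lmodType rat) (K : comAlgType rat).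

Definition balanced (A : zmodType) (b : V -> K -> A) : Prop :=
  [/\ forall c, {morph b^~ c : v w / v + w},
      forall v, {morph b v : c d / c + d}
    & forall (a : rat) v c, b (a *: v) c = b v (a *: c)].

Definition bsum (A : zmodType) (b : V -> K -> A) (s : seq (V * K)) : A :=
  \sum_(p <- s) b p.1 p.2.

(* Two formal sums of pure tensors are equal in the tensor product over Q iff
   every balanced biadditive map takes the same value on them. *)
Definition tens_eqv (s t : seq (V * K)) : bool :=
  `[< forall (A : zmodType) (b : V -> K -> A),
        balanced b -> bsum b s = bsum b t >].

Lemma tens_eqv_is_equiv : equiv_class_of tens_eqv.
Proof.
split=> [u|u v|v u w]; first exact/asboolP.
  by apply/asboolP/asboolP => uv A b bb; rewrite uv.
by move=> /asboolP uv /asboolP vw; apply/asboolP => A b bb; rewrite uv ?vw.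
Qed.

Canonical tens_equiv := EquivRelPack tens_eqv_is_equiv.

Definition tens : Type := {eq_quot tens_equiv}.
HB.instance Definition _ := Choice.on tens.

Definition tens_pi (s : seq (V * K)) : tens := \pi_{eq_quot tens_equiv} s.
Definition tens_repr (x : tens) : seq (V * K) := repr (x : {eq_quot tens_equiv}).

Lemma tens_reprK : cancel tens_repr tens_pi. Proof. exact: reprK. Qed.
Lemma tens_eqP s t : tens_pi s = tens_pi t <->
  forall (A : zmodType) (b : V -> K -> A), balanced b -> bsum b s = bsum b t.
Proof. by split=> [/eqmodP/asboolP //|xy]; apply/eqmodP/asboolP. Qed.
Lemma tens_pi_ind (P : tens -> Prop) :
  (forall s, P (tens_pi s)) -> forall x, P x.
Proof. by move=> H x; rewrite -[x]tens_reprK. Qed.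

Definition tens_lift (A : zmodType) (b : V -> K -> A) (x : tens) : A :=
  bsum b (tens_repr x).

Lemma tens_liftE (A : zmodType) (b : V -> K -> A) s :
  balanced b -> tens_lift b (tens_pi s) = bsum b s.
Proof.
have /tens_eqP e : tens_pi (tens_repr (tens_pi s)) = tens_pi s.
  by rewrite tens_reprK.
exact: e.
Qed.

Definition tens_add (x y : tens) := tens_pi (tens_repr x ++ tens_repr y).
Definition tens_opp (x : tens) := tens_pi [seq (- p.1, p.2) | p <- tens_repr x].

Lemma bsum_cat (A : zmodType) (b : V -> K -> A) s t :
  bsum b (s ++ t) = bsum b s + bsum b t.
Proof. by rewrite /bsum big_cat. Qed.

Lemma bsum_opp (A : zmodType) (b : V -> K -> A) s : balanced b ->
  bsum b [seq (- p.1, p.2) | p <- s] = - bsum b s.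
Proof.
case=> bl br bq; rewrite /bsum big_map -sumrN; apply: eq_bigr => p _ /=.
apply: (addrI (b p.1 p.2)); rewrite -bl !subrr.
by apply: (addrI (b 0 p.2)); rewrite -bl !addr0.
Qed.

Lemma bsum_repr (A : zmodType) (b : V -> K -> A) s : balanced b ->
  bsum b (tens_repr (tens_pi s)) = bsum b s.
Proof. exact: tens_liftE. Qed.

Lemma tens_addE s t : tens_add (tens_pi s) (tens_pi t) = tens_pi (s ++ t).
Proof. by apply/tens_eqP => A b bb; rewrite !bsum_cat !bsum_repr. Qed.
Lemma tens_oppE s :
  tens_opp (tens_pi s) = tens_pi [seq (- p.1, p.2) | p <- s].
Proof. by apply/tens_eqP => A b bb; rewrite !bsum_opp ?bsum_repr. Qed.

Fact tens_addA : associative tens_add.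
Proof.
elim/tens_pi_ind=> x; elim/tens_pi_ind=> y; elim/tens_pi_ind=> z.
by rewrite !tens_addE catA.
Qed.
Fact tens_addC : commutative tens_add.
Proof.
elim/tens_pi_ind=> x; elim/tens_pi_ind=> y; rewrite !tens_addE.
by apply/tens_eqP => A b bb; rewrite !bsum_cat addrC.
Qed.
Fact tens_add0 : left_id (tens_pi [::]) tens_add.
Proof. by elim/tens_pi_ind=> x; rewrite tens_addE. Qed.
Fact tens_addN : left_inverse (tens_pi [::]) tens_opp tens_add.
Proof.
elim/tens_pi_ind=> x; rewrite tens_oppE tens_addE.
by apply/tens_eqP => A b bb; rewrite bsum_cat bsum_opp // addNr /bsum big_nil.
Qed.
HB.instance Definition _ := GRing.isZmodule.Build tens
  tens_addA tens_addC tens_add0 tens_addN.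

Definition pure (v : V) (c : K) : tens := tens_pi [:: (v, c)].

Lemma pure_balanced : balanced pure.
Proof.
split=> [c v w|v c d|a v c]; rewrite ?[RHS]tens_addE; apply/tens_eqP => A b;
  by case=> bl br bq; rewrite /bsum /= !big_cons ?big_nil /= ?addr0 ?bl ?br ?bq.
Qed.

Lemma pureDl c v w : pure (v + w) c = pure v c + pure w c.
Proof. by case: pure_balanced => + _ _; apply. Qed.
Lemma pureDr v c d : pure v (c + d) = pure v c + pure v d.
Proof. by case: pure_balanced => _ + _; apply. Qed.
Lemma pureZ a v c : pure (a *: v) c = pure v (a *: c).
Proof. by case: pure_balanced => _ _; apply. Qed.

Lemma tens_pi_sum s : tens_pi s = \sum_(p <- s) pure p.1 p.2.
Proof.
elim: s => [|[v c] s IH]; first by rewrite big_nil.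
by rewrite big_cons -IH [RHS]tens_addE.
Qed.

Lemma pure0 c : pure 0 c = 0.
Proof. by apply: (addrI (pure 0 c)); rewrite -pureDl !addr0. Qed.

Lemma tens_ind (P : tens -> Prop) :
  (forall v c, P (pure v c)) -> (forall x y, P x -> P y -> P (x + y)) ->
  forall x, P x.
Proof.
move=> Pp PD; elim/tens_pi_ind=> s; rewrite tens_pi_sum.
elim/big_ind: _ => [|//|p _]; last exact: Pp.
by rewrite -(pure0 0); exact: Pp.
Qed.

Section TensLift.
Variables (A : zmodType) (b : V -> K -> A).
Hypothesis bb : balanced b.

Lemma tens_lift_pure v c : tens_lift b (pure v c) = b v c.
Proof. by rewrite tens_liftE // /bsum big_seq1. Qed.
Lemma tens_liftD : {morph tens_lift b : x y / x + y}.
Proof.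
elim/tens_pi_ind=> x; elim/tens_pi_ind=> y.
by rewrite [_ + _]tens_addE !tens_liftE // bsum_cat.
Qed.
Lemma tens_lift0 : tens_lift b 0 = 0.
Proof. by rewrite tens_liftE // /bsum big_nil. Qed.
End TensLift.

Definition tens_scale (c : K) (x : tens) : tens :=
  tens_lift (fun v d => pure v (c * d)) x.

Lemma tens_scale_balanced c : balanced (fun v d => pure v (c * d)).
Proof.
split=> [d v w|v d e|a v d]; rewrite ?pureDl ?mulrDr ?pureDr //.
by rewrite pureZ scalerAr.
Qed.

Lemma tens_scale_pure c v d : tens_scale c (pure v d) = pure v (c * d).
Proof. exact: (tens_lift_pure (tens_scale_balanced c)). Qed.
Fact tens_scaleDr : right_distributive tens_scale +%R.
Proof. by move=> c x y; exact: (tens_liftD (tens_scale_balanced c)). Qed.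

Fact tens_scaleA a b x : tens_scale a (tens_scale b x) = tens_scale (a * b) x.
Proof.
elim/tens_ind: x => [v c|x y IHx IHy]; first by rewrite !tens_scale_pure mulrA.
by rewrite !tens_scaleDr IHx IHy.
Qed.
Fact tens_scale1 : left_id 1 tens_scale.
Proof.
elim/tens_ind=> [v c|x y IHx IHy]; first by rewrite tens_scale_pure mul1r.
by rewrite tens_scaleDr IHx IHy.
Qed.
Fact tens_scaleDl x : {morph tens_scale^~ x : a b / a + b}.
Proof.
move=> a b; elim/tens_ind: x => [v c|x y IHx IHy].
  by rewrite !tens_scale_pure mulrDl pureDr.
by rewrite !tens_scaleDr IHx IHy addrACA.
Qed.
HB.instance Definition _ := GRing.Zmodule_isLmodule.Build K tens
  tens_scaleA tens_scale1 tens_scaleDr tens_scaleDl.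

Lemma scale_pure c v d : c *: pure v d = pure v (c * d).
Proof. exact: tens_scale_pure. Qed.

End Tensor.

Arguments pure {V K} v c.

Section TensorMap.
Variables (V W : lmodType rat) (K K' : comAlgType rat).
Variables (u : {linear V -> W}) (phi : {lrmorphism K -> K'}).

(* v (x) c |-> u v (x) phi c *)
Definition tens_map : tens V K -> tens W K' :=
  tens_lift (fun v c => pure (u v) (phi c)).

Lemma tens_map_balanced :
  balanced (fun v c => pure (u v) (phi c)).
Proof.
split=> [c v w|v c d|a v c]; first by rewrite linearD pureDl.
  by rewrite raddfD pureDr.
by rewrite !linearZ pureZ.
Qed.

Lemma tens_map_pure v c : tens_map (pure v c) = pure (u v) (phi c).
Proof. exact: (tens_lift_pure tens_map_balanced). Qed.
Lemma tens_mapD : {morph tens_map : x y / x + y}.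
Proof. exact: (tens_liftD tens_map_balanced). Qed.
Lemma tens_map0 : tens_map 0 = 0.
Proof. exact: (tens_lift0 tens_map_balanced). Qed.
Lemma tens_mapZ c x : tens_map (c *: x) = phi c *: tens_map x.
Proof.
elim/tens_ind: x => [v d|x y IHx IHy].
  by rewrite scale_pure !tens_map_pure scale_pure rmorphM.
by rewrite scalerDr !tens_mapD scalerDr IHx IHy.
Qed.

End TensorMap.

Section TensorLie.
Variables (L : lieAlgType rat) (K : comAlgType rat).

(* [x (x) c, y (x) d] = [x, y] (x) cd *)
Definition tens_lie (x y : tens L K) : tens L K :=
  tens_lift (fun v c => tens_lift (fun w d => pure (lie v w) (c * d)) y) x.

Lemma tens_lie_bal1 v c : balanced (fun w d => pure (lie v w) (c * d) : tens L K).
Proof.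
split=> [d w w'|w d e|a w d]; first by rewrite lieDr pureDl.
  by rewrite mulrDr pureDr.
by rewrite lieZr pureZ scalerAr.
Qed.

Lemma tens_lie_bal2 y : balanced
  (fun v c => tens_lift (fun w d => pure (lie v w) (c * d) : tens L K) y).
Proof.
have bD v c := tens_liftD (tens_lie_bal1 v c).
have bP v c := tens_lift_pure (tens_lie_bal1 v c).
split=> [c v w|v c d|a v c]; elim/tens_ind: y => [x e|y z IHy IHz].
- by rewrite !bP lieDl pureDl.
- by rewrite !bD IHy IHz addrACA.
- by rewrite !bP mulrDl pureDr.
- by rewrite !bD IHy IHz addrACA.
- by rewrite !bP lieZl pureZ scalerAl.
- by rewrite !bD IHy IHz.
Qed.

Lemma tens_lie_pure v c w d : tens_lie (pure v c) (pure w d) = pure (lie v w) (c * d).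
Proof.
by rewrite /tens_lie (tens_lift_pure (tens_lie_bal2 _)) (tens_lift_pure (tens_lie_bal1 _ _)).
Qed.
Lemma tens_lieDl z : {morph tens_lie^~ z : x y / x + y}.
Proof. exact: (tens_liftD (tens_lie_bal2 z)). Qed.
Lemma tens_lieDr z : {morph tens_lie z : x y / x + y}.
Proof.
move=> x y; elim/tens_ind: z => [v c|z w IHz IHw].
  by rewrite /tens_lie !(tens_lift_pure (tens_lie_bal2 _)) (tens_liftD (tens_lie_bal1 v c)).
by rewrite !tens_lieDl IHz IHw addrACA.
Qed.
Fact tens_lie_linearl z : linear (tens_lie^~ z).
Proof.
move=> a x y; rewrite tens_lieDl; congr (_ + _).
elim/tens_ind: x => [v c|x x' e e']; last by rewrite scalerDr !tens_lieDl e e' scalerDr.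
elim/tens_ind: z => [w d|z z' e e']; last by rewrite !tens_lieDr e e' scalerDr.
by rewrite scale_pure !tens_lie_pure scale_pure mulrA.
Qed.
Fact tens_lie_linearr z : linear (tens_lie z).
Proof.
move=> a x y; rewrite tens_lieDr; congr (_ + _).
elim/tens_ind: x => [v c|x x' e e']; last by rewrite scalerDr !tens_lieDr e e' scalerDr.
elim/tens_ind: z => [w d|z z' e e']; last by rewrite !tens_lieDl e e' scalerDr.
by rewrite scale_pure !tens_lie_pure scale_pure mulrCA.
Qed.
Lemma tens_lieC x y : tens_lie x y = - tens_lie y x.
Proof.
elim/tens_ind: x => [v c|x x' e e']; last by rewrite tens_lieDl tens_lieDr e e' opprD.
elim/tens_ind: y => [w d|y z e e']; last by rewrite tens_lieDl tens_lieDr e e' opprD.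
apply/eqP; rewrite !tens_lie_pure lieC mulrC -addr_eq0 -pureDl addNr.
by rewrite pure0.
Qed.
Fact tens_liexx x : tens_lie x x = 0.
Proof.
elim/tens_ind: x => [v c|y z yy zz]; first by rewrite tens_lie_pure liexx pure0.
by rewrite tens_lieDl !tens_lieDr yy zz add0r addr0 tens_lieC addNr.
Qed.
Fact tens_jacobi x y z :
  tens_lie x (tens_lie y z) + tens_lie y (tens_lie z x) +
  tens_lie z (tens_lie x y) = 0.
Proof.
have D6 (a b c a' b' c' : tens L K) : a + b + c = 0 -> a' + b' + c' = 0 ->
    (a + a') + (b + b') + (c + c') = 0.
  by move=> abc abc'; rewrite (addrACA a) (addrACA (a + b)) abc abc' addr0.
elim/tens_ind: x => [v c|x x' e e']; last first.
  by rewrite !(tens_lieDl, tens_lieDr); exact: D6.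
elim/tens_ind: y => [w d|y y' e e']; last first.
  by rewrite !(tens_lieDl, tens_lieDr); exact: D6.
elim/tens_ind: z => [u b|z z' e e']; last first.
  by rewrite !(tens_lieDl, tens_lieDr); exact: D6.
rewrite !tens_lie_pure (mulrCA d) (mulrC d c) (mulrC b (c * d)) -!mulrA (mulrC d b).
by rewrite (mulrC b d) -!pureDl jacobi pure0.
Qed.
HB.instance Definition _ := Lmodule_isLie.Build K (tens L K)
  tens_lie_linearl tens_lie_linearr tens_liexx tens_jacobi.

Lemma lie_pure (v w : L) (c d : K) :
  lie (pure v c) (pure w d) = pure (lie v w) (c * d) :> tens L K.
Proof. exact: tens_lie_pure. Qed.

End TensorLie.

Local Notation tproj K m := (@tens_map _ _ K K (lieq_proj m) idfun).

Section Extension.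
Variables (L : lieAlgType rat) (K : comAlgType rat).

(* L (^x) K = lim_m (L / L^{>= m+1}) (x) K *)
Record ext := Ext {
  ext_at :> forall m, tens (lieq L m) K;
  ext_compat : forall m, tproj K m (ext_at m.+1) = ext_at m }.

HB.instance Definition _ := gen_eqMixin ext.
HB.instance Definition _ := gen_choiceMixin ext.

Lemma extP (x y : ext) : (forall m, x m = y m) -> x = y.
Proof.
case: x y => x xP [y yP] /= xy; have {}xy : x = y by apply: functional_extensionality_dep.
by rewrite {}xy in xP *; congr Ext; exact: Prop_irrelevance.
Qed.

Lemma tens_mapN (V W : lmodType rat) (K1 K2 : comAlgType rat) (u : {linear V -> W})
  (phi : {lrmorphism K1 -> K2}) : {morph tens_map u phi : x / - x}.
Proof.
by move=> x; rewrite -scaleN1r tens_mapZ rmorphN1 scaleN1r.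
Qed.

Lemma tens_map_lie (L1 L2 : lieAlgType rat) (K1 K2 : comAlgType rat)
    (u : {linear L1 -> L2}) (phi : {lrmorphism K1 -> K2}) :
  {morph u : x y / lie x y} -> {morph tens_map u phi : x y / lie x y}.
Proof.
move=> uL x y; elim/tens_ind: x => [v c|x x' e e']; last first.
  by rewrite lieDl !tens_mapD lieDl e e'.
elim/tens_ind: y => [w d|y y' e e']; last by rewrite lieDr !tens_mapD lieDr e e'.
by rewrite lie_pure !tens_map_pure lie_pure uL rmorphM.
Qed.

Lemma lieq_proj_lie m : {morph @lieq_proj _ L m : x y / lie x y}.
Proof.
by elim/lieq_ind=> x; elim/lieq_ind=> y; rewrite -lieq_piL !lieq_projE -lieq_piL.
Qed.

Definition ext_zero := @Ext (fun=> 0) (fun m => tens_map0 _ _).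

Fact ext_add_subproof (x y : ext) m :
  tproj K m (x m.+1 + y m.+1) = x m + y m.
Proof. by rewrite tens_mapD !ext_compat. Qed.
Definition ext_add x y := Ext (ext_add_subproof x y).
Fact ext_opp_subproof (x : ext) m :
  tproj K m (- x m.+1) = - x m.
Proof. by rewrite tens_mapN ext_compat. Qed.
Definition ext_opp x := Ext (ext_opp_subproof x).
Fact ext_scale_subproof c (x : ext) m :
  tproj K m (c *: x m.+1) = c *: x m.
Proof. by rewrite tens_mapZ ext_compat. Qed.
Definition ext_scale c x := Ext (ext_scale_subproof c x).
Fact ext_lie_subproof (x y : ext) m :
  tproj K m (lie (x m.+1) (y m.+1)) = lie (x m) (y m).
Proof. by rewrite tens_map_lie ?ext_compat //; exact: lieq_proj_lie. Qed.
Definition ext_lie x y := Ext (ext_lie_subproof x y).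

Fact ext_addA : associative ext_add.
Proof. by move=> x y z; apply: extP => m /=; rewrite addrA. Qed.
Fact ext_addC : commutative ext_add.
Proof. by move=> x y; apply: extP => m /=; rewrite addrC. Qed.
Fact ext_add0 : left_id ext_zero ext_add.
Proof. by move=> x; apply: extP => m /=; rewrite add0r. Qed.
Fact ext_addN : left_inverse ext_zero ext_opp ext_add.
Proof. by move=> x; apply: extP => m /=; rewrite addNr. Qed.
HB.instance Definition _ := GRing.isZmodule.Build ext
  ext_addA ext_addC ext_add0 ext_addN.

Fact ext_scaleA a b x : ext_scale a (ext_scale b x) = ext_scale (a * b) x.
Proof. by apply: extP => m /=; rewrite scalerA. Qed.
Fact ext_scale1 : left_id 1 ext_scale.
Proof. by move=> x; apply: extP => m /=; rewrite scale1r. Qed.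
Fact ext_scaleDr : right_distributive ext_scale +%R.
Proof. by move=> a x y; apply: extP => m /=; rewrite scalerDr. Qed.
Fact ext_scaleDl x : {morph ext_scale^~ x : a b / a + b}.
Proof. by move=> a b; apply: extP => m /=; rewrite scalerDl. Qed.
HB.instance Definition _ := GRing.Zmodule_isLmodule.Build K ext
  ext_scaleA ext_scale1 ext_scaleDr ext_scaleDl.

Fact ext_linearl z : linear (ext_lie^~ z).
Proof. by move=> a x y; apply: extP => m; exact: lie_linearl. Qed.
Fact ext_linearr z : linear (ext_lie z).
Proof. by move=> a x y; apply: extP => m; exact: lie_linearr. Qed.
Fact ext_liexx x : ext_lie x x = 0.
Proof. by apply: extP => m; exact: liexx. Qed.
Fact ext_jacobi x y z :
  ext_lie x (ext_lie y z) + ext_lie y (ext_lie z x) + ext_lie z (ext_lie x y) = 0.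
Proof. by apply: extP => m; exact: jacobi. Qed.
HB.instance Definition _ := Lmodule_isLie.Build K ext
  ext_linearl ext_linearr ext_liexx ext_jacobi.

Lemma ext_atD (x y : ext) m : (x + y) m = x m + y m. Proof. by []. Qed.
Lemma ext_atB (x y : ext) m : (x - y) m = x m - y m. Proof. by []. Qed.
Lemma ext_at0 m : (0 : ext) m = 0. Proof. by []. Qed.
Lemma ext_atZ c (x : ext) m : (c *: x) m = c *: x m. Proof. by []. Qed.
Lemma ext_at_lie (x y : ext) m : (lie x y) m = lie (x m) (y m). Proof. by []. Qed.

Lemma ext_at_le0 (x : ext) m p : (m <= p)%N -> x p = 0 -> x m = 0.
Proof.
move=> /subnKC <-; elim: (p - m)%N => [|k IH]; first by rewrite addn0.
by rewrite addnS => x0; apply: IH; rewrite -ext_compat x0 tens_map0.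
Qed.

Fact ext_of_subproof (x : L) m :
  tproj K m (pure (lieq_pi m.+1 x) 1) = pure (lieq_pi m x) 1.
Proof. by rewrite tens_map_pure /= lieq_projE. Qed.
(* the canonical map x |-> x (x) 1 *)
Definition ext_of (x : L) : ext := Ext (ext_of_subproof x).

Lemma ext_ofD : {morph ext_of : x y / x + y}.
Proof. by move=> x y; apply: extP => m /=; rewrite lieq_piD pureDl. Qed.
Lemma ext_ofZ a x : ext_of (a *: x) = a%:A *: ext_of x.
Proof. by apply: extP => m; rewrite ext_atZ /= lieq_piZ pureZ scale_pure mulr1. Qed.
Lemma ext_of_lie : {morph ext_of : x y / lie x y}.
Proof.
by move=> x y; apply: extP => m; rewrite ext_at_lie /= lieq_piL lie_pure mulr1.
Qed.
Lemma ext_of_lcs m x : lcs m x -> ext_of x m = 0.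
Proof.
move=> xm; have /= -> : lieq_pi m x = lieq_pi m 0 by apply/lieq_eqP; rewrite subr0.
by rewrite linear0 pure0.
Qed.

(* Continuity (at 0, for additive maps) for the inverse limit topology. *)
Definition ext_continuous (f : ext -> ext) : Prop :=
  forall m, exists p, forall x : ext, x p = 0 -> f x m = 0.

Definition ext_end (f : ext -> ext) : Prop :=
  [/\ linear f, {morph f : x y / lie x y} & ext_continuous f].

End Extension.

Arguments ext_of {L} K x.

Section ExtensionMap.
Variables (L : lieAlgType rat) (K K' : comAlgType rat).
Variable phi : {lrmorphism K -> K'}.

Fact ext_map_subproof (x : ext L K) m :
  tproj K' m (tens_map idfun phi (x m.+1)) =
  tens_map idfun phi (x m).
Proof.
rewrite -[x m]ext_compat; elim/tens_ind: (x m.+1) => [v c|y z e e'].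
  by rewrite !tens_map_pure.
by rewrite !tens_mapD e e'.
Qed.
Definition ext_map (x : ext L K) : ext L K' := Ext (ext_map_subproof x).

Lemma ext_map_of x : ext_map (ext_of K x) = ext_of K' x.
Proof. by apply: extP => m /=; rewrite tens_map_pure rmorph1. Qed.

Section BaseChange.
Variable f : ext L K -> ext L K.
Hypothesis f_end : ext_end f.

Let fD : {morph f : x y / x + y}.
Proof. by case: f_end => fL _ _ x y; have := fL 1 x y; rewrite !scale1r. Qed.
Let f0 : f 0 = 0.
Proof. by apply: (addrI (f 0)); rewrite -fD !addr0. Qed.
Let fZ a : {morph f : x / a *: x}.
Proof. by case: f_end => fL _ _ x; have := fL a x 0; rewrite f0 !addr0. Qed.
Let fB : {morph f : x y / x - y}.
Proof. by move=> x y; rewrite -scaleN1r fD fZ scaleN1r. Qed.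

Definition modulus m p := forall x : ext L K, x p = 0 -> f x m = 0.

(* v (x) c |-> c . phi (f (v (x) 1)) *)
Definition bc_at m p : tens (lieq L p) K' -> tens (lieq L m) K' :=
  tens_lift (fun v c => c *: tens_map idfun phi (f (ext_of K (lieq_repr v)) m)).

Let f_lcs m p x y : modulus m p -> lcs p (x - y) ->
  f (ext_of K x) m = f (ext_of K y) m.
Proof.
move=> mp xy; rewrite -[x](subrK y) ext_ofD fD ext_atD.
by rewrite (mp _ (ext_of_lcs _ xy)) add0r.
Qed.

Let bc_bal m p : modulus m p -> balanced
  (fun (v : lieq L p) c => c *: tens_map idfun phi (f (ext_of K (lieq_repr v)) m)).
Proof.
move=> mp; split=> [c v w|v c d|a v c]; last 2 first.
- by rewrite scalerDl.
- have -> : f (ext_of K (lieq_repr (a *: v))) m = f (ext_of K (a *: lieq_repr v)) m.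
    apply: (f_lcs mp); apply/lieq_eqP.
    by rewrite lieq_reprK lieq_piZ lieq_reprK.
  by rewrite ext_ofZ fZ ext_atZ tens_mapZ scalerA rmorph_alg -scalerAr mulr1.
have -> : f (ext_of K (lieq_repr (v + w))) m =
          f (ext_of K (lieq_repr v + lieq_repr w)) m.
  by apply: (f_lcs mp); apply/lieq_eqP; rewrite lieq_reprK lieq_piD !lieq_reprK.
by rewrite ext_ofD fD ext_atD tens_mapD scalerDr.
Qed.

Let bcD m p : modulus m p -> {morph @bc_at m p : x y / x + y}.
Proof. by move=> mp; exact: (tens_liftD (bc_bal mp)). Qed.
Let bc0 m p : modulus m p -> bc_at m (0 : tens (lieq L p) K') = 0.
Proof. by move=> mp; exact: (tens_lift0 (bc_bal mp)). Qed.
Let bcP m p v c : modulus m p ->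
  bc_at m (pure v c : tens (lieq L p) K') =
  c *: tens_map idfun phi (f (ext_of K (lieq_repr v)) m).
Proof. by move=> mp; exact: (tens_lift_pure (bc_bal mp)). Qed.
Let bcP' m p x c : modulus m p ->
  bc_at m (pure (lieq_pi p x) c : tens (lieq L p) K') =
  c *: tens_map idfun phi (f (ext_of K x) m).
Proof. by move=> mp; rewrite bcP // (f_lcs mp (lcs_repr p x)). Qed.
Let bcZ m p a : modulus m p -> {morph @bc_at m p : x / a *: x}.
Proof.
move=> mp; elim/tens_ind=> [v c|x y e e'].
  by rewrite scale_pure !bcP // scalerA.
by rewrite scalerDr !bcD // scalerDr e e'.
Qed.

Let modulus_le m p q : (p <= q)%N -> modulus m p -> modulus m q.
Proof. by move=> pq mp x /(ext_at_le0 pq)/mp. Qed.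
Let modulus_pred m p : modulus m.+1 p -> modulus m p.
Proof. by move=> mp x /mp; exact: ext_at_le0. Qed.

Let bc_proj m p (x : ext L K') : modulus m p ->
  bc_at m (x p.+1) = bc_at m (x p).
Proof.
move=> mp; have mp1 := modulus_le (leqnSn p) mp.
rewrite -[x p]ext_compat; elim/tens_ind: (x p.+1) => [v c|y z e e'].
  by elim/lieq_ind: v => v; rewrite tens_map_pure /= lieq_projE !bcP'.
by rewrite tens_mapD !bcD // e e'.
Qed.
Let bc_le m p q (x : ext L K') : modulus m p -> (p <= q)%N ->
  bc_at m (x q) = bc_at m (x p).
Proof.
move=> mp /subnKC <-; elim: (q - p)%N => [|k IH]; first by rewrite addn0.
by rewrite addnS bc_proj //; apply: modulus_le mp; exact: leq_addr.
Qed.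
Let bc_indep m p q (x : ext L K') : modulus m p -> modulus m q ->
  bc_at m (x p) = bc_at m (x q).
Proof.
move=> mp mq; rewrite -(bc_le x mp (leq_maxl p q)).
by rewrite -(bc_le x mq (leq_maxr p q)).
Qed.

Let N_ex m : exists p, modulus m p. Proof. by case: f_end => _ _; apply. Qed.
Definition bc_modulus m := projT1 (cid (N_ex m)).
Let N := bc_modulus.
Let NP m : modulus m (N m). Proof. exact: projT2 (cid (N_ex m)). Qed.

Fact base_change_subproof (x : ext L K') m :
  tproj K' m (bc_at m.+1 (x (N m.+1))) = bc_at m (x (N m)).
Proof.
rewrite (@bc_indep _ _ (N m.+1)) //; last exact: modulus_pred.
elim/tens_ind: (x (N m.+1)) => [v c|y z e e'].
  rewrite !bcP //; last exact: modulus_pred.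
  by rewrite tens_mapZ; congr (_ *: _); exact: (ext_compat (ext_map _)).
rewrite !bcD ?tens_mapD //; last exact: modulus_pred.
by rewrite e e'.
Qed.
Definition base_change_fun (x : ext L K') : ext L K' := Ext (base_change_subproof x).

Lemma base_change_at m p x : modulus m p -> base_change_fun x m = bc_at m (x p).
Proof. by move=> mp; exact: bc_indep. Qed.

Lemma base_change_end : ext_end base_change_fun.
Proof.
split=> [a x y|x y|m].
- by apply: extP => m; rewrite ext_atD ext_atZ /= bcD // bcZ.
- apply: extP => m; rewrite ext_at_lie /= -/(N m).
  elim/tens_ind: (x (N m)) => [v c|z z' e e']; last by rewrite lieDl !bcD // lieDl e e'.
  elim/tens_ind: (y (N m)) => [w d|z z' e e']; last by rewrite lieDr !bcD // lieDr e e'.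
  elim/lieq_ind: v => v; elim/lieq_ind: w => w; rewrite lie_pure -lieq_piL !bcP' //.
  rewrite lieZl lieZr scalerA -tens_map_lie // ext_of_lie.
  by case: f_end => _ -> _; rewrite ext_at_lie.
- exists (N m) => x /= ->; exact: bc0.
Qed.

Lemma base_change_map x : base_change_fun (ext_map x) = ext_map (f x).
Proof.
apply: extP => m /=; set p := N m; have mp : modulus m p by exact: NP.
pose s := tens_repr (x p).
pose z : ext L K := \sum_(i <- s) i.2 *: ext_of K (lieq_repr i.1).
have atS (I : Type) (r : seq I) (F : I -> ext L K) q :
    (\sum_(i <- r) F i) q = \sum_(i <- r) F i q.
  by elim/big_rec2: _ => // i y1 y2 _ <-.
have zx : z p = x p.
  rewrite -[x p]tens_reprK tens_pi_sum atS; apply: eq_bigr => i _.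
  by rewrite ext_atZ scale_pure mulr1 lieq_reprK.
have -> : f x m = f z m.
  rewrite -[x](subrK z) fD ext_atD mp ?add0r //.
  by rewrite ext_atB zx subrr.
rewrite -zx /z.
elim: s {z zx} => [|i r IH].
  by rewrite !big_nil f0 !ext_at0 !tens_map0 bc0.
rewrite !big_cons fD !ext_atD !tens_mapD bcD // IH; congr (_ + _).
rewrite fZ !ext_atZ !tens_mapZ bcZ //; congr (_ *: _).
by rewrite tens_map_pure rmorph1 bcP' // scale1r.
Qed.

End BaseChange.
End ExtensionMap.

Section ExtensionUniq.
Variables (L : lieAlgType rat) (K : comAlgType rat).

Lemma ext_map_id (x : ext L K) : ext_map idfun x = x.
Proof.
apply: extP => m /=; elim/tens_ind: (x m) => [v c|y z e e'].
  by rewrite tens_map_pure.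
by rewrite tens_mapD e e'.
Qed.

Lemma ext_end_eq (f g : ext L K -> ext L K) : ext_end f -> ext_end g ->
  (forall x, f (ext_of K x) = g (ext_of K x)) -> f =1 g.
Proof.
move=> fE gE fg x; rewrite -[f x]ext_map_id -[g x]ext_map_id.
rewrite -(base_change_map idfun fE) -(base_change_map idfun gE) ext_map_id.
apply: extP => m.
have [[_ _ /(_ m)[p fp]] [_ _ /(_ m)[q gq]]] := (fE, gE).
have fpq : modulus f m (maxn p q) by move=> y /(ext_at_le0 (leq_maxl _ _))/fp.
have gpq : modulus g m (maxn p q) by move=> y /(ext_at_le0 (leq_maxr _ _))/gq.
rewrite (base_change_at _ fE _ fpq) (base_change_at _ gE _ gpq).
by rewrite /bc_at; congr (tens_lift _ _); apply/funext => v; apply/funext => c; rewrite fg.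
Qed.

Lemma ext_end_id : ext_end (@id (ext L K)).
Proof. by split=> // m; exists m. Qed.

Lemma ext_end_comp (f g : ext L K -> ext L K) :
  ext_end f -> ext_end g -> ext_end (f \o g).
Proof.
move=> [fL fB fC] [gL gB gC]; split=> [a x y|x y|m] /=.
- by rewrite gL fL.
- by rewrite gB fB.
- by have [p fp] := fC m; have [q gq] := gC p; exists q => x /gq/fp.
Qed.

Definition is_ext_aut : {pred bij (ext L K)} :=
  fun f => `[< ext_end f /\ ext_end (bij_inv f) >].

Fact is_ext_aut_closed : group_closed is_ext_aut.
Proof.
split; first by apply/asboolP; split; exact: ext_end_id.
move=> f g /asboolP[fE f'E] /asboolP[gE g'E]; apply/asboolP.
by split; exact: ext_end_comp.
Qed.

(* Aut(L (^x) K): automorphisms of the topological K-Lie algebra L (^x) K *)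
Definition ext_aut : Type := {f : bij (ext L K) | is_ext_aut f}.
HB.instance Definition _ := SubChoice.on ext_aut.
HB.instance Definition _ :=
  SubChoice_isSubGroup.Build (bij (ext L K)) is_ext_aut ext_aut is_ext_aut_closed.

Definition ext_aut_fun (f : ext_aut) : ext L K -> ext L K := val f.

Lemma ext_autP (f g : ext_aut) :
  (forall x, ext_aut_fun f (ext_of K x) = ext_aut_fun g (ext_of K x)) -> f = g.
Proof.
move=> fg; apply/val_inj/bijP.
have /asboolP[fE _] := valP f; have /asboolP[gE _] := valP g.
exact: ext_end_eq.
Qed.

Lemma ext_aut_mulE (f g : ext_aut) x :
  ext_aut_fun (f * g)%g x = ext_aut_fun f (ext_aut_fun g x).
Proof. by []. Qed.

End ExtensionUniq.

Coercion ext_aut_fun : ext_aut >-> Funclass.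

Section AutBaseChange.
Variables (L : lieAlgType rat) (K K' : comAlgType rat).
Variable phi : {lrmorphism K -> K'}.

Lemma base_change_of (f : ext L K -> ext L K) (fE : ext_end f) x :
  base_change_fun phi fE (ext_of K' x) = ext_map phi (f (ext_of K x)).
Proof. by rewrite -(ext_map_of phi) base_change_map. Qed.

Lemma base_changeK (f g : ext L K -> ext L K) (fE : ext_end f) (gE : ext_end g) :
  cancel f g -> cancel (base_change_fun phi fE) (base_change_fun phi gE).
Proof.
move=> fK; apply: (@ext_end_eq _ _ (base_change_fun phi gE \o base_change_fun phi fE) id).
- by apply: ext_end_comp; exact: base_change_end.
- exact: ext_end_id.
- by move=> x /=; rewrite base_change_of base_change_map fK ext_map_of.
Qed.

Definition ext_autE (f : ext_aut L K) : ext_end f /\ ext_end (bij_inv (val f)) :=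
  elimT (asboolP _) (valP f).

Definition base_change_bij (f : ext_aut L K) : bij (ext L K') :=
  let: conj fE f'E := ext_autE f in
  Bij (base_changeK fE f'E (bijK (val f))) (base_changeK f'E fE (bijKV (val f))).

Fact base_change_aut_subproof (f : ext_aut L K) : is_ext_aut (base_change_bij f).
Proof.
rewrite /base_change_bij; case: (ext_autE f) => fE f'E.
by apply/asboolP; split; exact: base_change_end.
Qed.

Definition base_change (f : ext_aut L K) : ext_aut L K' :=
  exist _ (base_change_bij f) (base_change_aut_subproof f).

Lemma base_changeE (f : ext_aut L K) x :
  base_change f (ext_map phi x) = ext_map phi (f x).
Proof.
rewrite /base_change /ext_aut_fun /= /base_change_bij.
by case: (ext_autE f) => fE f'E /=; rewrite base_change_map.
Qed.

Fact base_changeM : {morph base_change : f g / (f * g)%g}.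
Proof.
move=> f g; apply: ext_autP => x; rewrite ext_aut_mulE -(ext_map_of phi).
by rewrite !base_changeE.
Qed.
HB.instance Definition _ :=
  isMultiplicative.Build (ext_aut L K) (ext_aut L K') base_change base_changeM.

End AutBaseChange.

Record groupFunctor := GroupFunctor {
  gf_pt :> comAlgType rat -> groupType;
  gf_map : forall K K' : comAlgType rat,
    {lrmorphism K -> K'} -> {multiplicative gf_pt K -> gf_pt K'};
  gf_map_id : forall (K : comAlgType rat) (x : gf_pt K), gf_map idfun x = x;
  gf_map_comp : forall (K K' K'' : comAlgType rat) (phi : {lrmorphism K -> K'})
      (psi : {lrmorphism K' -> K''}) (x : gf_pt K),
    gf_map (psi \o phi) x = gf_map psi (gf_map phi x) }.

Arguments gf_map {g K K'} phi : rename.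

Section AutFunctor.
Variable L : lieAlgType rat.

Fact aut_functor_id (K : comAlgType rat) (f : ext_aut L K) :
  base_change idfun f = f.
Proof.
by apply: ext_autP => x; rewrite -[X in base_change _ _ X]ext_map_id base_changeE ext_map_id.
Qed.

Fact aut_functor_comp (K K' K'' : comAlgType rat) (phi : {lrmorphism K -> K'})
    (psi : {lrmorphism K' -> K''}) (f : ext_aut L K) :
  base_change (psi \o phi) f = base_change psi (base_change phi f).
Proof.
apply: ext_autP => x; rewrite -{1}(ext_map_of (psi \o phi)) -{1}(ext_map_of psi).
rewrite -{1}(ext_map_of phi) !base_changeE; apply: extP => m /=.
elim/tens_ind: (ext_aut_fun _ _ _) => [v c|y z e e']; first by rewrite !tens_map_pure.
by rewrite !tens_mapD e e'.
Qed.

(* The group functor k |-> Aut(L (^x) k). *)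
Definition aut_functor : groupFunctor :=
  @GroupFunctor (fun K => ext_aut L K)
    (fun K K' phi => base_change phi) aut_functor_id aut_functor_comp.
End AutFunctor.

Record subgroupFunctor (G : groupFunctor) := SubgroupFunctor {
  sgf_mem :> forall K : comAlgType rat, G K -> Prop;
  sgf_group : forall K, group_closed (fun x : G K => `[< sgf_mem x >]);
  sgf_stable : forall (K K' : comAlgType rat) (phi : {lrmorphism K -> K'}) (x : G K),
    sgf_mem x -> sgf_mem (gf_map phi x) }.

(* S is a closed subscheme: for every x in G(K), the set of specialisations of x
   lying in S is cut out by equations, i.e. by a subset J of K (which may be
   replaced by the ideal it generates). *)
Definition closed_subgroup (G : groupFunctor) (S : subgroupFunctor G) : Prop :=
  forall (K : comAlgType rat) (x : G K), exists J : K -> Prop,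
    forall (K' : comAlgType rat) (phi : {lrmorphism K -> K'}),
      S K' (gf_map phi x) <-> (forall c, J c -> phi c = 0).

Section SubFunctor.
Variables (G : groupFunctor) (S : subgroupFunctor G).

Definition sgf_pred (K : comAlgType rat) : {pred G K} := fun x => `[< S K x >].
Definition sgf_pt (K : comAlgType rat) : Type := {x : G K | sgf_pred x}.
HB.instance Definition _ K := SubChoice.on (sgf_pt K).
HB.instance Definition _ K :=
  SubChoice_isSubGroup.Build (G K) (@sgf_pred K) (sgf_pt K) (@sgf_group G S K).

Section Map.
Variables (K K' : comAlgType rat) (phi : {lrmorphism K -> K'}).

Fact sgf_map_subproof (x : sgf_pt K) : sgf_pred (gf_map phi (val x)).
Proof. by apply/asboolP/sgf_stable/asboolP; exact: (valP x). Qed.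
Definition sgf_map (x : sgf_pt K) : sgf_pt K' := exist _ (gf_map phi (val x)) (sgf_map_subproof x).
Fact sgf_mapM : {morph sgf_map : x y / (x * y)%g}.
Proof. by move=> x y; apply: val_inj; exact: gmulfM. Qed.
HB.instance Definition _ :=
  isMultiplicative.Build (sgf_pt K) (sgf_pt K') sgf_map sgf_mapM.
End Map.

Fact sgf_map_id (K : comAlgType rat) (x : sgf_pt K) : sgf_map idfun x = x.
Proof. by apply: val_inj; exact: gf_map_id. Qed.
Fact sgf_map_comp (K K' K'' : comAlgType rat) (phi : {lrmorphism K -> K'})
    (psi : {lrmorphism K' -> K''}) (x : sgf_pt K) :
  sgf_map (psi \o phi) x = sgf_map psi (sgf_map phi x).
Proof. by apply: val_inj; exact: gf_map_comp. Qed.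

Definition sub_functor : groupFunctor :=
  @GroupFunctor (fun K => sgf_pt K) (fun K K' phi => sgf_map phi)
    sgf_map_id sgf_map_comp.
End SubFunctor.

Section ZariskiClosure.
Variables (G : groupFunctor) (Gamma : groupType).
Variable rho : {multiplicative Gamma -> G rat^o}.

Definition zariski_mem (K : comAlgType rat) (x : G K) : Prop :=
  forall S : subgroupFunctor G, closed_subgroup S ->
    (forall g, S rat^o (rho g)) -> S K x.

Fact zariski_group K : group_closed (fun x : G K => `[< zariski_mem x >]).
Proof.
split; first by apply/asboolP => S _ _; apply/asboolP; exact: (sgf_group S K).1.
move=> x y /asboolP xZ /asboolP yZ; apply/asboolP => S Sc Sg; apply/asboolP.
by apply: (sgf_group S K).2; apply/asboolP; [exact: xZ | exact: yZ].
Qed.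
Fact zariski_stable (K K' : comAlgType rat) (phi : {lrmorphism K -> K'}) (x : G K) :
  zariski_mem x -> zariski_mem (gf_map phi x).
Proof. by move=> xZ S Sc Sg; apply/sgf_stable/xZ. Qed.

Definition zariski_subgroup : subgroupFunctor G :=
  SubgroupFunctor zariski_group zariski_stable.
Definition zariski_closure : groupFunctor := sub_functor zariski_subgroup.

Fact to_zariski_subproof g : sgf_pred zariski_subgroup (rho g).
Proof. by apply/asboolP => S _; apply. Qed.
Definition to_zariski (g : Gamma) : zariski_closure rat^o :=
  exist _ (rho g) (to_zariski_subproof g).
Fact to_zariskiM : {morph to_zariski : g h / (g * h)%g}.
Proof. by move=> g h; apply: val_inj; exact: gmulfM. Qed.
HB.instance Definition _ :=
  isMultiplicative.Build Gamma (zariski_closure rat^o) to_zariski to_zariskiM.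
End ZariskiClosure.

Record groupFunctorIso (G H : groupFunctor) := GroupFunctorIso {
  gfi_map :> forall K : comAlgType rat, {multiplicative G K -> H K};
  gfi_bij : forall K, bijective (gfi_map K);
  gfi_natural : forall (K K' : comAlgType rat) (phi : {lrmorphism K -> K'}) (x : G K),
    gfi_map K' (gf_map phi x) = gf_map phi (gfi_map K x) }.

Section InducedMap.
Variables (L1 L2 : lieAlgType rat) (K : comAlgType rat) (u : L1 -> L2).
Hypothesis u_lin : linear u.
Hypothesis u_lie : {morph u : x y / lie x y}.

HB.instance Definition _ := GRing.isLinear.Build rat L1 L2 _ u u_lin.

Lemma lcs_map m x : lcs m x -> lcs m (u x).
Proof.
elim: m x => [//|m IH] _ [s [sm ->]]; exists [seq (u p.1, u p.2) | p <- s].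
split; first by move=> _ /mapP[p /sm/IH pm ->].
by rewrite linear_sum big_map; apply: eq_bigr => p _ /=; rewrite u_lie.
Qed.

Definition lieq_map m (x : lieq L1 m) : lieq L2 m := lieq_pi m (u (lieq_repr x)).

Lemma lieq_mapE m x : lieq_map (lieq_pi m x) = lieq_pi m (u x).
Proof. by apply/lieq_eqP; rewrite -linearB; apply/lcs_map/lcs_repr. Qed.
Fact lieq_map_linear m : linear (@lieq_map m).
Proof.
by move=> a; elim/lieq_ind=> x; elim/lieq_ind=> y; rewrite -linearP !lieq_mapE !linearP.
Qed.
HB.instance Definition _ m := GRing.isLinear.Build rat (lieq L1 m) (lieq L2 m) _
  (@lieq_map m) (@lieq_map_linear m).
Lemma lieq_map_lie m : {morph @lieq_map m : x y / lie x y}.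
Proof.
elim/lieq_ind=> x; elim/lieq_ind=> y.
by rewrite -lieq_piL !lieq_mapE u_lie lieq_piL.
Qed.

Fact ext_induced_subproof (x : ext L1 K) m :
  @tens_map _ _ K K (lieq_proj m) idfun (@tens_map _ _ K K (@lieq_map m.+1) idfun (x m.+1)) =
  tens_map (@lieq_map m) idfun (x m).
Proof.
rewrite -[x m]ext_compat; elim/tens_ind: (x m.+1) => [v c|y z e e'].
  by elim/lieq_ind: v => v; rewrite !tens_map_pure /= lieq_mapE !lieq_projE lieq_mapE.
by rewrite !tens_mapD e e'.
Qed.
(* The map L1 (^x) K -> L2 (^x) K induced by u. *)
Definition ext_induced (x : ext L1 K) : ext L2 K := Ext (ext_induced_subproof x).

Lemma ext_induced_of x : ext_induced (ext_of K x) = ext_of K (u x).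
Proof. by apply: extP => m /=; rewrite tens_map_pure /= lieq_mapE. Qed.
Lemma ext_induced_linear : linear ext_induced.
Proof.
move=> a x y; apply: extP => m.
by rewrite ext_atD ext_atZ /= tens_mapD tens_mapZ.
Qed.
Lemma ext_induced_lie : {morph ext_induced : x y / lie x y}.
Proof.
move=> x y; apply: extP => m; rewrite ext_at_lie /= tens_map_lie //.
exact: lieq_map_lie.
Qed.
Lemma ext_induced_at0 m (x : ext L1 K) : x m = 0 -> ext_induced x m = 0.
Proof. by move=> /= ->; rewrite tens_map0. Qed.
End InducedMap.

Section InducedAut.
Variables (L : lieAlgType rat) (K : comAlgType rat).

Lemma ext_induced_end (u : L -> L) (uL : linear u) (uB : {morph u : x y / lie x y}) :
  ext_end (@ext_induced L L K u uL uB).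
Proof.
split; [exact: ext_induced_linear | exact: ext_induced_lie |].
by move=> m; exists m => x; exact: ext_induced_at0.
Qed.

Lemma ext_inducedK (u v : L -> L) uL uB vL vB : cancel u v ->
  cancel (@ext_induced L L K u uL uB) (@ext_induced L L K v vL vB).
Proof.
move=> uK; apply: (@ext_end_eq _ _
  (@ext_induced L L K v vL vB \o @ext_induced L L K u uL uB) id).
- by apply: ext_end_comp; exact: ext_induced_end.
- exact: ext_end_id.
- by move=> x /=; rewrite !ext_induced_of uK.
Qed.
End InducedAut.

Section MalcevLie.
Variable Gamma : groupType.
Implicit Types (f g : Gamma -> rat) (D : (Gamma -> rat) -> rat).

(* killed m f: f vanishes on the m-th power of the augmentation ideal of Q[Gamma]
   (f being extended linearly to Q[Gamma]). *)
Fixpoint killed (m : nat) f : Prop :=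
  if m is m'.+1 then forall a, killed m' (fun x => f (a * x)%g - f x)
  else forall x, f x = 0.

(* The coordinate ring of the prounipotent completion of a finitely generated
   group Gamma: its elements are the matrix coefficients of the finite dimensional
   unipotent representations of Gamma, that is, the functions on Gamma vanishing on
   some power of the augmentation ideal of Q[Gamma]. *)
Definition unip f : Prop := exists m, killed m f.

Lemma killed_ext m f g : f =1 g -> killed m f -> killed m g.
Proof. by move=> /funext ->. Qed.
Lemma killed0 m : killed m (fun=> 0).
Proof. by elim: m => [//|m IH] a; rewrite subrr. Qed.
Lemma killedD m f g : killed m f -> killed m g -> killed m (fun x => f x + g x).
Proof.
elim: m f g => [|m IH] f g /= fm gm; first by move=> x; rewrite fm gm addr0.
by move=> a; apply: killed_ext (IH _ _ (fm a) (gm a)) => x; rewrite opprD addrACA.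
Qed.
Lemma killedZ m c f : killed m f -> killed m (fun x => c * f x).
Proof.
elim: m f => [|m IH] f /= fm; first by move=> x; rewrite fm mulr0.
by move=> a; apply: killed_ext (IH _ (fm a)) => x; rewrite mulrBr.
Qed.
Lemma killedS m f : killed m f -> killed m.+1 f.
Proof.
elim: m f => [|m IH] f fm a; first by move=> x; rewrite !fm subrr.
exact/IH/fm.
Qed.
Lemma killed_le m n f : (m <= n)%N -> killed m f -> killed n f.
Proof.
move=> /subnKC <-; elim: (n - m)%N => [|k IH] fm; first by rewrite addn0.
by rewrite addnS; apply/killedS/IH.
Qed.
Lemma killed_trans m b f : killed m f -> killed m (fun x => f (b * x)%g).
Proof.
elim: m f => [|m IH] f /= fm; first by move=> x; rewrite fm.
move=> a; apply: killed_ext (IH _ (fm (b * a * b^-1)%g)) => x /=.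
by rewrite !mulgA mulgKV.
Qed.
Lemma killedM m n f g : killed m f -> killed n g ->
  killed (m + n) (fun x => f x * g x).
Proof.
elim: m n f g => [|m IHm] n f g fm gn.
  by apply: killed_ext (killed0 _) => x; rewrite fm mul0r.
elim: n g gn => [|n IHn] g gn.
  by apply: killed_ext (killed0 _) => x; rewrite gn mulr0.
move=> a; rewrite addnS.
have H1 := IHm n.+1 _ _ (fm a) (killed_trans a gn).
have H2 := IHn _ (gn a); rewrite addnS in H1; rewrite addSn in H2.
apply: killed_ext (killedD H1 H2) => x.
by rewrite mulrBl mulrBr addrA subrK.
Qed.

Lemma unipD f g : unip f -> unip g -> unip (fun x => f x + g x).
Proof.
move=> [m fm] [n gn]; exists (maxn m n); apply: killedD.
- exact: killed_le (leq_maxl _ _) fm.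
- exact: killed_le (leq_maxr _ _) gn.
Qed.
Lemma unipZ c f : unip f -> unip (fun x => c * f x).
Proof. by move=> [m fm]; exists m; exact: killedZ. Qed.
Lemma unipM f g : unip f -> unip g -> unip (fun x => f x * g x).
Proof. by move=> [m fm] [n gn]; exists (m + n)%N; exact: killedM. Qed.
Lemma unip_trans b f : unip f -> unip (fun x => f (b * x)%g).
Proof. by move=> [m fm]; exists m; exact: killed_trans. Qed.

(* The tangent space at 1 of the prounipotent completion: derivations at 1 of its
   coordinate ring, extended by 0 to all functions on Gamma. *)
Record tangent_spec D : Prop := TangentSpec {
  tangent_out : forall f, ~ unip f -> D f = 0;
  tangent_add : forall f g, unip f -> unip g -> D (fun x => f x + g x) = D f + D g;
  tangent_scale : forall c f, unip f -> D (fun x => c * f x) = c * D f;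
  tangent_der : forall f g, unip f -> unip g ->
    D (fun x => f x * g x) = f 1%g * D g + D f * g 1%g }.

Definition tangent : {pred (Gamma -> rat) -> rat^o} := fun D => `[< tangent_spec D >].

Fact tangent_submod : GRing.submod_closed tangent.
Proof.
split; first by apply/asboolP; split=> *; rewrite /= ?(mulr0, mul0r, addr0).
move=> c D D' /asboolP[o a s d] /asboolP[o' a' s' d']; apply/asboolP.
have E f : (c *: D + D') f = c * D f + D' f by [].
split=> [f nf|f g uf ug|b f uf|f g uf ug]; rewrite !E.
- by rewrite o ?o' // mulr0 addr0.
- by rewrite a ?a' // mulrDr addrACA.
- by rewrite s ?s' // mulrDr mulrCA.
- by rewrite d ?d' // !mulrDr mulrDl (mulrCA c) -!mulrA addrACA.
Qed.

Definition malcev : Type := {D : (Gamma -> rat) -> rat^o | tangent D}.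
HB.instance Definition _ := SubChoice.on malcev.
HB.instance Definition _ :=
  GRing.SubChoice_isSubLmodule.Build rat ((Gamma -> rat) -> rat^o) tangent malcev
    (GRing.submod_closed_semi tangent_submod).

Definition malcev_fun (D : malcev) : (Gamma -> rat) -> rat := val D.
Coercion malcev_fun : malcev >-> Funclass.

Lemma malcevP (D E : malcev) : (forall f, unip f -> D f = E f) -> D = E.
Proof.
move=> DE; apply/val_inj/funext => f; have [uf|nf] := pselect (unip f).
  exact: DE.
have /asboolP[o _ _ _] := valP D; have /asboolP[o' _ _ _] := valP E.
by rewrite o ?o'.
Qed.

Section Tangent.
Variable D : malcev.
Let DT : tangent_spec D. Proof. exact/asboolP/(valP D). Qed.

Lemma malcev_out f : ~ unip f -> D f = 0. Proof. by case: DT => + _ _ _; apply. Qed.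
Lemma malcevD f g : unip f -> unip g -> D (fun x => f x + g x) = D f + D g.
Proof. by case: DT => _ + _ _; apply. Qed.
Lemma malcevZ c f : unip f -> D (fun x => c * f x) = c * D f.
Proof. by case: DT => _ _ + _; apply. Qed.
Lemma malcevM f g : unip f -> unip g ->
  D (fun x => f x * g x) = f 1%g * D g + D f * g 1%g.
Proof. by case: DT => _ _ _; apply. Qed.

Lemma unipB f g : unip f -> unip g -> unip (fun x => f x - g x).
Proof.
move=> uf ug; have := unipD uf (unipZ (-1) ug).
by congr unip; apply/funext => x; rewrite mulN1r.
Qed.
Lemma malcevB f g : unip f -> unip g -> D (fun x => f x - g x) = D f - D g.
Proof.
move=> uf ug; rewrite -[- D g]mulN1r -malcevZ // -malcevD //; last exact: unipZ.
by congr malcev_fun; apply/funext => x; rewrite mulN1r.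
Qed.

Lemma unip_malcev f : unip f -> unip (fun x => D (fun y => f (x * y)%g)).
Proof.
move=> [m fm]; exists m; elim: m f fm => [|m IH] f fm.
  move=> x; have -> : (fun y => f (x * y)%g) = (fun y => 0 * f y).
    by apply/funext => y; rewrite fm mul0r.
  by rewrite malcevZ ?mul0r //; exists 0.
have uf : unip f by exists m.+1.
move=> a; apply: killed_ext (IH _ (fm a)) => x /=.
rewrite malcevB; last 2 first.
- have := unip_trans (a * x)%g uf.
  by congr unip; apply/funext => y; rewrite mulgA.
- exact: unip_trans.
by congr (malcev_fun _ _ - _); apply/funext => y; rewrite mulgA.
Qed.
End Tangent.

(* Convolution product of distributions: the dual of the coproduct
   f |-> ((x, y) |-> f (x * y)). *)
Definition conv (D E : (Gamma -> rat) -> rat) : (Gamma -> rat) -> rat :=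
  fun f => D (fun x => E (fun y => f (x * y)%g)).

Definition malcev_lie_fun (D E : malcev) : (Gamma -> rat) -> rat^o :=
  fun f => if `[< unip f >] then conv D E f - conv E D f else 0.

Let lie_funE (D E : malcev) f : unip f ->
  malcev_lie_fun D E f = conv D E f - conv E D f.
Proof. by move=> uf; rewrite /malcev_lie_fun asboolT. Qed.

Let convD (D E : malcev) f g : unip f -> unip g ->
  conv D E (fun x => f x + g x) = conv D E f + conv D E g.
Proof.
move=> uf ug; rewrite /conv -malcevD; try exact: unip_malcev.
by congr malcev_fun; apply/funext => x; rewrite malcevD //; exact: unip_trans.
Qed.
Let convZ (D E : malcev) c f : unip f ->
  conv D E (fun x => c * f x) = c * conv D E f.
Proof.
move=> uf; rewrite /conv -malcevZ; try exact: unip_malcev.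
by congr malcev_fun; apply/funext => x; rewrite malcevZ //; exact: unip_trans.
Qed.
Let convM (D E : malcev) f g : unip f -> unip g ->
  conv D E (fun x => f x * g x) =
  f 1%g * conv D E g + D f * E g + (E f * D g + conv D E f * g 1%g).
Proof.
move=> uf ug; rewrite /conv.
have -> : (fun x => E (fun y => f (x * y)%g * g (x * y)%g)) =
  (fun x => f x * E (fun y => g (x * y)%g) + E (fun y => f (x * y)%g) * g x).
  apply/funext => x; rewrite malcevM; try exact: unip_trans.
  by rewrite !mulg1.
have uE h : unip h -> unip (fun x => E (fun y => h (x * y)%g)) by exact: unip_malcev.
rewrite malcevD; try by apply: unipM => //; exact: uE.
rewrite !malcevM //; try exact: uE.
have e h : (fun y => h (1 * y)%g) = h :> (Gamma -> rat).
  by apply/funext => y; rewrite mul1g.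
by rewrite !e.
Qed.

Fact malcev_lie_subproof (D E : malcev) : tangent (malcev_lie_fun D E).
Proof.
apply/asboolP; split=> [f nf|f g uf ug|c f uf|f g uf ug].
- by rewrite /malcev_lie_fun asboolF.
- rewrite !lie_funE //; last exact: unipD.
  by rewrite !convD // opprD addrACA.
- rewrite !lie_funE //; last exact: unipZ.
  by rewrite !convZ // mulrBr.
- rewrite !lie_funE //; last exact: unipM.
  rewrite !convM //.
  move: (conv D E g) (conv E D g) (conv D E f) (conv E D f) (D f) (D g) (E f) (E g).
  move: (f 1%g) (g 1%g) => p q; rewrite /GRing.regular => a b c d e e' h h'.
  by ring.
Qed.
Definition malcev_lie (D E : malcev) : malcev :=
  exist _ (malcev_lie_fun D E) (malcev_lie_subproof D E).

Let lieE (D E : malcev) f : unip f -> malcev_lie D E f = conv D E f - conv E D f.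
Proof. exact: lie_funE. Qed.

Let addE (D E : malcev) f : (D + E : malcev) f = D f + E f. Proof. by []. Qed.
Let scaleE c (D : malcev) f : (c *: D : malcev) f = c * D f. Proof. by []. Qed.

Let conv_linl a (D D' E : malcev) f :
  conv (a *: D + D' : malcev) E f = a * conv D E f + conv D' E f.
Proof. by []. Qed.
Let conv_linr a (D D' E : malcev) f : unip f ->
  conv E (a *: D + D' : malcev) f = a * conv E D f + conv E D' f.
Proof.
move=> uf; rewrite /conv -malcevZ; last exact: unip_malcev.
by rewrite -malcevD //; [exact/unipZ/unip_malcev | exact: unip_malcev].
Qed.

Fact malcev_linearl E : linear (malcev_lie^~ E).
Proof.
move=> a D D'; apply: malcevP => f uf; rewrite addE scaleE !lieE //.
by rewrite conv_linl conv_linr // mulrBr opprD addrACA.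
Qed.
Fact malcev_linearr E : linear (malcev_lie E).
Proof.
move=> a D D'; apply: malcevP => f uf; rewrite addE scaleE !lieE //.
by rewrite conv_linl conv_linr // mulrBr opprD addrACA.
Qed.
Fact malcev_liexx (D : malcev) : malcev_lie D D = 0.
Proof. by apply: malcevP => f uf; rewrite lieE // subrr. Qed.

Let conv_liel (D E F : malcev) f : unip f -> conv (malcev_lie D E) F f =
  conv (conv D E) F f - conv (conv E D) F f.
Proof. by move=> uf; rewrite {1}/conv lieE //; exact: unip_malcev. Qed.
Let conv_lier (D E F : malcev) f : unip f -> conv F (malcev_lie D E) f =
  conv (conv F D) E f - conv (conv F E) D f.
Proof.
move=> uf.
have A (X Y : malcev) : conv (conv F X) Y f =
    F (fun x => conv X Y (fun y => f (x * y)%g)).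
  rewrite /conv; congr malcev_fun; apply/funext => x; congr malcev_fun.
  by apply/funext => y; congr malcev_fun; apply/funext => z; rewrite mulgA.
have uA (X Y : malcev) : unip (fun x => conv X Y (fun y => f (x * y)%g)).
  have := unip_malcev X (unip_malcev Y uf); congr unip; apply/funext => x.
  rewrite /conv; congr malcev_fun; apply/funext => y; congr malcev_fun.
  by apply/funext => z; rewrite mulgA.
rewrite !A -malcevB // /conv; congr malcev_fun; apply/funext => x.
by rewrite lieE //; exact: unip_trans.
Qed.

Fact malcev_jacobi (D E F : malcev) :
  malcev_lie D (malcev_lie E F) + malcev_lie E (malcev_lie F D) +
  malcev_lie F (malcev_lie D E) = 0.
Proof.
apply: malcevP => f uf; rewrite !addE !lieE // !conv_liel // !conv_lier //.
move: (conv (conv D E) F f) (conv (conv D F) E f) (conv (conv E F) D f)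
  (conv (conv E D) F f) (conv (conv F D) E f) (conv (conv F E) D f).
move=> a b c d e g; rewrite -[RHS]/(0 : rat).
by ring.
Qed.
HB.instance Definition _ := Lmodule_isLie.Build rat malcev
  malcev_linearl malcev_linearr malcev_liexx malcev_jacobi.

Lemma malcev_lieE (D E : malcev) f : unip f ->
  (lie D E : malcev) f = conv D E f - conv E D f.
Proof. exact: lieE. Qed.

End MalcevLie.

Section MalcevMap.
Variables (G H : groupType) (h : {multiplicative G -> H}).

Lemma unip_comp (f : H -> rat) : unip f -> unip (f \o h).
Proof.
move=> [m fm]; exists m; elim: m f fm => [|m IH] f fm; first by move=> x; exact: fm.
by move=> a; apply: killed_ext (IH _ (fm (h a))) => x /=; rewrite gmulfM.
Qed.

Lemma gmulf1' : h 1%g = 1%g.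
Proof. by apply: (@mulgI _ (h 1%g)); rewrite -gmulfM !mulg1. Qed.

Definition malcev_map_fun (D : malcev G) : (H -> rat) -> rat^o :=
  fun f => if `[< unip f >] then D (f \o h) else 0.

Fact malcev_map_subproof D : tangent (malcev_map_fun D).
Proof.
have E f : unip f -> malcev_map_fun D f = D (f \o h).
  by move=> uf; rewrite /malcev_map_fun asboolT.
apply/asboolP; split=> [f nf|f g uf ug|c f uf|f g uf ug].
- by rewrite /malcev_map_fun asboolF.
- rewrite !E //; last exact: unipD.
  by rewrite -malcevD //; exact: unip_comp.
- rewrite !E //; last exact: unipZ.
  by rewrite -malcevZ //; exact: unip_comp.
- rewrite !E //; last exact: unipM.
  rewrite -[in f 1%g]gmulf1' -[in g 1%g]gmulf1'.
  by rewrite -(malcevM D (unip_comp uf) (unip_comp ug)).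
Qed.
Definition malcev_map (D : malcev G) : malcev H :=
  exist _ (malcev_map_fun D) (malcev_map_subproof D).

Lemma malcev_mapE D f : unip f -> malcev_map D f = D (f \o h).
Proof. by move=> uf; rewrite /malcev_map /malcev_fun /= /malcev_map_fun asboolT. Qed.

Lemma malcev_map_linear : linear malcev_map.
Proof.
move=> a D E; apply: malcevP => f uf.
by rewrite -[RHS]/(a * malcev_map D f + malcev_map E f) !malcev_mapE.
Qed.

Lemma malcev_map_lie : {morph malcev_map : D E / lie D E}.
Proof.
move=> D E; apply: malcevP => f uf.
have A (X Y : malcev G) : conv (malcev_map X) (malcev_map Y) f = conv X Y (f \o h).
  rewrite /conv malcev_mapE; last exact: unip_malcev.
  congr malcev_fun; apply/funext => x; rewrite /= malcev_mapE; last exact: unip_trans.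
  by congr malcev_fun; apply/funext => y /=; rewrite gmulfM.
by rewrite malcev_mapE // !malcev_lieE ?A //; exact: unip_comp.
Qed.
End MalcevMap.

Section AutMalcev.
Variables (G : groupType) (K : comAlgType rat).

HB.instance Definition _ (f : gaut G) :=
  isMultiplicative.Build G G (val f : bij G) (elimT (asboolP _) (valP f)).

Lemma malcev_map_comp (f g h : {multiplicative G -> G}) : f \o g =1 h ->
  malcev_map f \o malcev_map g =1 malcev_map h.
Proof.
move=> fg D; apply: malcevP => k uk /=; rewrite !malcev_mapE //; last exact: unip_comp.
by congr malcev_fun; apply/funext => x /=; rewrite -fg.
Qed.

Lemma malcev_map_id (f : {multiplicative G -> G}) : f =1 id -> malcev_map f =1 id.
Proof.
move=> f1 D; apply: malcevP => k uk; rewrite malcev_mapE //.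
by congr malcev_fun; apply/funext => x /=; rewrite f1.
Qed.

Definition gaut_fun (f : gaut G) : {multiplicative G -> G} := (val f : bij G).

Lemma gaut_malcevK (f g : gaut G) : (f * g = 1)%g ->
  cancel (malcev_map (gaut_fun g)) (malcev_map (gaut_fun f)).
Proof.
move=> fg D; have fgE x : gaut_fun f (gaut_fun g x) = x.
  by rewrite -[LHS]/(val (f * g)%g x) fg.
apply: malcevP => k uk; rewrite !malcev_mapE //; last exact: unip_comp.
by congr malcev_fun; apply/funext => x /=; rewrite fgE.
Qed.

Definition gaut_ext (f : gaut G) : ext (malcev G) K -> ext (malcev G) K :=
  ext_induced (malcev_map_linear (gaut_fun f)) (malcev_map_lie (gaut_fun f)).

Lemma gaut_extK (f g : gaut G) : (f * g = 1)%g -> cancel (gaut_ext g) (gaut_ext f).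
Proof. by move=> fg; apply/ext_inducedK/gaut_malcevK. Qed.

Definition gaut_bij (f : gaut G) : bij (ext (malcev G) K) :=
  Bij (gaut_extK (mulVg f)) (gaut_extK (mulgV f)).

Fact gaut_malcev_subproof f : is_ext_aut (gaut_bij f).
Proof. by apply/asboolP; split; exact: ext_induced_end. Qed.

(* The natural morphism Aut Gamma -> Aut (Lie Gamma (^x) K). *)
Definition gaut_malcev (f : gaut G) : aut_functor (malcev G) K :=
  exist _ (gaut_bij f) (gaut_malcev_subproof f).

Lemma gaut_malcev_of (f : gaut G) D :
  (gaut_malcev f : ext_aut _ K) (ext_of K D) = ext_of K (malcev_map (gaut_fun f) D).
Proof. exact: ext_induced_of. Qed.

Fact gaut_malcevM : {morph gaut_malcev : f g / (f * g)%g}.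
Proof.
move=> f g; apply: ext_autP => D; rewrite ext_aut_mulE !gaut_malcev_of.
congr ext_of; apply: malcevP => k uk; rewrite !malcev_mapE //; exact: unip_comp.
Qed.
HB.instance Definition _ := isMultiplicative.Build
  (gaut G) (aut_functor (malcev G) K) gaut_malcev gaut_malcevM.
End AutMalcev.

Section EllipticRelations.
Local Open Scope group_scope.
Variable G : groupType.
Implicit Types (s : nat -> G) (x y z : G) (n : nat).

(* chain s z k = s_(k-1) ... s_0 z s_0 ... s_(k-1) *)
Fixpoint chain s z k : G := if k is k'.+1 then s k' * chain s z k' * s k' else z.
Fixpoint chain_prod s z k : G :=
  if k is k'.+1 then chain_prod s z k' * chain s z k' else 1.

Definition braid_sys n s : Prop :=
  (forall i, (i.+1 < n.-1)%N -> s i * s i.+1 * s i = s i.+1 * s i * s i.+1) /\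
  (forall i j, (i.+1 < j < n.-1)%N -> s i * s j = s j * s i).

Definition half_sys n s z : Prop :=
  [/\ (1 < n)%N -> (s 0%N * z) * (s 0%N * z) = (z * s 0%N) * (z * s 0%N),
      forall i, (0 < i < n.-1)%N -> z * s i = s i * z
    & chain_prod s z n = 1].

Definition ell_sys n s x y : Prop :=
  [/\ braid_sys n s, half_sys n s x, half_sys n (fun i => (s i)^-1) y
    & (1 < n)%N -> y * (chain s x 1)^-1 * y^-1 * chain s x 1 = s 0%N * s 0%N].

Lemma tailP (u v : G) : (forall t, u * t = v * t) -> u = v.
Proof. by move=> /(_ 1); rewrite !mulg1. Qed.
Lemma commT (a b : G) : a * b = b * a -> forall t, a * (b * t) = b * (a * t).
Proof. by move=> e t; rewrite !mulgA e. Qed.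
Lemma commV (a b : G) : a * b = b * a -> a^-1 * b = b * a^-1.
Proof. by move=> e; apply: (mulgI a); rewrite !mulgA mulgV mul1g e mulgK. Qed.
Lemma mulVT (a t : G) : a^-1 * (a * t) = t. Proof. by rewrite mulgA mulVg mul1g. Qed.
Lemma mulTV (a t : G) : a * (a^-1 * t) = t. Proof. by rewrite mulgA mulgV mul1g. Qed.

Lemma braid_sysV n s : braid_sys n s -> braid_sys n (fun i => (s i)^-1).
Proof.
case=> b c; split=> [i /b|i j /c]; move=> /(congr1 (fun u => u^-1)).
  by rewrite !invgM !mulgA.
by rewrite !invgM => ->.
Qed.

Section Half.
Variables (n : nat) (s : nat -> G) (z : G).
Hypotheses (sB : braid_sys n s).
Hypothesis z_sq : (1 < n)%N -> (s 0%N * z) * (s 0%N * z) = (z * s 0%N) * (z * s 0%N).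
Hypothesis z_comm : forall i, (0 < i < n.-1)%N -> z * s i = s i * z.
Local Notation N := n.-1.
Local Notation zc := (chain s z).
Local Notation w := (chain_prod s z).

Lemma farT i j t : (i.+1 < j)%N -> (j < N)%N -> s i * (s j * t) = s j * (s i * t).
Proof. by move=> ij jN; case: sB => _ c; apply/commT/c; rewrite ij. Qed.
Lemma brT i t : (i.+1 < N)%N ->
  s i * (s i.+1 * (s i * t)) = s i.+1 * (s i * (s i.+1 * t)).
Proof. by case: sB => b _ /b e; rewrite !mulgA e. Qed.

Lemma chain_gtT i k : (k < i)%N -> (i < N)%N ->
  forall t, s i * (zc k * t) = zc k * (s i * t).
Proof.
move=> + iN; elim: k => [|k IH] ki t /=; first by apply: commT; rewrite z_comm ?ki.
by rewrite -!mulgA -farT // IH ?(ltnW ki) // -farT.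
Qed.

Lemma chain_ltT i k : (i.+1 < k)%N -> (k <= N)%N ->
  forall t, s i * (zc k * t) = zc k * (s i * t).
Proof.
elim: k => // k IH; rewrite ltnS leq_eqVlt => /predU1P[<-|ik] kN t /=; last first.
  by rewrite -!mulgA farT // IH ?(ltnW kN) // farT.
by rewrite -!mulgA brT // (chain_gtT (ltnSn i) kN) -brT.
Qed.

Lemma chain_commT k : (k < N)%N ->
  forall t, zc k.+1 * (zc k * t) = zc k * (zc k.+1 * t).
Proof.
elim: k => [|k IH] kN t.
  have n1 : (1 < n)%N by case: (n) kN => [|[]].
  rewrite /= -!mulgA; have := congr1 (fun u => u * t) (z_sq n1).
  by rewrite -!mulgA.
move: (IH (ltnW kN)) => {IH}; rewrite [zc k.+2]/= [zc k.+1]/=.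
move: (chain_gtT (ltnSn k) kN) (fun t => brT t kN).
move: (s k) (s k.+1) (zc k) => a b c bc ab IH.
have {}IH u : a * (c * (a * (c * u))) = c * (a * (c * (a * u))).
  by have := IH u; rewrite -!mulgA.
rewrite -!mulgA.
by rewrite (ab (c * (a * t))) -(bc (a * _)) -ab bc IH ab -(bc (a * (b * _))) bc -ab.
Qed.

Lemma prod_leT i k : (k <= i)%N -> (i < N)%N ->
  forall t, s i * (w k * t) = w k * (s i * t).
Proof.
move=> + iN; elim: k => [|k IH] ki t /=; first by rewrite !mul1g.
by rewrite -!mulgA IH ?(ltnW ki) // chain_gtT.
Qed.

Lemma prod_gtT i k : (i.+1 < k)%N -> (k <= N.+1)%N ->
  forall t, s i * (w k * t) = w k * (s i * t).
Proof.
elim: k => // k IH; rewrite ltnS leq_eqVlt => /predU1P[<-|ik] kN t; last first.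
  by rewrite /= -!mulgA IH ?(ltnW kN) // chain_ltT.
have e := chain_commT kN; rewrite [w _]/=.
have {}e u : s i * (zc i * (s i * (zc i * u))) = zc i * (s i * (zc i * (s i * u))).
  by have := e u; rewrite /= -!mulgA.
by rewrite -!mulgA prod_leT // e.
Qed.

Lemma prod_chainT k : (k <= N)%N -> forall t, zc k * (w k * t) = w k * (zc k * t).
Proof.
elim: k => [|k IH] kN t; first by rewrite !mul1g.
have e u : s k * (zc k * (s k * (zc k * u))) = zc k * (s k * (zc k * (s k * u))).
  by have := chain_commT kN u; rewrite /= -!mulgA.
by rewrite /= -!mulgA prod_leT // IH ?(ltnW kN) // prod_leT // e.
Qed.

(* jm k = s_(k-1) ... s_0 s_0 ... s_(k-1) *)
Fixpoint jm k : G := if k is k'.+1 then s k' * jm k' * s k' else 1.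

Lemma jm_prodT k : (k <= N)%N ->
  forall t, jm k * (w k.+1 * t) = w k.+1 * (jm k * t).
Proof.
move=> kN; have: forall i, (i < k)%N -> forall t, s i * (w k.+1 * t) = w k.+1 * (s i * t).
  by move=> i ik t; exact: prod_gtT.
move: (w k.+1) => v; elim: (k) => [|i IH] H t; first by rewrite !mul1g.
rewrite [jm _]/= -!mulgA (H i) // IH ?(H i) // => j ji; apply: H; exact: ltnW.
Qed.

End Half.

Section Twist.
Variables (n : nat) (s : nat -> G) (x y : G).
Hypothesis sys : ell_sys n s x y.
Local Notation N := n.-1.
Local Notation sV := (fun i => (s i)^-1).
Local Notation xc := (chain s x).
Local Notation yc := (chain sV y).
Local Notation wx := (chain_prod s x).
Local Notation wy := (chain_prod sV y).

Let sB : braid_sys n s. Proof. by case: sys. Qed.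
Let sVB : braid_sys n sV. Proof. exact: braid_sysV. Qed.
Let x_sq : (1 < n)%N -> (s 0%N * x) * (s 0%N * x) = (x * s 0%N) * (x * s 0%N).
Proof. by case: sys => _ []. Qed.
Let x_comm i : (0 < i < n.-1)%N -> x * s i = s i * x.
Proof. by case: sys => _ [_ + _] _ _; apply. Qed.
Let y_sq : (1 < n)%N -> (sV 0%N * y) * (sV 0%N * y) = (y * sV 0%N) * (y * sV 0%N).
Proof. by case: sys => _ _ []. Qed.
Let y_comm i : (0 < i < n.-1)%N -> y * sV i = sV i * y.
Proof. by case: sys => _ _ [_ + _] _; apply. Qed.
Let pureR : (1 < n)%N -> y * (xc 1)^-1 * y^-1 * xc 1 = s 0%N * s 0%N.
Proof. by case: sys. Qed.

Let x_gtT := chain_gtT sB x_comm.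
Let y_gtT := chain_gtT sVB y_comm.
Let y_gtT' i k : (k < i)%N -> (i < N)%N ->
  forall t, s i * (yc k * t) = yc k * (s i * t).
Proof. by move=> ki iN t; apply: (mulgI (s i)^-1); rewrite mulVT y_gtT // mulVT. Qed.

Lemma mixedT k : (k < N)%N -> forall t,
  yc k * (xc k.+1 * t) = xc k.+1 * ((s k)^-1 * ((s k)^-1 * (yc k * t))).
Proof.
elim: k => [|k IH] kN t.
  have n1 : (1 < n)%N by case: (n) kN => [|[]].
  have e := pureR n1; move: (xc 1) e => u e.
  rewrite [yc 0]/= (mulgA (s 0%N)^-1) -invgM -e !invgM !invgK -!mulgA.
  by rewrite mulTV mulVT.
move: (IH (ltnW kN)) (x_gtT (ltnSn k) kN) (y_gtT' (ltnSn k) kN) (fun t => brT sB t kN).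
move=> {}IH; rewrite [yc k.+1]/= [xc k.+2]/=; move: IH; rewrite [xc k.+1]/=.
move: (s k) (s k.+1) (xc k) (yc k) => a b d c IH bd bc ab.
have VT := mulVT; have TV := mulTV.
have bdV u : b^-1 * (d * u) = d * (b^-1 * u) by apply: (mulgI b); rewrite TV bd TV.
have ab1 u : a^-1 * (b * (a * u)) = b * (a * (b^-1 * u)).
  by apply: (mulgI a); rewrite TV ab TV.
have ab2 u : b^-1 * (a * (b * u)) = a * (b * (a^-1 * u)).
  by apply: (mulgI b); rewrite TV -ab TV.
have ab3 u : b^-1 * (a^-1 * (b * u)) = a * (b^-1 * (a^-1 * u)).
  by apply: (mulgI b); rewrite TV -ab1 TV.
have {}IH u : c * (a * (d * (a * u))) = a * (d * (a^-1 * (c * u))).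
  by have := IH u; rewrite -!mulgA TV.
rewrite -!mulgA ab1 -bc bdV ab2 IH TV -bc.
by rewrite (ab1 (d * _)) bdV ab3.
Qed.
Let x_gtVT i k : (k < i)%N -> (i < N)%N ->
  forall t, (s i)^-1 * (xc k * t) = xc k * ((s i)^-1 * t).
Proof. by move=> ki iN t; apply: (mulgI (s i)); rewrite mulTV x_gtT // mulTV. Qed.

Lemma prod_yT k : (k <= N)%N ->
  forall t, wx k * (yc k * t) = yc k * (jm s k * (wx k * t)).
Proof.
elim: k => [|k IH] kN t; first by rewrite !mul1g.
have M u : xc k * ((s k)^-1 * (yc k * u)) = (s k)^-1 * (yc k * (xc k.+1 * u)).
  rewrite (mixedT kN u) [xc k.+1]/= -!mulgA; apply: (mulgI (s k)).
  by rewrite !mulTV.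
have PV u : wx k * ((s k)^-1 * u) = (s k)^-1 * (wx k * u).
  apply: (mulgI (s k)); rewrite mulTV.
  by rewrite (prod_leT sB x_comm (leqnn k) kN) mulTV.
rewrite [wx _]/= [yc _]/= [jm _ _]/= -!mulgA M PV [xc k.+1]/= -!mulgA.
by rewrite IH ?(ltnW kN) // (prod_leT sB x_comm (leqnn k) kN) mulTV mulVT.
Qed.

Let n_gt1 : (1 < n)%N -> (0 < N)%N. Proof. by case: (n) => [|[]]. Qed.

Let x_comm0T : (1 < n)%N -> forall t, xc 1 * (x * t) = x * (xc 1 * t).
Proof. by move=> n1; exact: (chain_commT sB x_sq x_comm (n_gt1 n1)). Qed.
Let y_sqT : (1 < n)%N -> forall t,
  (s 0%N)^-1 * (y * ((s 0%N)^-1 * (y * t))) = y * ((s 0%N)^-1 * (y * ((s 0%N)^-1 * t))).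
Proof. by move=> n1 t; have := congr1 (fun u => u * t) (y_sq n1); rewrite -!mulgA. Qed.
Let x_sqT : (1 < n)%N -> forall t,
  s 0%N * (x * (s 0%N * (x * t))) = x * (s 0%N * (x * (s 0%N * t))).
Proof. by move=> n1 t; have := congr1 (fun u => u * t) (x_sq n1); rewrite -!mulgA. Qed.
Let M0 : (1 < n)%N -> forall t,
  x * ((s 0%N)^-1 * (y * t)) = (s 0%N)^-1 * (y * (s 0%N * (x * (s 0%N * t)))).
Proof.
move=> /n_gt1 n1 t; have := mixedT n1 t; rewrite /= -!mulgA mulTV => ->.
by rewrite mulVT.
Qed.

Let x_commV i : (0 < i < n.-1)%N -> x * (s i)^-1 = (s i)^-1 * x.
Proof. by move=> iN; rewrite commV // x_comm. Qed.

Let chain_mul k : chain sV (y * x) k = yc k * (xc k * (jm s k)^-1).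
Proof.
elim: k => [|k IH] /=; first by rewrite invg1 mulg1.
by rewrite IH !invgM -!mulgA mulVT mulTV.
Qed.
Let chain_div k : chain sV (y * x^-1) k = yc k * (jm s k * (xc k)^-1).
Proof.
elim: k => [|k IH] /=; first by rewrite mul1g.
by rewrite IH !invgM -!mulgA mulVT mulTV.
Qed.

Let prod_mul k : (k <= N.+1)%N -> chain_prod sV (y * x) k = wy k * wx k.
Proof.
elim: k => [|k IH] kN; first by rewrite mulg1.
rewrite [LHS]/= IH ?(ltnW kN) // chain_mul -mulgA prod_yT //.
rewrite (mulgA (wx k)) -[wx k * xc k]/(wx k.+1) (jm_prodT sB x_sq x_comm) //.
by rewrite mulgV mulg1 mulgA.
Qed.
Let prod_div k : (k <= N.+1)%N -> chain_prod sV (y * x^-1) k = wy k * (wx k)^-1.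
Proof.
elim: k => [|k IH] kN; first by rewrite invg1 mulg1.
rewrite [LHS]/= IH ?(ltnW kN) // chain_div.
have e t : (wx k)^-1 * (yc k * (jm s k * t)) = yc k * ((wx k)^-1 * t).
  by apply: (mulgI (wx k)); rewrite mulTV prod_yT // mulTV.
rewrite -mulgA e /= invgM -!mulgA; congr (_ * (_ * _)).
rewrite -!invgM; congr (_^-1); apply: tailP => t.
by rewrite -!mulgA (prod_chainT sB x_sq x_comm).
Qed.

Lemma ell_sys_mul : ell_sys n s x (y * x).
Proof.
case: (sys) => _ sx [_ _ wy1] _; split=> //; first split.
- move=> n1; apply: tailP => t; rewrite -!mulgA !M0 // y_sqT //.
  by rewrite mulVT x_sqT // mulTV.
- by move=> i iN; rewrite -mulgA x_commV // !mulgA y_comm.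
- case: (n) (prod_mul (k := n)) wy1 sx => [//|m] -> // -> [_ _ ->].
  by rewrite mulg1.
- move=> n1; move: (xc 1) (pureR n1) (x_comm0T n1) => u <- ux.
  apply: tailP => t; rewrite invgM -!mulgA; congr (y * _).
  have uVx v : x * (u^-1 * v) = u^-1 * (x * v).
    by apply: (mulgI u); rewrite mulTV ux mulTV.
  by rewrite uVx mulTV.
Qed.

Lemma ell_sys_div : ell_sys n s x (y * x^-1).
Proof.
case: (sys) => _ sx [_ _ wy1] _; split=> //; first split.
- move=> n1; apply: tailP => t; rewrite -!mulgA.
  have M1 u : x^-1 * ((s 0%N)^-1 * (y * u)) =
     (s 0%N)^-1 * (y * ((s 0%N)^-1 * (x^-1 * ((s 0%N)^-1 * u)))).
    by apply: (mulgI x); rewrite mulTV M0 // !mulTV.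
  have xV u : (s 0%N)^-1 * (x^-1 * ((s 0%N)^-1 * (x^-1 * u))) =
      x^-1 * ((s 0%N)^-1 * (x^-1 * ((s 0%N)^-1 * u))).
    apply: (mulgI (x * s 0%N * x * s 0%N)); rewrite -!mulgA !(mulTV, mulVT).
    by rewrite -x_sqT // !(mulTV, mulVT).
  by rewrite !M1 y_sqT // xV.
- move=> i iN; rewrite -mulgA; apply: tailP => t; rewrite -!mulgA.
  have xVs u : x^-1 * ((s i)^-1 * u) = (s i)^-1 * (x^-1 * u).
    by apply: (mulgI x); rewrite mulTV (commT (x_commV iN)) mulTV.
  by rewrite xVs (commT (y_comm iN)).
- case: (n) (prod_div (k := n)) wy1 sx => [//|m] -> // -> [_ _ ->].
  by rewrite invg1 mulg1.
- move=> n1; move: (xc 1) (pureR n1) (x_comm0T n1) => u <- ux.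
  apply: tailP => t; rewrite invgM invgK -!mulgA; congr (y * _).
  have uVx v : x * (u^-1 * v) = u^-1 * (x * v).
    by apply: (mulgI u); rewrite mulTV ux mulTV.
  by rewrite -uVx mulVT.
Qed.

Lemma ell_sys_swap : ell_sys n sV y x.
Proof.
have sVV : (fun i => (s i)^-1^-1) = s by apply/funext => i; rewrite invgK.
case: (sys) => _ sx sy _; split; [exact: sVB | exact: sy | by rewrite sVV |].
move=> n1; apply: tailP => t; rewrite /= !invgM invgK -!mulgA.
have M1 u : x^-1 * ((s 0%N)^-1 * (y * u)) =
   (s 0%N)^-1 * (y * ((s 0%N)^-1 * (x^-1 * ((s 0%N)^-1 * u)))).
  by apply: (mulgI x); rewrite mulTV M0 // !mulTV.
by rewrite M1 !(mulTV, mulVT).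
Qed.
End Twist.

Lemma ell_sys_mulr n s x y : ell_sys n s x y -> ell_sys n s (x * y) y.
Proof.
move=> /ell_sys_swap/ell_sys_mul/ell_sys_swap.
by congr ell_sys; apply/funext => i; rewrite invgK.
Qed.

Lemma ell_sys_divr n s x y : ell_sys n s x y -> ell_sys n s (x * y^-1) y.
Proof.
move=> /ell_sys_swap/ell_sys_div/ell_sys_swap.
by congr ell_sys; apply/funext => i; rewrite invgK.
Qed.
End EllipticRelations.

Declare Scope gterm_scope.
Delimit Scope gterm_scope with gt.
Notation "u * v" := (GMul u v) : gterm_scope.
Notation "u ^-1" := (GInv u) : gterm_scope.
Notation "1" := GOne : gterm_scope.

Section PresentedAut.
Variables (T : Type) (R : gterm T -> gterm T -> Prop).
Variables (f g : T -> presented R) (Rf : satisfies R f) (Rg : satisfies R g).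
Hypothesis fgK : forall t, pres_lift Rf (g t) = pres_gen R t.
Hypothesis gfK : forall t, pres_lift Rg (f t) = pres_gen R t.

Fact pres_autK : cancel (pres_lift Rf) (pres_lift Rg).
Proof.
apply: (pres_hom_eq (h := pres_lift Rg \o pres_lift Rf) (k := id)) => [x y|//|t] /=.
  by rewrite !gmulfM.
by rewrite pres_lift_gen.
Qed.
Fact pres_autKV : cancel (pres_lift Rg) (pres_lift Rf).
Proof.
apply: (pres_hom_eq (h := pres_lift Rf \o pres_lift Rg) (k := id)) => [x y|//|t] /=.
  by rewrite !gmulfM.
by rewrite pres_lift_gen.
Qed.
Fact pres_aut_subproof : is_gaut (Bij pres_autK pres_autKV).
Proof. by apply/asboolP => x y; exact: gmulfM. Qed.
(* The automorphism t |-> f t, with inverse t |-> g t. *)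
Definition pres_aut : gaut (presented R) :=
  exist _ (Bij pres_autK pres_autKV) pres_aut_subproof.

Lemma pres_aut_gen t : gaut_fun pres_aut (pres_gen R t) = f t.
Proof. exact: pres_lift_gen. Qed.
End PresentedAut.

Lemma gaut_mulE (G : groupType) (f g : gaut G) x :
  gaut_fun (f * g)%g x = gaut_fun f (gaut_fun g x).
Proof. by []. Qed.

Lemma gmulfV' (G H : groupType) (h : {multiplicative G -> H}) x :
  h x^-1%g = (h x)^-1%g.
Proof. by apply: (mulgI (h x)); rewrite -gmulfM !mulgV gmulf1'. Qed.

Lemma pres_gaut_eq (T : Type) (R : gterm T -> gterm T -> Prop) (f g : gaut (presented R)) :
  (forall t, gaut_fun f (pres_gen R t) = gaut_fun g (pres_gen R t)) -> f = g.
Proof. by move=> fg; apply/val_inj/bijP; apply: pres_hom_eq fg; exact: gmulfM. Qed.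

(* Psi_+ and Psi_- are the generators true and false. *)
Inductive braid3_rel : gterm bool -> gterm bool -> Prop :=
  Braid3Rel : let p := GVar true in let m := GVar false in
    braid3_rel (p * m * p)%gt (m * p * m)%gt.

Definition B3 : groupType := presented braid3_rel.

Definition no_rel (u v : gterm bool) : Prop := False.

(* The free group on X (true) and Y (false). *)
Definition F2 : groupType := presented no_rel.
Definition F2_X : F2 := pres_gen no_rel true.
Definition F2_Y : F2 := pres_gen no_rel false.

Section ActionF2.
Local Open Scope group_scope.

Lemma no_relP (f : bool -> F2) : satisfies no_rel f. Proof. by []. Qed.

Local Notation X := F2_X.
Local Notation Y := F2_Y.

Definition F2_plus_val (b : bool) : F2 := if b then X else Y * X.
Definition F2_plus_inv (b : bool) : F2 := if b then X else Y * X^-1.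
Definition F2_minus_val (b : bool) : F2 := if b then X * Y^-1 else Y.
Definition F2_minus_inv (b : bool) : F2 := if b then X * Y else Y.

Fact F2_plusK b :
  pres_lift (@no_relP F2_plus_val) (F2_plus_inv b) = pres_gen no_rel b.
Proof.
by case: b; rewrite /= ?(gmulfM, gmulfV') /= !pres_lift_gen //= mulgK.
Qed.
Fact F2_plusKV b :
  pres_lift (@no_relP F2_plus_inv) (F2_plus_val b) = pres_gen no_rel b.
Proof.
by case: b; rewrite /= ?(gmulfM, gmulfV') /= !pres_lift_gen //= mulgVK.
Qed.
Fact F2_minusK b :
  pres_lift (@no_relP F2_minus_val) (F2_minus_inv b) = pres_gen no_rel b.
Proof.
by case: b; rewrite /= ?(gmulfM, gmulfV') /= !pres_lift_gen //= mulgVK.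
Qed.
Fact F2_minusKV b :
  pres_lift (@no_relP F2_minus_inv) (F2_minus_val b) = pres_gen no_rel b.
Proof.
by case: b; rewrite /= ?(gmulfM, gmulfV') /= !pres_lift_gen //= mulgK.
Qed.

(* X |-> X, Y |-> Y * X *)
Definition F2_plus : gaut F2 := pres_aut F2_plusK F2_plusKV.
(* X |-> X * Y^-1, Y |-> Y *)
Definition F2_minus : gaut F2 := pres_aut F2_minusK F2_minusKV.

Fact F2_braid : satisfies braid3_rel (fun b : bool => if b then F2_plus else F2_minus).
Proof.
move=> _ _ [] /=.
have pX : gaut_fun F2_plus X = X by exact: pres_aut_gen.
have pY : gaut_fun F2_plus Y = Y * X by exact: pres_aut_gen.
have mX : gaut_fun F2_minus X = X * Y^-1 by exact: pres_aut_gen.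
have mY : gaut_fun F2_minus Y = Y by exact: pres_aut_gen.
apply: pres_gaut_eq => -[]; rewrite !gaut_mulE -/X -/Y.
  by rewrite !(pX, mX, pY, mY, gmulfM, gmulfV', invgM, mulgA, mulgV, mulgK, mulgVK, mul1g).
by rewrite !(pX, mX, pY, mY, gmulfM, gmulfV', invgM, mulgA, mulgV, mulgK, mulgVK, mul1g).
Qed.

Definition B3_F2 : {multiplicative B3 -> gaut F2} := pres_lift F2_braid.
End ActionF2.

(* The composite morphism B3 -> Aut F2 -> Aut(Lie F2). *)
Definition rho_F2 : {multiplicative B3 -> aut_functor (malcev F2) rat^o} :=
  gaut_malcev rat^o \o B3_F2.

(* EllSigma i is sigma_(i+1); EllX true and EllX false are X_1^+ and X_1^-. *)
Inductive ell_gen (n : nat) : Type := EllSigma of 'I_n.-1 | EllX of bool.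
Arguments EllX {n}.

Section EllipticBraid.
Variable n : nat.
Local Open Scope gterm_scope.

(* sig e k = sigma_(k+1)^e, where true and false stand for 1 and -1. *)
Definition sig (e : bool) (k : nat) : gterm (ell_gen n) :=
  if insub k is Some i then
    if e then GVar (EllSigma i) else (GVar (EllSigma i))^-1
  else 1.

(* ellX e k = X_(k+1)^e *)
Fixpoint ellX (e : bool) (k : nat) : gterm (ell_gen n) :=
  if k is k'.+1 then sig e k' * ellX e k' * sig e k' else GVar (EllX e).

(* X_1^e ... X_k^e *)
Fixpoint ellX_prod (e : bool) (k : nat) : gterm (ell_gen n) :=
  if k is k'.+1 then ellX_prod e k' * ellX e k' else 1.

Inductive ell_rel : gterm (ell_gen n) -> gterm (ell_gen n) -> Prop :=
  | EllBraid i : (i.+1 < n.-1)%N ->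
      ell_rel (sig true i * sig true i.+1 * sig true i)
              (sig true i.+1 * sig true i * sig true i.+1)
  | EllFar i j : (i.+1 < j < n.-1)%N ->
      ell_rel (sig true i * sig true j) (sig true j * sig true i)
  | EllSquare e : (1 < n)%N ->
      ell_rel ((sig e 0 * GVar (EllX e)) * (sig e 0 * GVar (EllX e)))
              ((GVar (EllX e) * sig e 0) * (GVar (EllX e) * sig e 0))
  | EllComm e i : (0 < i < n.-1)%N ->
      ell_rel (GVar (EllX e) * sig true i) (sig true i * GVar (EllX e))
  | EllPure : (1 < n)%N ->
      ell_rel (ellX false 0 * (ellX true 1)^-1 * (ellX false 0)^-1 * ellX true 1)
              (sig true 0 * sig true 0)
  | EllProd e : ell_rel (ellX_prod e n) 1.

(* The reduced elliptic braid group. *)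
Definition ell_braid : groupType := presented ell_rel.

End EllipticBraid.

Section EllipticAction.
Variable n : nat.
Local Open Scope group_scope.

Section Assignment.
Variables (G : groupType) (f : ell_gen n -> G).
Let s k : G := geval f (sig n true k).
Let x : G := f (EllX true).
Let y : G := f (EllX false).

Lemma geval_sigV k : geval f (sig n false k) = (s k)^-1.
Proof. by rewrite /s /sig; case: insubP => //=; rewrite invg1. Qed.

Lemma geval_ellX k : geval f (ellX n true k) = chain s x k.
Proof. by elim: k => //= k ->. Qed.
Lemma geval_ellXV k : geval f (ellX n false k) = chain (fun i => (s i)^-1) y k.
Proof. by elim: k => //= k ->; rewrite geval_sigV. Qed.
Lemma geval_ellX_prod k : geval f (ellX_prod n true k) = chain_prod s x k.
Proof. by elim: k => //= k ->; rewrite geval_ellX. Qed.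
Lemma geval_ellX_prodV k :
  geval f (ellX_prod n false k) = chain_prod (fun i => (s i)^-1) y k.
Proof. by elim: k => //= k ->; rewrite geval_ellXV. Qed.

Lemma ell_satisfiesP : satisfies (@ell_rel n) f <-> ell_sys n s x y.
Proof.
split=> [H|].
  split; [split|split|split|].
  - by move=> i iN; exact: H (EllBraid iN).
  - by move=> i j ij; exact: H (EllFar ij).
  - by move=> n1; exact: H (EllSquare true n1).
  - by move=> i iN; exact: H (EllComm true iN).
  - by rewrite -geval_ellX_prod; exact: H (EllProd n true).
  - by move=> n1; have := H _ _ (EllSquare false n1); rewrite /= geval_sigV.
  - by move=> i iN; apply/esym/commV/esym; exact: H (EllComm false iN).
  - by rewrite -geval_ellX_prodV; exact: H (EllProd n false).
  - by move=> n1; exact: H (EllPure n1).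
case=> -[br far] [xsq xc xp] [ysq yc yp] pr _ _ [] => [i iN|i j ij|[] n1|[] i iN|n1|[]].
- exact: br.
- exact: far.
- exact: xsq.
- by rewrite /= geval_sigV; exact: ysq.
- exact: xc.
- have := yc _ iN => /esym/commV; rewrite invgK => /esym; exact.
- exact: pr.
- by rewrite geval_ellX_prod.
- by rewrite geval_ellX_prodV.
Qed.

End Assignment.

Local Notation B := (ell_braid n).

Definition ell_X (e : bool) : B := pres_gen (@ell_rel n) (EllX e).

(* The assignment sigma_i |-> sigma_i, X_1^+ |-> x, X_1^- |-> y. *)
Definition ell_val (x y : B) (t : ell_gen n) : B :=
  match t with
  | EllSigma i => pres_gen (@ell_rel n) (EllSigma i)
  | EllX e => if e then x else y
  end.

Let sgm k : B := geval (pres_gen (@ell_rel n)) (sig n true k).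

Let geval_ell_val x y k : geval (ell_val x y) (sig n true k) = sgm k.
Proof. by rewrite /sgm /sig; case: insubP. Qed.

Lemma ell_valP x y : ell_sys n sgm x y -> satisfies (@ell_rel n) (ell_val x y).
Proof.
move=> H; apply/ell_satisfiesP.
by rewrite (_ : (fun k => _) = sgm) //; apply/funext => k; exact: geval_ell_val.
Qed.

Let X := ell_X true.
Let Y := ell_X false.

Lemma ell_braid_sys : ell_sys n sgm X Y.
Proof. exact/ell_satisfiesP/pres_genP. Qed.

Definition ell_plus_val := ell_val X (Y * X).
Definition ell_plus_inv := ell_val X (Y * X^-1).
Definition ell_minus_val := ell_val (X * Y^-1) Y.
Definition ell_minus_inv := ell_val (X * Y) Y.

Fact ell_plus_valP : satisfies (@ell_rel n) ell_plus_val.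
Proof. exact/ell_valP/ell_sys_mul/ell_braid_sys. Qed.
Fact ell_plus_invP : satisfies (@ell_rel n) ell_plus_inv.
Proof. exact/ell_valP/ell_sys_div/ell_braid_sys. Qed.
Fact ell_minus_valP : satisfies (@ell_rel n) ell_minus_val.
Proof. exact/ell_valP/ell_sys_divr/ell_braid_sys. Qed.
Fact ell_minus_invP : satisfies (@ell_rel n) ell_minus_inv.
Proof. exact/ell_valP/ell_sys_mulr/ell_braid_sys. Qed.

Fact ell_plusK t :
  pres_lift ell_plus_valP (ell_plus_inv t) = pres_gen (@ell_rel n) t.
Proof.
by case: t => [i|[]]; rewrite /= ?(gmulfM, gmulfV') /= !pres_lift_gen //= mulgK.
Qed.
Fact ell_plusKV t :
  pres_lift ell_plus_invP (ell_plus_val t) = pres_gen (@ell_rel n) t.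
Proof.
by case: t => [i|[]]; rewrite /= ?(gmulfM, gmulfV') /= !pres_lift_gen //= mulgVK.
Qed.
Fact ell_minusK t :
  pres_lift ell_minus_valP (ell_minus_inv t) = pres_gen (@ell_rel n) t.
Proof.
by case: t => [i|[]]; rewrite /= ?(gmulfM, gmulfV') /= !pres_lift_gen //= mulgVK.
Qed.
Fact ell_minusKV t :
  pres_lift ell_minus_invP (ell_minus_val t) = pres_gen (@ell_rel n) t.
Proof.
by case: t => [i|[]]; rewrite /= ?(gmulfM, gmulfV') /= !pres_lift_gen //= mulgK.
Qed.

(* sigma_i |-> sigma_i, X_1^+ |-> X_1^+, X_1^- |-> X_1^- * X_1^+ *)
Definition ell_plus : gaut B := pres_aut ell_plusK ell_plusKV.
(* sigma_i |-> sigma_i, X_1^+ |-> X_1^+ * (X_1^-)^-1, X_1^- |-> X_1^- *)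
Definition ell_minus : gaut B := pres_aut ell_minusK ell_minusKV.

Fact ell_braid_rel : satisfies braid3_rel (fun b : bool => if b then ell_plus else ell_minus).
Proof.
move=> _ _ [] /=.
have pS i : gaut_fun ell_plus (pres_gen _ (EllSigma i)) = pres_gen _ (EllSigma i).
  exact: pres_aut_gen.
have mS i : gaut_fun ell_minus (pres_gen _ (EllSigma i)) = pres_gen _ (EllSigma i).
  exact: pres_aut_gen.
have pX : gaut_fun ell_plus X = X by exact: pres_aut_gen.
have pY : gaut_fun ell_plus Y = Y * X by exact: pres_aut_gen.
have mX : gaut_fun ell_minus X = X * Y^-1 by exact: pres_aut_gen.
have mY : gaut_fun ell_minus Y = Y by exact: pres_aut_gen.
apply: pres_gaut_eq => -[i|[]]; rewrite !gaut_mulE -/X -/Y; first by rewrite !(pS, mS).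
  by rewrite !(pX, mX, pY, mY, gmulfM, gmulfV', invgM, mulgA, mulgV, mulgK, mulgVK, mul1g).
by rewrite !(pX, mX, pY, mY, gmulfM, gmulfV', invgM, mulgA, mulgV, mulgK, mulgVK, mul1g).
Qed.

Definition B3_ell_braid : {multiplicative B3 -> gaut B} := pres_lift ell_braid_rel.

Fact ell_gen_lt (i : 'I_n.-1) : (i < n)%N.
Proof. exact: leq_trans (ltn_ord i) (leq_pred n). Qed.
Fact ell_gen_ltS (i : 'I_n.-1) : (i.+1 < n)%N.
Proof. by case: (n) i => [|m] [i ?]. Qed.

(* sigma_i |-> (i, i+1), X_1^+ and X_1^- |-> 1; strands are numbered from 0. *)
Definition ell_perm_val (t : ell_gen n) : 'S_n :=
  match t with
  | EllSigma i => tperm (Ordinal (ell_gen_lt i)) (Ordinal (ell_gen_ltS i))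
  | EllX _ => 1
  end.

Let sp k : 'S_n := geval ell_perm_val (sig n true k).

Let spK k : sp k * sp k = 1.
Proof. by rewrite /sp /sig; case: insubP => /= [i _ _|_]; rewrite ?tperm2 ?mulg1. Qed.
Let spV k : (sp k)^-1 = sp k.
Proof. by apply: (mulgI (sp k)); rewrite mulgV spK. Qed.

Let spE k (k1 : (k < n)%N) (k2 : (k.+1 < n)%N) : sp k = tperm (Ordinal k1) (Ordinal k2).
Proof.
have kN : (k < n.-1)%N by case: (n) k2.
rewrite /sp /sig insubT /=; congr tperm; exact: val_inj.
Qed.

Fact ell_permP : satisfies (@ell_rel n) ell_perm_val.
Proof.
have sp_chain k : chain sp 1 k = 1 by elim: k => //= k ->; rewrite mulg1 spK.
have sp_prod k : chain_prod sp 1 k = 1.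
  by elim: k => //= k ->; rewrite sp_chain mulg1.
have spVE : (fun i => (sp i)^-1) = sp by apply/funext.
apply/ell_satisfiesP; rewrite -[fun k => _]/sp; split.
- split=> [i iN|i j /andP[ij jN]].
    have i3 : (i.+2 < n)%N by case: (n) iN.
    rewrite (spE (ltnW (ltnW i3)) (ltnW i3)) (spE (ltnW i3) i3).
    set a := Ordinal _; set b := Ordinal _; set c := Ordinal _.
    have ab : a != b by rewrite -val_eqE /= neq_ltn ltnSn.
    have ac : a != c by rewrite -val_eqE /= neq_ltn ltnW.
    have bc : b != c by rewrite -val_eqE /= neq_ltn ltnSn.
    have e1 : tperm a b * tperm b c * tperm a b = tperm a c.
      rewrite -{1}(tpermV a b) -mulgA -[LHS]/(tperm b c ^ tperm a b) tpermJ.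
      by rewrite tpermR tpermD.
    have e2 : tperm b c * tperm a b * tperm b c = tperm a c.
      rewrite -{1}(tpermV b c) -mulgA -[LHS]/(tperm a b ^ tperm b c) tpermJ.
      by rewrite tpermL tpermD // eq_sym.
    by rewrite e1 e2.
  have j2 : (j.+1 < n)%N by case: (n) jN.
  have i2 : (i.+1 < n)%N by exact: ltn_trans (ltnW j2).
  rewrite (spE (ltnW i2) i2) (spE (ltnW j2) j2).
  by apply/esym/commgP/conjg_fixP; rewrite tpermJ !tpermD // -val_eqE /= ltn_eqF //;
    do ?[exact: ltnW | exact: ltnW (ltnW _)].
- by split=> [n1|i iN|]; rewrite ?mulg1 ?mul1g.
- by split=> [n1|i iN|]; rewrite ?spVE ?mulg1 ?mul1g.
- by move=> n1; rewrite sp_chain spK invg1 !mulg1.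
Qed.

Definition ell_perm : {multiplicative B -> 'S_n} := pres_lift ell_permP.

Definition ell_pure_pred : {pred B} := fun x => ell_perm x == 1.

Fact ell_pure_closed : group_closed ell_pure_pred.
Proof.
split; first by apply/eqP; exact: gmulf1'.
by move=> x y /eqP x1 /eqP y1; apply/eqP; rewrite gmulfM gmulfV' x1 y1 mulgV.
Qed.

(* The pure elliptic braid group P_{1,n}. *)
Definition ell_pure : Type := {x : B | ell_pure_pred x}.
HB.instance Definition _ := SubChoice.on ell_pure.
HB.instance Definition _ :=
  SubChoice_isSubGroup.Build B ell_pure_pred ell_pure ell_pure_closed.

Lemma B3_perm b x : ell_perm (gaut_fun (B3_ell_braid b) x) = ell_perm x.
Proof.
elim/pres_ind: b x => t; rewrite -geval_pres_gen.
rewrite (morph_geval _ _ (h := B3_ell_braid)); last exact: gmulfM.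
elim: t => [b|| u IHu v IHv|u IHu] x //=.
- rewrite pres_lift_gen.
  have H (f : gaut B) : (forall t, ell_perm (gaut_fun f (pres_gen _ t)) =
      ell_perm (pres_gen _ t)) -> ell_perm (gaut_fun f x) = ell_perm x.
    move=> fE; apply: (pres_hom_eq (h := ell_perm \o gaut_fun f) _ _ fE) => u v /=;
      by rewrite !gmulfM.
  have E t : ell_perm (pres_gen _ t) = ell_perm_val t by exact: pres_lift_gen.
  case: b; apply: H => -[i|[]]; rewrite pres_aut_gen /= ?gmulfM ?gmulfV' !E //=;
    by rewrite ?invg1 ?mulg1.
- exact: etrans (IHu _) (IHv _).
- set f := geval _ u in IHu *.
  by rewrite -[LHS]IHu; congr (ell_perm _); exact: (bijKV (val f)).
Qed.

Section Restrict.
Variable b : B3.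

Fact B3_pure_subproof (x : ell_pure) :
  ell_pure_pred (gaut_fun (B3_ell_braid b) (val x)).
Proof. by apply/eqP; rewrite B3_perm; exact/eqP/(valP x). Qed.
Definition B3_pure_fun (x : ell_pure) : ell_pure :=
  exist _ (gaut_fun (B3_ell_braid b) (val x)) (B3_pure_subproof x).
End Restrict.

Lemma B3_pure_funM b c x : B3_pure_fun (b * c) x = B3_pure_fun b (B3_pure_fun c x).
Proof. by apply: val_inj => /=; rewrite gmulfM. Qed.
Lemma B3_pure_fun1 x : B3_pure_fun 1 x = x.
Proof. by apply: val_inj => /=; rewrite gmulf1'. Qed.

Fact B3_pureK b : cancel (B3_pure_fun b) (B3_pure_fun b^-1).
Proof. by move=> x; rewrite -B3_pure_funM mulVg B3_pure_fun1. Qed.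
Fact B3_pureKV b : cancel (B3_pure_fun b^-1) (B3_pure_fun b).
Proof. by move=> x; rewrite -B3_pure_funM mulgV B3_pure_fun1. Qed.
Fact B3_pure_aut b : is_gaut (Bij (B3_pureK b) (B3_pureKV b)).
Proof. by apply/asboolP => x y; apply: val_inj; exact: gmulfM. Qed.

(* The restriction to P_{1,n} of the action of B3. *)
Definition B3_pure (b : B3) : gaut ell_pure :=
  exist _ (Bij (B3_pureK b) (B3_pureKV b)) (B3_pure_aut b).
Fact B3_pureM : {morph B3_pure : b c / b * c}.
Proof. by move=> b c; apply/val_inj/bijP => x; exact: B3_pure_funM. Qed.
HB.instance Definition _ := isMultiplicative.Build B3 (gaut ell_pure) B3_pure B3_pureM.

(* The composite morphism B3 -> Aut P_{1,n} -> Aut(Lie P_{1,n}). *)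
Definition rho_ell : {multiplicative B3 -> aut_functor (malcev ell_pure) rat^o} :=
  gaut_malcev rat^o \o B3_pure.

End EllipticAction.

(* P_{1,1} is trivial. *)
Lemma ell_pure1 (x : ell_pure 1) : x = 1%g.
Proof.
apply: val_inj; apply: (pres_hom_eq (h := id) (k := fun=> 1%g)) => // [u v|t].
  by rewrite mulg1.
case: t => [[]//|e]; have := pres_genP (EllProd 1 e).
by rewrite /= mul1g.
Qed.

(* Main.v *)
Require Import Defs.
From HB Require Import structures.
From mathcomp Require Import all_boot all_order all_algebra all_fingroup.
From mathcomp Require Import generic_quotient ring_quotient boolp classical_sets functions.
From mathcomp Require Import ring zify.

(** Conjugating X |-> X_1^+, Y |-> X_1^- by the elements g of B_{1,n} fixed by B_3 (such as
    the sigma_i) gives B_3-equivariant morphisms F_2 -> P_{1,n}.  Their images generate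
    P_{1,n}, because modulo the conjugates of the X_1^{+-} the sigma_i satisfy the Coxeter
    relations of S_n; and the one for g = 1 is split by the map keeping only the first two
    strands.  In the Lie algebra of a finitely generated group every element vanishing on
    additive functions is a sum of brackets with logarithms of generators, so the images of
    Lie F_2 generate Lie P_{1,n} modulo every term of its lower central series.
    Consequently "f' restricts to f on every copy of Lie F_2" is the graph of an isomorphism
    between a subgroup functor of Aut F_2 and one of Aut P_{1,n}; both are closed and the
    graph contains the image of B_3, so it restricts to an isomorphism of Zariski closures. *)

Set Implicit Arguments.
Unset Strict Implicit.
Unset Printing Implicit Defensive.

Import GRing.Theory.
Local Open Scope ring_scope.

(** * Zariski closures and correspondences *)

(** An automorphism on one side need not have a partner on the other, so a graph with a closed
    domain on each side replaces a morphism. The two domains have different equations. On the F_2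
    side, bracket words that are small in Lie P_{1,n} must stay small after transport. On the
    P_{1,n} side, every copy must be moved by the map read off from the split copy. Each condition
    is imposed on the inverse as well, since by itself it only produces an endomorphism of the other
    side.

    The conjugators [g] are required to be fixed by B_3 because the copy through g X g^-1 would
    otherwise not be equivariant; that these copies still generate a normal subgroup then needs an
    argument ([conjX_normal]).

    Lie Gamma is given only as a space of derivations of unipotent functions, so membership in
    [L, L] means producing brackets. This is done by duality: a functional is extended by Zorn's
    lemma, and its components turn out to be tangent vectors. The same extension result gives
    coordinates in tensor products over Q, hence equations. *)

Section QuotientAlgebra.
Variables (R : comNzRingType) (K : comAlgType R) (I : idealr K).

Definition quot_alg : Type := {ideal_quot I}.
HB.instance Definition _ := GRing.ComNzRing.on quot_alg.

Definition quot_pi (x : K) : quot_alg := \pi_({ideal_quot I})%qT x.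

Fact quot_pi_zmod : zmod_morphism quot_pi.
Proof. by move=> x y; rewrite /quot_pi !piE. Qed.
Fact quot_pi_monoid : monoid_morphism quot_pi.
Proof. by split=> [|x y]; rewrite /quot_pi !piE. Qed.
HB.instance Definition _ := GRing.isZmodMorphism.Build K quot_alg quot_pi quot_pi_zmod.
HB.instance Definition _ := GRing.isMonoidMorphism.Build K quot_alg quot_pi quot_pi_monoid.

Lemma quot_pi_surj (y : quot_alg) : exists x, y = quot_pi x.
Proof. by exists (repr (y : {ideal_quot I})); rewrite /quot_pi reprK. Qed.

Lemma quot_pi_eq x y : quot_pi x = quot_pi y <-> x - y \in I.
Proof.
by split=> [/eqP|xy]; rewrite /quot_pi; [|apply/eqP]; rewrite -(Quotient.idealrBE I).
Qed.

Definition quot_scale (a : R) (x : quot_alg) : quot_alg := quot_pi a%:A * x.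
Fact quot_scaleA a b v : quot_scale a (quot_scale b v) = quot_scale (a * b) v.
Proof. by rewrite /quot_scale mulrA -rmorphM -scalerAl mul1r scalerA. Qed.
Fact quot_scale1 : left_id 1 quot_scale.
Proof. by move=> x; rewrite /quot_scale scale1r rmorph1 mul1r. Qed.
Fact quot_scaleDr : right_distributive quot_scale +%R.
Proof. by move=> a x y; rewrite /quot_scale mulrDr. Qed.
Fact quot_scaleDl v : {morph quot_scale^~ v : a b / a + b}.
Proof. by move=> a b; rewrite /quot_scale scalerDl rmorphD mulrDl. Qed.
HB.instance Definition _ := GRing.Zmodule_isLmodule.Build R quot_alg
  quot_scaleA quot_scale1 quot_scaleDr quot_scaleDl.
Fact quot_scaleAl (a : R) (u v : quot_alg) : a *: (u * v) = (a *: u) * v.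
Proof. exact: mulrA. Qed.
HB.instance Definition _ := GRing.Lmodule_isLalgebra.Build R quot_alg quot_scaleAl.
HB.instance Definition _ := GRing.Lalgebra_isComAlgebra.Build R quot_alg.

Fact quot_pi_scale : scalable quot_pi.
Proof.
move=> a x; rewrite -[RHS]/(quot_pi a%:A * quot_pi x).
by rewrite -rmorphM /= -scalerAl mul1r.
Qed.
HB.instance Definition _ := GRing.isScalable.Build R K quot_alg *:%R quot_pi quot_pi_scale.

Section Factor.
Variables (K' : comAlgType R) (phi : {lrmorphism K -> K'}).
Hypothesis phiI : forall x, x \in I -> phi x = 0.

Definition quot_factor (y : quot_alg) : K' := phi (repr (y : {ideal_quot I})).

Lemma quot_factorE x : quot_factor (quot_pi x) = phi x.
Proof.
apply/eqP; rewrite -subr_eq0 -rmorphB /=; apply/eqP/phiI/quot_pi_eq.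
by rewrite /quot_pi reprK.
Qed.

Fact quot_factor_zmod : zmod_morphism quot_factor.
Proof.
move=> y z; have [[x ->] [t ->]] := (quot_pi_surj y, quot_pi_surj z).
by rewrite -rmorphB !quot_factorE rmorphB.
Qed.
Fact quot_factor_monoid : monoid_morphism quot_factor.
Proof.
split=> [|y z]; first by rewrite -(rmorph1 quot_pi) quot_factorE rmorph1.
have [[x ->] [t ->]] := (quot_pi_surj y, quot_pi_surj z).
by rewrite -rmorphM !quot_factorE rmorphM.
Qed.
Fact quot_factor_scale : scalable quot_factor.
Proof.
move=> a y; have [x ->] := quot_pi_surj y.
by rewrite -linearZ !quot_factorE linearZ.
Qed.
HB.instance Definition _ := GRing.isZmodMorphism.Build quot_alg K' quot_factor quot_factor_zmod.
HB.instance Definition _ :=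
  GRing.isMonoidMorphism.Build quot_alg K' quot_factor quot_factor_monoid.
HB.instance Definition _ :=
  GRing.isScalable.Build R quot_alg K' *:%R quot_factor quot_factor_scale.
Definition quot_factor_lrmorphism : {lrmorphism quot_alg -> K'} := quot_factor.
End Factor.
End QuotientAlgebra.

Lemma lrmorphism_eq (R : comNzRingType) (K K' : comAlgType R)
  (phi psi : {lrmorphism K -> K'}) : phi =1 psi -> phi = psi.
Proof.
case: phi psi => f fP [g gP] /= /funext fg; subst g; congr GRing.LRMorphism.Pack.
case: fP gP => [[a1] [a2] [a3]] [[b1] [b2] [b3]].
by rewrite (Prop_irrelevance a1 b1) (Prop_irrelevance a2 b2) (Prop_irrelevance a3 b3).
Qed.

(** Instead of the ideal generated by [J], the common kernel of all morphisms killing [J] is divided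
    out, which makes the factorisation immediate. The point [phi0] keeps this ideal proper: algebras
    are nonzero rings here. *)
Lemma universal_quotient (R : comNzRingType) (K K0 : comAlgType R) (J : K -> Prop)
    (phi0 : {lrmorphism K -> K0}) : (forall c, J c -> phi0 c = 0) ->
  exists (Q : comAlgType R) (p : {lrmorphism K -> Q}),
    [/\ forall y, exists x, y = p x, forall c, J c -> p c = 0
      & forall (K' : comAlgType R) (phi : {lrmorphism K -> K'}),
        (forall c, J c -> phi c = 0) ->
        exists psi : {lrmorphism Q -> K'}, phi = psi \o p :> {lrmorphism K -> K'}].
Proof.
move=> phi0J.
pose I : {pred K} := fun x => `[< forall (K' : comAlgType R) (phi : {lrmorphism K -> K'}),
  (forall c, J c -> phi c = 0) -> phi x = 0 >].
have I_ideal : idealr_closed I.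
  split; first by apply/asboolP => K' phi _; rewrite rmorph0.
    by apply/asboolP => /(_ _ _ phi0J) /eqP; rewrite rmorph1 oner_eq0.
  move=> a u v /asboolP uI /asboolP vI; apply/asboolP => K' phi phiJ.
  by rewrite rmorphD rmorphM /= (uI _ _ phiJ) (vI _ _ phiJ) mulr0 addr0.
pose II : idealr K := HB.pack I (isIdealr.Build K I I_ideal).
exists (quot_alg II), (@quot_pi _ _ II); split=> [y|c Jc|K' phi phiJ].
- exact: quot_pi_surj.
- rewrite -(rmorph0 (@quot_pi _ _ II)); apply/quot_pi_eq.
  by rewrite subr0; apply/asboolP => K' phi; apply.
- have phiI x : x \in II -> phi x = 0 by move=> /asboolP; exact.
  exists (quot_factor_lrmorphism phiI); apply: lrmorphism_eq => x /=.
  by rewrite quot_factorE.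
Qed.

Definition closed_condition (K : comAlgType rat)
    (P : forall K' : comAlgType rat, {lrmorphism K -> K'} -> Prop) : Prop :=
  exists J : K -> Prop, forall (K' : comAlgType rat) (phi : {lrmorphism K -> K'}),
    P K' phi <-> (forall c, J c -> phi c = 0).

(** * Transport of Zariski closures along a correspondence *)

Section Correspondence.
Variables (G1 G2 : groupFunctor) (C : forall K : comAlgType rat, G1 K -> G2 K -> Prop).

(** The graph of a morphism to [G2] from a closed subgroup of [G1]. Only [corr_fun] and [corr_dom]
    distinguish the two sides; an isomorphism of subgroups results from asking the same of the
    converse relation. *)
Record correspondence : Prop := Correspondence {
  corr1 : forall K, C (1%g : G1 K) 1%g;
  corrM : forall K (x y : G1 K) (x' y' : G2 K), C x x' -> C y y' -> C (x * y)%g (x' * y')%g;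
  corrV : forall K (x : G1 K) (x' : G2 K), C x x' -> C x^-1%g x'^-1%g;
  corr_map : forall (K K' : comAlgType rat) (phi : {lrmorphism K -> K'}) (x : G1 K) (x' : G2 K),
    C x x' -> C (gf_map phi x) (gf_map phi x');
  corr_fun : forall K (x : G1 K) (x' y' : G2 K), C x x' -> C x y' -> x' = y';
  corr_dom : forall K (x : G1 K),
    closed_condition (fun K' (phi : {lrmorphism K -> K'}) => exists x', C (gf_map phi x) x') }.

Hypothesis CP : correspondence.
Variables (Gamma : groupType) (rho1 : {multiplicative Gamma -> G1 rat^o}).
Variable rho2 : {multiplicative Gamma -> G2 rat^o}.
Hypothesis C_rho : forall g, C (rho1 g) (rho2 g).

Section Pullback.
Variable S : subgroupFunctor G2.

Definition pullback_mem (K : comAlgType rat) (x : G1 K) : Prop := exists2 x', C x x' & S K x'.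

Fact pullback_group K : group_closed (fun x : G1 K => `[< pullback_mem x >]).
Proof.
have [S1 SB] := sgf_group S K.
split; first by apply/asboolP; exists 1%g; [exact: corr1 | exact/asboolP].
move=> x y /asboolP[x' xx' Sx] /asboolP[y' yy' Sy]; apply/asboolP.
exists (x' * y'^-1)%g; first exact/(corrM CP)/corrV.
by apply/asboolP/SB; exact/asboolP.
Qed.
Fact pullback_stable (K K' : comAlgType rat) (phi : {lrmorphism K -> K'}) (x : G1 K) :
  pullback_mem x -> pullback_mem (gf_map phi x).
Proof.
by move=> [x' xx' Sx]; exists (gf_map phi x'); [exact: corr_map | exact: sgf_stable].
Qed.
Definition pullback : subgroupFunctor G1 := SubgroupFunctor pullback_group pullback_stable.

(* Over the quotient by the equations of the domain, x acquires a partner x', and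
   the equations of S at x' lift to equations at x. *)
Lemma pullback_closed : closed_subgroup S -> closed_subgroup pullback.
Proof.
move=> Scl K x; have [J JP] := corr_dom CP x.
(* If the equations [J] have no solution in any algebra, the domain is empty over [K] and [J]
   already describes the pullback. *)
have [[K0 [phi0 phi0J]]|noK] :=
    pselect (exists (K0 : comAlgType rat) (phi0 : {lrmorphism K -> K0}),
      forall c, J c -> phi0 c = 0); last first.
  exists J => K' phi; split=> [[x' xx' _]|H]; first by apply/JP; exists x'.
  by case: noK; exists K', phi.
have [Q [p [p_surj pJ p_univ]]] := universal_quotient phi0J.
have [x' xx'] : exists x', C (gf_map p x) x' by exact/JP.
have [J' J'P] := Scl Q x'.
exists (fun c => J c \/ J' (p c)) => K' phi.
have fact (psi : {lrmorphism Q -> K'}) : C (gf_map (psi \o p) x) (gf_map psi x').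
  by rewrite gf_map_comp; exact: corr_map.
split=> [[y' xy' Sy] c [Jc|J'c]|H].
- by have /JP : exists z, C (gf_map phi x) z; [exists y' | apply].
- have [psi ephi] : exists psi : {lrmorphism Q -> K'}, phi = psi \o p :> {lrmorphism K -> K'}.
    by apply: p_univ; apply/JP; exists y'.
  subst phi; have /J'P : S K' (gf_map psi x') by rewrite (corr_fun CP (fact psi) xy').
  exact.
- have [psi ephi] : exists psi : {lrmorphism Q -> K'}, phi = psi \o p :> {lrmorphism K -> K'}.
    by apply: p_univ => c Jc; apply: H; left.
  subst phi; exists (gf_map psi x') => //; apply/J'P => c J'c.
  by have [d ec] := p_surj c; rewrite ec; apply: H; right; rewrite -ec.
Qed.
End Pullback.

(** Each closed [S] containing the image of [rho2] has a closed pullback containing the image of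
    [rho1], which supplies a partner of [x] in [S]; by uniqueness of partners it is the same one for
    all [S]. *)
Lemma zariski_corr (K : comAlgType rat) (x : G1 K) :
  zariski_mem rho1 x -> exists2 x', C x x' & zariski_mem rho2 x'.
Proof.
move=> xZ.
have H S : closed_subgroup S -> (forall g, S rat^o (rho2 g)) -> pullback_mem S x.
  move=> Scl Srho; apply: (xZ (pullback S)); first exact: pullback_closed.
  by move=> g; exists (rho2 g).
(* The whole of [G2], closed by the empty set of equations, provides the partner before any [S] is
   given. *)
pose top := @SubgroupFunctor G2 (fun _ _ => True)
  (fun K => conj (asboolT I) (fun x y _ _ => asboolT I)) (fun _ _ _ _ _ => I).
have [|//|x' xx' _] := H top.
  by move=> K1 y; exists (fun=> False).
exists x' => // S Scl Srho; have [y' xy' Sy] := H S Scl Srho.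
by rewrite (corr_fun CP xx' xy').
Qed.

End Correspondence.

Lemma zariski_closure_iso (G1 G2 : groupFunctor)
    (C : forall K : comAlgType rat, G1 K -> G2 K -> Prop) (Gamma : groupType)
    (rho1 : {multiplicative Gamma -> G1 rat^o}) (rho2 : {multiplicative Gamma -> G2 rat^o}) :
  correspondence C -> correspondence (fun K x y => C K y x) ->
  (forall g, C _ (rho1 g) (rho2 g)) ->
  exists F : groupFunctorIso (zariski_closure rho1) (zariski_closure rho2),
    forall g, F rat^o (to_zariski rho1 g) = to_zariski rho2 g.
Proof.
move=> CP CP' Crho.
pose Z1 := zariski_closure rho1; pose Z2 := zariski_closure rho2.
have ex K (x : Z1 K) : exists y : Z2 K, C K (val x) (val y).
  have /asboolP/(zariski_corr CP Crho)[y xy yZ] := valP x.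
  by exists (exist _ y (asboolT yZ)).
have ex' K (y : Z2 K) : exists x : Z1 K, C K (val x) (val y).
  have /asboolP/(zariski_corr CP' Crho)[x xy xZ] := valP y.
  by exists (exist _ x (asboolT xZ)).
pose F K x := projT1 (cid (ex K x)); pose F' K y := projT1 (cid (ex' K y)).
have FP K x : C K (val x) (val (F K x)) by rewrite /F; case: (cid _).
have F'P K y : C K (val (F' K y)) (val y) by rewrite /F'; case: (cid _).
have FE K x (y : Z2 K) : C K (val x) (val y) -> F K x = y.
  by move=> xy; apply/val_inj/(corr_fun CP (FP K x) xy).
have FM K : {morph F K : x y / (x * y)%g}.
  by move=> x y; apply: FE; exact: (corrM CP).
pose Fm K : {multiplicative Z1 K -> Z2 K} :=
  HB.pack (F K) (isMultiplicative.Build (Z1 K) (Z2 K) (F K) (@FM K)).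
have Fbij K : bijective (Fm K).
  exists (F' K) => [x|y]; last exact: FE.
  apply: val_inj; exact: (@corr_fun _ _ _ CP' K (val (F K x)) _ _ (F'P K (F K x)) (FP K x)).
have Fnat (K K' : comAlgType rat) (phi : {lrmorphism K -> K'}) (x : Z1 K) :
    Fm K' (gf_map phi x) = gf_map phi (Fm K x).
  by apply: FE; exact: (corr_map CP phi (FP K x)).
by exists (GroupFunctorIso Fbij Fnat) => g; exact: (FE _ (to_zariski rho1 g) (to_zariski rho2 g) (Crho g)).
Qed.

(** * Extension of functionals and vanishing in tensor products *)

Section LinearExtension.
Variables (F : fieldType) (V : lmodType F).

(** A linear functional on a subspace. The relational form lets a chain be bounded by its union, and
    lets values be prescribed on vectors given through non-unique expressions. *)
Definition functional_graph (G : set (V * F)) : Prop :=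
  [/\ G (0, 0), forall a u v, G u -> G v -> G (a *: u.1 + v.1, a * u.2 + v.2)
    & forall c, G (0, c) -> c = 0].

(** The functional is extended by the value 0 at [v]. It stays single-valued, since a pair
    [(- a *: v, c)] in [G] with [a] nonzero would already give [v] a value. *)
Lemma functional_graph_adjoin (G : set (V * F)) (v : V) :
  functional_graph G -> (forall c, ~ G (v, c)) ->
  functional_graph [set p | exists a : F, G (p.1 - a *: v, p.2)]%classic.
Proof.
move=> [G0 GD Gu] Gv; split; first by exists 0; rewrite scale0r subr0.
  move=> a p q [b bp] [c cq]; exists (a * b + c).
  have := GD a _ _ bp cq; congr G; congr pair => /=.
  by rewrite scalerBr scalerDl scalerA opprD addrACA.
move=> c [a]; rewrite /= sub0r.
have [->|a0] := eqVneq a 0; first by rewrite scale0r oppr0; exact: Gu.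
move=> ac; case: (Gv (- a^-1 * c + 0)).
have := GD (- a^-1) _ _ ac G0; congr G; congr pair => /=.
by rewrite addr0 scalerN scaleNr opprK scalerA mulVf // scale1r.
Qed.

(** By Zorn's lemma there is a maximal graph above [G]; it is defined everywhere, for at a vector
    without a value [functional_graph_adjoin] would enlarge it. *)
Lemma functional_extension (G : set (V * F)) : functional_graph G ->
  exists f : {scalar V}, forall v c, G (v, c) -> f v = c.
Proof.
move=> GG.
pose P (H : set (V * F)) := functional_graph H /\ (G `<=` H)%classic.
(* the union of the empty chain is empty, hence the harmless union with G *)
have [H [[HG GH] Hmax]] : exists H, P (G `|` H)%classic /\
    forall H', (H `<` H')%classic -> ~ P (G `|` H')%classic.
  apply: (Zorn_bigcup (P := [set H | P (G `|` H)%classic])) => C CP Ctot.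
  split; last by move=> p Gp; left.
  (* Two points of the union lie in a single member of the chain joined with [G], or in [G];
     linearity and uniqueness are checked there. *)
  have both p q : (G `|` \bigcup_(X in C) X)%classic p ->
      (G `|` \bigcup_(X in C) X)%classic q ->
      exists H, [/\ functional_graph H, H p, H q &
        (H `<=` G `|` \bigcup_(X in C) X)%classic].
    have S X : C X -> (G `|` X `<=` G `|` \bigcup_(X in C) X)%classic.
      by move=> CX r [Gr|Xr]; [left|right; exists X].
    move=> [Gp|[X CX Xp]] [Gq|[Y CY Yq]].
    - by exists G; split=> // r Gr; left.
    - by exists (G `|` Y)%classic; split; [case: (CP _ CY)|left|right|exact: S].
    - by exists (G `|` X)%classic; split; [case: (CP _ CX)|right|left|exact: S].
    - have [XY|YX] := Ctot _ _ CX CY.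
      + by exists (G `|` Y)%classic; split; [case: (CP _ CY)|right; exact: XY|right|exact: S].
      + by exists (G `|` X)%classic; split; [case: (CP _ CX)|right|right; exact: YX|exact: S].
  split; first by left; case: GG.
    by move=> a u v up vp; have [H [[_ HD _] Hu Hv HS]] := both _ _ up vp; exact/HS/HD.
  by move=> c cp; have [H [[_ _ Hc] H1 _ _]] := both _ _ cp cp; exact: Hc.
have tot v : exists c, (G `|` H)%classic (v, c).
  apply: contrapT => /forallNP nv.
  pose H' := [set p : V * F | exists a : F, (G `|` H)%classic (p.1 - a *: v, p.2)]%classic.
  have H'G : functional_graph H' := functional_graph_adjoin HG nv.
  have HH' : (G `|` H `<=` H')%classic.
    by move=> [u c] uc; exists 0; rewrite scale0r subr0.
  have eH : (G `|` H')%classic = H' by apply/setUidPr => p /GH/HH'.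
  apply: (Hmax H'); last by rewrite eH; split=> // p /GH/HH'.
  split; first by move=> p Hp; apply: HH'; right.
  move=> /(_ (v, 0)) Hv; apply: (nv 0); right; apply: Hv.
  by exists 1; rewrite scale1r subrr; case: HG.
case: HG => H0 HD Hu.
have uniq v c d : (G `|` H)%classic (v, c) -> (G `|` H)%classic (v, d) -> c = d.
  move=> vc vd; apply/eqP; rewrite -subr_eq0; apply/eqP/Hu.
  have := HD (-1) _ _ vd vc; rewrite /= scaleN1r addNr mulN1r addrC.
  exact.
pose f v := projT1 (cid (tot v)).
have fP v : (G `|` H)%classic (v, f v) by rewrite /f; case: (cid _).
have fL : scalar f by move=> a u v; exact: uniq (fP _) (HD a (u, f u) (v, f v) (fP u) (fP v)).
pose fl : {scalar V} := HB.pack f (GRing.isLinear.Build F V F^o _ f fL).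
by exists fl => v c vc; apply: uniq (fP v) _; left.
Qed.

Lemma functional_separates (v : V) : v != 0 -> exists f : {scalar V}, f v = 1.
Proof.
move=> v0; pose G := [set p : V * F | p.1 = p.2 *: v]%classic.
have [|f fG] := @functional_extension G; last by exists f; apply: fG; rewrite /G /= scale1r.
split; rewrite /G /=; first by rewrite scale0r.
  by move=> a [u c] [w d] /= -> ->; rewrite scalerA scalerDl.
by move=> c /esym/eqP; rewrite scaler_eq0 (negPf v0) orbF => /eqP.
Qed.

End LinearExtension.

(** * Equations for the vanishing of a tensor *)

Section TensorVanishing.
Variables (V : lmodType rat) (K : comAlgType rat).

Lemma pure0r (K' : comAlgType rat) (v : V) : pure v (0 : K') = 0.
Proof. by apply: (addrI (pure v 0)); rewrite -pureDr !addr0. Qed.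

(** Gram-Schmidt on the vectors of a finite expression of [z]: a new vector [w] is replaced by its
    residue [w'], on which the previous [l i] vanish, the rest being absorbed into the coefficients.
    A nonzero residue gets a functional, corrected so as to vanish on the previous [v i]. *)
Lemma tens_dual_basis (z : tens V K) :
  exists (N : nat) (v : nat -> V) (c : nat -> K) (l : nat -> {scalar V}),
    z = \sum_(i < N) pure (v i) (c i) /\
    forall i j, (i < N)%N -> (j < N)%N -> l i (v j) = (i == j)%:R.
Proof.
elim/tens_pi_ind: z => s; rewrite tens_pi_sum.
elim: s => [|[w d] s [N [v [c [l [es lv]]]]]].
  exists 0%N, (fun=> 0), (fun=> 0), (fun=> (\0)%R : {scalar V}).
  by rewrite big_nil big_ord0.
rewrite big_cons es /= {es}.
pose w' := w - \sum_(i < N) l i w *: v i.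
pose c' i := c i + l i w *: d.
have ez : pure w d + \sum_(i < N) pure (v i) (c i) =
          pure w' d + \sum_(i < N) pure (v i) (c' i).
  rewrite -[w in LHS](subrK (\sum_(i < N) l i w *: v i)) -/w' pureDl -addrA.
  congr (_ + _).
  have -> : pure (\sum_(i < N) l i w *: v i) d = \sum_(i < N) pure (v i) (l i w *: d).
    elim/big_rec2: _ => [|i y x _ <-]; first exact: pure0.
    by rewrite pureDl pureZ.
  by rewrite -big_split /=; apply: eq_bigr => i _; rewrite -pureDr addrC.
have lw' i : (i < N)%N -> l i w' = 0.
  move=> iN; rewrite linearB linear_sum (bigD1 (Ordinal iN)) //= big1 => [|j ji].
    by rewrite linearZ /= lv // eqxx mulr1 addr0 subrr.
  by rewrite linearZ /= lv // eq_sym -[_ == i]/(j == Ordinal iN) (negPf ji) mulr0.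
rewrite ez; have [w0|w0] := eqVneq w' 0.
  exists N, v, c', l; split=> //.
  by rewrite w0 pure0 add0r.
have [f fw] := functional_separates w0.
pose f1 x := f x - \sum_(i < N) f (v i) * l i x.
have f1L : scalar f1.
  move=> a x y; rewrite /f1 linearP mulrBr mulr_sumr addrACA -opprD -big_split /=.
  by congr (_ - _); apply: eq_bigr => i _; rewrite linearP mulrDr mulrCA.
pose f' : {scalar V} := HB.pack f1 (GRing.isLinear.Build rat V rat^o _ f1 f1L).
exists N.+1, (fun i => if i is i'.+1 then v i' else w').
exists (fun i => if i is i'.+1 then c' i' else d).
exists (fun i => if i is i'.+1 then l i' else f').
split; first by rewrite big_ord_recl.
move=> [|i] [|j] // iN jN; [| |exact: lw'|exact: lv].
  rewrite -[LHS]/(f1 w') /f1 fw big1 ?subr0 // => i _.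
  by rewrite lw' ?mulr0.
rewrite -[LHS]/(f1 (v j)) /f1; have {}jN : (j < N)%N by [].
rewrite (bigD1 (Ordinal jN)) //= lv // eqxx mulr1 big1 ?addr0 ?subrr //.
by move=> i ij; rewrite lv // -[_ == _ :> nat]/(i == Ordinal jN) (negPf ij) mulr0.
Qed.

(** The equations are the coefficients [c i] of a biorthogonal expression: applying [l i] to the
    first factor of the image of [z] extracts [phi (c i)]. *)
Lemma tens_vanishing (z : tens V K) :
  closed_condition (fun K' (phi : {lrmorphism K -> K'}) => tens_map idfun phi z = 0).
Proof.
have [N [v [c [l [-> lv]]]]] := tens_dual_basis z.
exists (fun d => exists2 i, (i < N)%N & d = c i) => K' phi.
have -> : tens_map idfun phi (\sum_(i < N) pure (v i) (c i)) =
    \sum_(i < N) pure (v i) (phi (c i)).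
  elim/big_rec2: _ => [|i y x _ <-]; first exact: tens_map0.
  by rewrite tens_mapD tens_map_pure.
split=> [z0 _ [i iN ->]|phi0]; last first.
  by rewrite big1 // => i _; rewrite phi0 ?pure0r //; exists i.
pose b (u : V) (d : K') := l i u *: d.
have bb : balanced b.
  by split=> [d x y|x d e|a x d]; rewrite /b ?linearD ?scalerDl ?scalerDr // linearZ /= scalerA mulrC.
have := congr1 (tens_lift b) z0; rewrite (tens_lift0 bb) => <-.
transitivity (\sum_(j < N) b (v j) (phi (c j))).
  rewrite (bigD1 (Ordinal iN)) //= big1 => [|j ji].
    by rewrite /b lv // eqxx scale1r addr0.
  by rewrite /b lv // eq_sym -[_ == i]/(j == Ordinal iN) (negPf ji) scale0r.
elim/big_rec2: _ => [|j y x _ ->]; first by rewrite (tens_lift0 bb).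
by rewrite (tens_liftD bb) (tens_lift_pure bb).
Qed.
End TensorVanishing.

Lemma closed_condition_all (K : comAlgType rat) (I : Type)
    (P : I -> forall K' : comAlgType rat, {lrmorphism K -> K'} -> Prop) :
  (forall i, closed_condition (P i)) -> closed_condition (fun K' phi => forall i, P i K' phi).
Proof.
move=> Pcl; pose J i := projT1 (cid (Pcl i)).
have JP i : forall K' phi, P i K' phi <-> (forall c, J i c -> phi c = 0).
  by rewrite /J; case: (cid _).
exists (fun c => exists i, J i c) => K' phi; split=> [H c [i Jc]|H i].
  exact: (JP i K' phi).1 (H i) c Jc.
by apply/JP => c Jc; apply: H; exists i.
Qed.

Lemma closed_condition_iff (K : comAlgType rat)
    (P Q : forall K' : comAlgType rat, {lrmorphism K -> K'} -> Prop) :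
  (forall K' phi, P K' phi <-> Q K' phi) -> closed_condition Q -> closed_condition P.
Proof. by move=> PQ [J JP]; exists J => K' phi; rewrite PQ. Qed.

(** * Completed scalar extensions *)

Section LowerCentralSeries.
Variables (R : comNzRingType) (L : lieAlgType R).
Implicit Types x y : L.

Lemma lcs_lier1 m x y : lcs m y -> lcs m.+1 (lie x y).
Proof.
by move=> ym; exists [:: (x, y)]; split=> [p|]; rewrite ?big_seq1 // inE => /eqP->.
Qed.

Lemma lcs_liel1 m x y : lcs m x -> lcs m.+1 (lie x y).
Proof. by move=> xm; rewrite lieC; apply/lcsN/lcs_lier1. Qed.

Lemma lcs_lieq m k (v : lieq L m) : lcs k v -> exists2 x, lcs k x & v = lieq_pi m x.
Proof.
elim: k v => [|k IH] v; first by elim/lieq_ind: v => x _; exists x.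
case=> s [sk ->] {v}; elim: s sk => [|[a b] s IHs] sk.
  by exists 0; [exact: lcs0 | rewrite big_nil linear0].
have [|x xk ex] := IHs; first by move=> p ps; apply: sk; rewrite inE ps orbT.
have /IH[y yk ey] : lcs k b by apply: (sk (a, b)); rewrite inE eqxx.
elim/lieq_ind: a {sk} => a; exists (lie a y + x); first exact/lcsD/xk/lcs_lier1.
by rewrite big_cons /= ex ey lieq_piD lieq_piL.
Qed.
End LowerCentralSeries.

Lemma lcs_tens (L : lieAlgType rat) (K : comAlgType rat) k (z : tens L K) :
  lcs k z -> exists s : seq (L * K),
    (forall p, p \in s -> lcs k p.1) /\ z = \sum_(p <- s) pure p.1 p.2.
Proof.
elim: k z => [|k IH] z.
  by exists (tens_repr z); split=> //; rewrite -tens_pi_sum tens_reprK.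
case=> s [sk ->] {z}; elim: s sk => [|[x y] s IHs] sk.
  by exists [::]; rewrite !big_nil.
have [|t [tk et]] := IHs; first by move=> p ps; apply: sk; rewrite inE ps orbT.
have /IH[u [uk ->]] : lcs k y by apply: (sk (x, y)); rewrite inE eqxx.
rewrite big_cons et /= {sk et}.
have [r [rk ->]] : exists r : seq (L * K), (forall p, p \in r -> lcs k.+1 p.1) /\
    lie x (\sum_(p <- u) pure p.1 p.2) = \sum_(p <- r) pure p.1 p.2.
  elim/tens_ind: x => [v c|x x' [r [rk er]] [r' [rk' er']]].
    exists [seq (lie v p.1, c * p.2) | p <- u]; split.
      by move=> _ /mapP[p /uk pk ->]; exact: lcs_lier1.
    rewrite big_map; elim: (u) => [|p u' IHu]; first by rewrite !big_nil lie0r.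
    by rewrite !big_cons lieDr IHu lie_pure.
  exists (r ++ r'); split; last by rewrite big_cat lieDl er er'.
  by move=> p; rewrite mem_cat => /orP[/rk|/rk'].
exists (r ++ t); split; last by rewrite big_cat.
by move=> p; rewrite mem_cat => /orP[/rk|/tk].
Qed.

Section ExtHom.
Variables (L M : lieAlgType rat) (K : comAlgType rat).
Implicit Types f g : ext L K -> ext M K.

Definition ext_hom f : Prop :=
  [/\ linear f, {morph f : x y / lie x y}
    & forall m, exists p, forall x : ext L K, x p = 0 -> f x m = 0].

Section Linear.
Variable f : ext L K -> ext M K.
Hypothesis fL : linear f.
Lemma ext_linD : {morph f : x y / x + y}.
Proof. by move=> x y; have := fL 1 x y; rewrite !scale1r. Qed.
Lemma ext_lin0 : f 0 = 0.
Proof. by apply: (addrI (f 0)); rewrite -ext_linD !addr0. Qed.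
Lemma ext_linZ a : {morph f : x / a *: x}.
Proof. by move=> x; have := fL a x 0; rewrite ext_lin0 !addr0. Qed.
Lemma ext_linB : {morph f : x y / x - y}.
Proof. by move=> x y; rewrite -scaleN1r ext_linD ext_linZ scaleN1r. Qed.
Lemma ext_lin_sum (T : Type) (s : seq T) (F : T -> ext L K) :
  f (\sum_(i <- s) F i) = \sum_(i <- s) f (F i).
Proof. exact: (big_morph f ext_linD ext_lin0). Qed.
End Linear.

Lemma ext_at_sum (T : Type) (s : seq T) (F : T -> ext L K) m :
  (\sum_(i <- s) F i) m = \sum_(i <- s) F i m.
Proof. by elim/big_rec2: _ => // i y1 y2 _ <-. Qed.

(** Density of the K-span of [L] in the completion; through it a continuous linear map is determined
    by its values on [L]. *)
Lemma ext_approx (x : ext L K) p : exists s : seq (L * K),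
  (x - \sum_(i <- s) i.2 *: ext_of K i.1) p = 0.
Proof.
exists [seq (lieq_repr i.1, i.2) | i <- tens_repr (x p)].
rewrite ext_atB big_map ext_at_sum -{1}[x p]tens_reprK tens_pi_sum.
apply/eqP; rewrite subr_eq0; apply/eqP; apply: eq_bigr => i _.
by rewrite ext_atZ scale_pure mulr1 /= lieq_reprK.
Qed.

Lemma ext_hom_eq f g : ext_hom f -> ext_hom g ->
  (forall x, f (ext_of K x) = g (ext_of K x)) -> f =1 g.
Proof.
move=> [fL _ fC] [gL _ gC] fg x; apply: extP => m.
have [[p fp] [q gq]] := (fC m, gC m).
have [s xs] := ext_approx x (maxn p q).
have := fp _ (ext_at_le0 (leq_maxl _ _) xs); have := gq _ (ext_at_le0 (leq_maxr _ _) xs).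
rewrite (ext_linB fL) (ext_linB gL) !ext_atB => /eqP; rewrite subr_eq0 => /eqP ->.
move=> /eqP; rewrite subr_eq0 => /eqP ->.
rewrite (ext_lin_sum fL) (ext_lin_sum gL); congr (ext_at _ m).
by apply: eq_bigr => i _; rewrite (ext_linZ fL) (ext_linZ gL) fg.
Qed.

(** Since [f] preserves brackets, level [m] of the image lies in the term [lcs m] of
    [tens (lieq M m) K], and that term vanishes. *)
Lemma ext_hom_lcs f m x : ext_hom f -> lcs m x -> f (ext_of K x) m = 0.
Proof.
move=> [fL fB _] xm.
have H k y : lcs k y -> lcs k (f (ext_of K y) m).
  elim: k y => [//|k IH] y [s [sk ->]].
  elim: s sk => [|[a b] s IHs] sk.
    rewrite big_nil; have -> : ext_of K (0 : L) = 0 by apply: extP => i /=; rewrite linear0 pure0.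
    by rewrite ext_lin0 // ext_at0; exact: lcs0.
  rewrite big_cons ext_ofD ext_linD // ext_atD; apply: lcsD; last first.
    by apply: IHs => p ps; apply: sk; rewrite inE ps orbT.
  rewrite /= ext_of_lie fB ext_at_lie; apply/lcs_lier1/IH.
  by apply: (sk (a, b)); rewrite inE eqxx.
have /lcs_tens[s [sm ->]] := H _ _ xm; rewrite big_seq big1 // => -[v c] /sm /= /lcs_lieq[y ym ->].
by have -> : lieq_pi m y = lieq_pi m 0; [apply/lieq_eqP; rewrite subr0 | rewrite linear0 pure0].
Qed.

Lemma ext_induced_hom (u : L -> M) (uL : linear u) (uB : {morph u : x y / lie x y}) :
  ext_hom (@ext_induced L M K u uL uB).
Proof.
split; [exact: ext_induced_linear | exact: ext_induced_lie |].
by move=> m; exists m => x; exact: ext_induced_at0.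
Qed.
End ExtHom.

Lemma ext_hom_comp (L M N : lieAlgType rat) (K : comAlgType rat)
    (f : ext M K -> ext N K) (g : ext L K -> ext M K) :
  ext_hom f -> ext_hom g -> ext_hom (f \o g).
Proof.
move=> [fL fB fC] [gL gB gC]; split=> [a x y|x y|m] /=.
- by rewrite gL fL.
- by rewrite gB fB.
- by have [p fp] := fC m; have [q gq] := gC p; exists q => x /gq/fp.
Qed.

Section ExtMap.
Variables (K K' : comAlgType rat) (phi : {lrmorphism K -> K'}) (L M : lieAlgType rat).

Lemma ext_mapD : {morph @ext_map L K K' phi : x y / x + y}.
Proof. by move=> x y; apply: extP => m /=; rewrite tens_mapD. Qed.
Lemma ext_map0 : @ext_map L K K' phi 0 = 0.
Proof. by apply: extP => m /=; rewrite tens_map0. Qed.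
Lemma ext_mapZ a (x : ext L K) : ext_map phi (a *: x) = phi a *: ext_map phi x.
Proof. by apply: extP => m /=; rewrite tens_mapZ. Qed.
Lemma ext_map_lie : {morph @ext_map L K K' phi : x y / lie x y}.
Proof. by move=> x y; apply: extP => m; rewrite ext_at_lie /= -tens_map_lie. Qed.
Lemma ext_map_induced (u : L -> M) (uL : linear u) (uB : {morph u : x y / lie x y}) x :
  ext_map phi (ext_induced uL uB x) = ext_induced uL uB (ext_map phi x).
Proof.
apply: extP => m /=; elim/tens_ind: (x m) => [v c|y z e e'].
  by rewrite !tens_map_pure.
by rewrite !tens_mapD e e'.
Qed.
End ExtMap.

Section Extend.
Variables (L M : lieAlgType rat) (K : comAlgType rat) (F : L -> ext M K).
Hypothesis FD : {morph F : x y / x + y}.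
Hypothesis FZ : forall a x, F (a *: x) = a%:A *: F x.
Hypothesis FB : {morph F : x y / lie x y}.
Hypothesis F_lcs : forall m x, lcs m x -> F x m = 0.

Let F_eq m x y : lcs m (x - y) -> F x m = F y m.
Proof. by move=> /F_lcs xy; rewrite -[x](subrK y) FD ext_atD xy add0r. Qed.

Let b m (v : lieq L m) (c : K) : tens (lieq M m) K := c *: F (lieq_repr v) m.
Let bE m x c : b (lieq_pi m x) c = c *: F x m.
Proof. by congr (_ *: _); exact/F_eq/lcs_repr. Qed.

Let b_bal m : balanced (@b m).
Proof.
split=> [c v w|v c d|a v c].
- elim/lieq_ind: v => v; elim/lieq_ind: w => w.
  by rewrite -lieq_piD !bE FD ext_atD scalerDr.
- exact: scalerDl.
- elim/lieq_ind: v => v; rewrite -lieq_piZ !bE FZ ext_atZ scalerA.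
  by rewrite -scalerAr mulr1.
Qed.
Let bD m : {morph tens_lift (@b m) : x y / x + y}. Proof. exact: tens_liftD. Qed.
Let bP m v c : tens_lift (@b m) (pure v c) = b v c. Proof. exact: tens_lift_pure. Qed.

Fact ext_extend_subproof (x : ext L K) m :
  tens_map (lieq_proj m) idfun (tens_lift (@b m.+1) (x m.+1)) = tens_lift (@b m) (x m).
Proof.
rewrite -[x m]ext_compat; elim/tens_ind: (x m.+1) => [v c|y z e e'].
  elim/lieq_ind: v => v; rewrite tens_map_pure /= lieq_projE !bP !bE tens_mapZ /=.
  by rewrite ext_compat.
by rewrite bD !tens_mapD bD e e'.
Qed.
(** The K-linear continuous extension of [F]: at each level a pure tensor of [v] and [c] goes to
    [c *: F v], which depends only on the class of [v] by [F_lcs]. *)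
Definition ext_extend (x : ext L K) : ext M K := Ext (ext_extend_subproof x).

Lemma ext_extend_of x : ext_extend (ext_of K x) = F x.
Proof. by apply: extP => m /=; rewrite bP bE scale1r. Qed.

Lemma ext_extend_hom : ext_hom ext_extend.
Proof.
have bZ m a x : tens_lift (@b m) (a *: x) = a *: tens_lift (@b m) x.
  elim/tens_ind: x => [v c|y z e e']; last by rewrite scalerDr !bD scalerDr e e'.
  by rewrite scale_pure !bP /b scalerA.
split=> [a x y|x y|m].
- by apply: extP => m; rewrite ext_atD ext_atZ /= bD bZ.
- apply: extP => m; rewrite ext_at_lie /=.
  elim/tens_ind: (x m) => [v c|z z' e e']; last by rewrite lieDl !bD lieDl e e'.
  elim/tens_ind: (y m) => [w d|z z' e e']; last by rewrite lieDr !bD lieDr e e'.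
  elim/lieq_ind: v => v; elim/lieq_ind: w => w.
  by rewrite lie_pure -lieq_piL !bP !bE FB ext_at_lie lieZl lieZr scalerA.
- by exists m => x /= ->; exact: (tens_lift0 (@b_bal m)).
Qed.
End Extend.

(** Bracket words are kept as syntax so that one word can be evaluated in several Lie algebras and
    over several base rings. Its coefficients are rational; the map [s] of [lie_eval] carries them
    to the base ring. *)
Inductive lie_term (T : Type) : Type :=
  | LieVar of T | LieZero | LieAdd of lie_term T & lie_term T
  | LieScale of rat & lie_term T | LieBracket of lie_term T & lie_term T.
Arguments LieZero {T}.

Fixpoint lie_eval (T : Type) (R : comNzRingType) (s : rat -> R) (L : lieAlgType R) (v : T -> L)
    (w : lie_term T) : L :=
  match w with
  | LieVar t => v t
  | LieZero => 0
  | LieAdd w1 w2 => lie_eval s v w1 + lie_eval s v w2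
  | LieScale a w1 => s a *: lie_eval s v w1
  | LieBracket w1 w2 => lie (lie_eval s v w1) (lie_eval s v w2)
  end.

Lemma ext_of0 (L : lieAlgType rat) (K : comAlgType rat) : ext_of K (0 : L) = 0.
Proof. by apply: extP => m /=; rewrite linear0 pure0. Qed.

Lemma lie_eval_hom (T : Type) (L M : lieAlgType rat) (K : comAlgType rat)
    (f : ext L K -> ext M K) (v : T -> L) (w : lie_term T) : ext_hom f ->
  f (ext_of K (lie_eval id v w)) = lie_eval (in_alg K) (fun t => f (ext_of K (v t))) w.
Proof.
move=> [fL fB _]; elim: w => //= [|w <- w' <-|a w <-|w <- w' <-].
- by rewrite ext_of0 ext_lin0.
- by rewrite ext_ofD ext_linD.
- by rewrite ext_ofZ ext_linZ.
- by rewrite ext_of_lie fB.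
Qed.

Lemma lie_eval_map (T : Type) (L : lieAlgType rat) (K K' : comAlgType rat)
    (phi : {lrmorphism K -> K'}) (v : T -> ext L K) w :
  ext_map phi (lie_eval (in_alg K) v w) = lie_eval (in_alg K') (fun t => ext_map phi (v t)) w.
Proof.
elim: w => //= [|w <- w' <-|a w <-|w <- w' <-].
- exact: ext_map0.
- exact: ext_mapD.
- by rewrite ext_mapZ rmorph_alg.
- exact: ext_map_lie.
Qed.

Section Generation.
Variables (T : Type) (L : lieAlgType rat) (v : T -> L).

(** Generation modulo [L, L] suffices. The remainder is a sum of brackets [a, b]; replacing [a] and
    [b] by words modulo [lcs m] changes each bracket by an element of [lcs m.+1]. *)
Lemma lie_generation : (forall x, exists w, lcs 1 (x - lie_eval id v w)) ->
  forall m x, exists w, lcs m (x - lie_eval id v w).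
Proof.
move=> gen1; elim=> [|m IH] x; first by exists LieZero.
have [w [s [_ es]]] := gen1 x.
have [w' w'm] : exists w', lcs m.+1 (\sum_(p <- s) lie p.1 p.2 - lie_eval id v w').
  elim: (s) => [|[a b] s' [u um]].
    by exists LieZero; rewrite big_nil subr0; exact: lcs0.
  have [[wa wam] [wb wbm]] := (IH a, IH b).
  exists (LieAdd (LieBracket wa wb) u); rewrite big_cons [lie_eval _ _ _]/= opprD addrACA.
  apply: lcsD => //; rewrite -(subrKA (lie (lie_eval id v wa) b)) -lieBl -lieBr.
  by apply: lcsD; [exact: lcs_liel1 | exact: lcs_lier1].
by exists (LieAdd w w'); rewrite [lie_eval _ _ _]/= opprD addrA es.
Qed.
End Generation.

(** * Automorphisms intertwined by a family of copies of one Lie algebra in another *)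

Section Intertwining.
Variables (L1 L2 : lieAlgType rat) (I : Type) (iota : I -> L1 -> L2) (r : L2 -> L1) (i0 : I).
Hypothesis iotaL : forall i, linear (iota i).
Hypothesis iotaB : forall i, {morph iota i : x y / lie x y}.
Hypothesis rL : linear r.
Hypothesis rB : {morph r : x y / lie x y}.
Hypothesis rK : cancel (iota i0) r.
Let ev := @lie_eval (I * L1) rat id L2 (fun t => iota t.1 t.2).
Hypothesis gen : forall m x, exists w, lcs m (x - ev w).

Let ind K i : ext L1 K -> ext L2 K := @ext_induced L1 L2 K (iota i) (iotaL i) (@iotaB i).
Let res K : ext L2 K -> ext L1 K := @ext_induced L2 L1 K r rL rB.

Lemma ind_hom K i : ext_hom (@ind K i). Proof. exact: ext_induced_hom. Qed.
Lemma res_hom K : ext_hom (@res K). Proof. exact: ext_induced_hom. Qed.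

Lemma ind_of K i x : ind i (ext_of K x) = ext_of K (iota i x).
Proof. exact: ext_induced_of. Qed.
Lemma res_of K x : res (ext_of K x) = ext_of K (r x).
Proof. exact: ext_induced_of. Qed.

Lemma ext_map_ind (K K' : comAlgType rat) (phi : {lrmorphism K -> K'}) i x :
  ext_map phi (ind i x) = ind i (ext_map phi x).
Proof. exact: ext_map_induced. Qed.
Lemma ext_map_res (K K' : comAlgType rat) (phi : {lrmorphism K -> K'}) x :
  ext_map phi (res x) = res (ext_map phi x).
Proof. exact: ext_map_induced. Qed.

Lemma indK K : cancel (@ind K i0) (@res K).
Proof.
apply: (ext_hom_eq (f := @res K \o @ind K i0) (g := id)) => [||x /=].
- exact/ext_hom_comp/ind_hom/res_hom.
- exact: ext_end_id.
- by rewrite ind_of res_of rK.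
Qed.

Definition intertwined (K : comAlgType rat) (f : ext_aut L1 K) (f' : ext_aut L2 K) :=
  forall i x, (f' : ext_aut L2 K) (ind i x) = ind i ((f : ext_aut L1 K) x).

Lemma ext_aut_hom (L : lieAlgType rat) K (f : ext_aut L K) : ext_hom f.
Proof. by case: (ext_autE f). Qed.

Lemma ext_aut_invE (L : lieAlgType rat) K (f : ext_aut L K) x :
  (f^-1%g : ext_aut L K) (f x) = x.
Proof. exact: bijK. Qed.
Lemma ext_aut_Vinv (L : lieAlgType rat) K (f : ext_aut L K) x :
  f ((f^-1%g : ext_aut L K) x) = x.
Proof. exact: bijKV. Qed.

Lemma intertwinedP K (f : ext_aut L1 K) (f' : ext_aut L2 K) :
  (forall i x, (f' : ext_aut L2 K) (ext_of K (iota i x)) =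
    ind i ((f : ext_aut L1 K) (ext_of K x))) -> intertwined f f'.
Proof.
move=> H i; apply: (ext_hom_eq (f := f' \o ind i) (g := ind i \o f)) => [||x /=].
- exact/ext_hom_comp/ind_hom/ext_aut_hom.
- exact/ext_hom_comp/ext_aut_hom/ind_hom.
- by rewrite ind_of H.
Qed.

Lemma intertwinedV K (f : ext_aut L1 K) (f' : ext_aut L2 K) :
  intertwined f f' -> intertwined f^-1%g f'^-1%g.
Proof.
move=> ff' i x; rewrite -[x in LHS](ext_aut_Vinv f) -ff'.
exact: ext_aut_invE.
Qed.

Lemma intertwinedM K (f g : ext_aut L1 K) (f' g' : ext_aut L2 K) :
  intertwined f f' -> intertwined g g' -> intertwined (f * g)%g (f' * g')%g.
Proof. by move=> ff' gg' i x; rewrite !ext_aut_mulE gg' ff'. Qed.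

Lemma intertwined1 K : intertwined (1%g : ext_aut L1 K) (1%g : ext_aut L2 K).
Proof. by []. Qed.

Lemma intertwined_map (K K' : comAlgType rat) (phi : {lrmorphism K -> K'})
    (f : ext_aut L1 K) (f' : ext_aut L2 K) :
  intertwined f f' -> intertwined (base_change phi f) (base_change phi f').
Proof.
move=> ff'; apply: intertwinedP => i x.
rewrite -!(ext_map_of phi) [LHS]base_changeE [in RHS]base_changeE.
by rewrite -ind_of ff' ext_map_induced.
Qed.

Lemma ext_hom_gen (M : lieAlgType rat) K (f g : ext L2 K -> ext M K) :
  ext_hom f -> ext_hom g ->
  (forall i x, f (ext_of K (iota i x)) = g (ext_of K (iota i x))) -> f =1 g.
Proof.
move=> fH gH fg; apply: (ext_hom_eq fH gH) => x; apply: extP => m.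
have [[fL _ /(_ m)[p fp]] [gL _ /(_ m)[q gq]]] := (fH, gH).
have [w xw] := gen (maxn p q) x.
have zp : ext_of K (x - ev w) (maxn p q) = 0 by exact: ext_of_lcs.
rewrite -[x](subrK (ev w)) ext_ofD (ext_linD fL) (ext_linD gL) !ext_atD.
rewrite (fp _ (ext_at_le0 (leq_maxl _ _) zp)) (gq _ (ext_at_le0 (leq_maxr _ _) zp)).
rewrite !add0r (lie_eval_hom _ _ fH) (lie_eval_hom _ _ gH); congr (ext_at (lie_eval _ _ _) m).
by apply/funext => t; exact: fg.
Qed.

Lemma intertwined_fun K (f : ext_aut L1 K) (f' g' : ext_aut L2 K) :
  intertwined f f' -> intertwined f g' -> f' = g'.
Proof.
move=> ff' fg'; apply: ext_autP => y; apply: (ext_hom_gen (ext_aut_hom f') (ext_aut_hom g')).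
by move=> i x; rewrite -ind_of ff' fg'.
Qed.

Lemma intertwined_inj K (f g : ext_aut L1 K) (f' : ext_aut L2 K) :
  intertwined f f' -> intertwined g f' -> f = g.
Proof.
move=> ff' gf'; apply: ext_autP => x; apply: (can_inj (@indK K)).
by rewrite -ff' -gf'.
Qed.

Section Descent.
Variable K : comAlgType rat.

(** A word whose value lies in [lcs m] is a relation of [L2] modulo [lcs m] between elements of the
    copies; it has to remain one when [f] is applied to its letters. Each pair of [m] and [w] is an
    equation on [f] alone, with no mention of a partner. *)
Definition keeps_relations (f : ext L1 K -> ext L1 K) : Prop := forall m w,
  lcs m (ev w) -> lie_eval (in_alg K) (fun t => ind t.1 (f (ext_of K t.2))) w m = 0.

Lemma intertwined_relations (f : ext_aut L1 K) (f' : ext_aut L2 K) :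
  intertwined f f' -> keeps_relations (f : ext_aut L1 K).
Proof.
move=> ff' m w wm; have <- := ext_hom_lcs (ext_aut_hom f') wm.
rewrite (lie_eval_hom _ _ (ext_aut_hom f')); congr (ext_at (lie_eval _ _ _) m).
by apply/funext => t; rewrite -ind_of ff'.
Qed.

(** At level [m], the image of [x] is computed from any word representing [x] modulo [lcs m], with
    [f] applied to its letters. [keeps_relations] makes the result independent of the word, which
    also gives compatibility of levels, additivity and preservation of brackets. *)
Lemma descend (f : ext L1 K -> ext L1 K) : ext_hom f -> keeps_relations f ->
  exists2 f' : ext L2 K -> ext L2 K, ext_hom f' & forall i x, f' (ind i x) = ind i (f x).
Proof.
move=> fH kf.
pose evf := lie_eval (in_alg K) (fun t : I * L1 => ind t.1 (f (ext_of K t.2))).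
have evf_eq m w w' : lcs m (ev w - ev w') -> evf w m = evf w' m.
  move=> ww'; apply/eqP; rewrite -subr_eq0; apply/eqP.
  have e : ev (LieAdd w (LieScale (-1) w')) = ev w - ev w'.
    by rewrite -[LHS]/(ev w + (-1) *: ev w') scaleN1r.
  have := kf m (LieAdd w (LieScale (-1) w')); rewrite e => /(_ ww').
  by rewrite -[lie_eval _ _ _]/(evf w + (-1)%:A *: evf w') scaleN1r scaleN1r.
pose wd m x := projT1 (cid (gen m x)).
have wdP m x : lcs m (x - ev (wd m x)) by rewrite /wd; case: (cid _).
have evf_wd m x w : lcs m (x - ev w) -> evf (wd m x) m = evf w m.
  move=> xw; apply: evf_eq; have := lcsB xw (wdP m x).
  by rewrite opprB addrC subrKA.
have compat x m : tens_map (lieq_proj m) idfun (evf (wd m.+1 x) m.+1) = evf (wd m x) m.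
  by rewrite ext_compat; apply/esym/evf_wd/lcs_le/wdP.
pose F x := Ext (compat x).
have FE m x w : lcs m (x - ev w) -> F x m = evf w m by exact: evf_wd.
have FD : {morph F : x y / x + y}.
  move=> x y; apply: extP => m; rewrite (FE _ _ (LieAdd (wd m x) (wd m y))) //.
  by rewrite [ev _]/= opprD addrACA; apply: lcsD; exact: wdP.
have FZ a x : F (a *: x) = a%:A *: F x.
  apply: extP => m; rewrite (FE _ _ (LieScale a (wd m x))) //.
  by rewrite [ev _]/= -scalerBr; apply: lcsZ; exact: wdP.
have FB : {morph F : x y / lie x y}.
  move=> x y; apply: extP => m; rewrite (FE _ _ (LieBracket (wd m x) (wd m y))) //.
  rewrite [ev _]/= -(subrKA (lie (ev (wd m x)) y)) -lieBl -lieBr.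
  by apply: lcsD; [exact/lcs_liel/wdP | exact/lcs_lier/wdP].
have F_lcs m x : lcs m x -> F x m = 0.
  by move=> xm; rewrite (FE _ _ LieZero) // [ev _]/= subr0.
exists (ext_extend FD FZ F_lcs); first exact: ext_extend_hom.
move=> i; apply: (ext_hom_eq (f := ext_extend FD FZ F_lcs \o ind i) (g := ind i \o f)) => [||x /=].
- exact/ext_hom_comp/ind_hom/ext_extend_hom.
- exact/ext_hom_comp/fH/ind_hom.
- rewrite ind_of ext_extend_of; apply: extP => m.
  by rewrite (FE _ _ (LieVar (i, x))) // subrr; exact: lcs0.
Qed.

(** [descend] yields an endomorphism only; applied to [f] and to its inverse it yields two, which
    are mutually inverse because they are so on the copies, and these generate. *)
Lemma intertwined_domain (f : ext_aut L1 K) :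
  (exists f', intertwined f f') <->
  keeps_relations (f : ext_aut L1 K) /\ keeps_relations (f^-1%g : ext_aut L1 K).
Proof.
split=> [[f' ff']|[kf kfV]].
  by split; [exact: intertwined_relations ff' | exact: intertwined_relations (intertwinedV ff')].
have [f' fH' ff'] := descend (ext_aut_hom f) kf.
have [g' gH' fg'] := descend (ext_aut_hom f^-1%g) kfV.
have f'K : cancel f' g'.
  apply: (ext_hom_gen (f := g' \o f') (g := id)) => [||i x /=].
  - exact: ext_hom_comp.
  - exact: ext_end_id.
  - by rewrite -ind_of ff' fg' ext_aut_invE.
have g'K : cancel g' f'.
  apply: (ext_hom_gen (f := f' \o g') (g := id)) => [||i x /=].
  - exact: ext_hom_comp.
  - exact: ext_end_id.
  - by rewrite -ind_of fg' ff' ext_aut_Vinv.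
have aut : is_ext_aut (Defs.Bij f'K g'K) by apply/asboolP; split; [exact: fH' | exact: gH'].
by exists (exist _ (Defs.Bij f'K g'K) aut) => i x; exact: ff'.
Qed.

(** The only candidate for a partner of [f'] is read off from the split copy, as
    [res \o f' \o ind i0]; the condition says that it serves all copies, and it is an equation on
    [f'] alone. *)
Definition keeps_copies (f' : ext L2 K -> ext L2 K) : Prop := forall i x,
  f' (ind i (ext_of K x)) = ind i (res (f' (ind i0 (ext_of K x)))).

Lemma intertwined_range (f' : ext_aut L2 K) :
  (exists f, intertwined f f') <->
  keeps_copies (f' : ext_aut L2 K) /\ keeps_copies (f'^-1%g : ext_aut L2 K).
Proof.
have kc (f : ext_aut L1 K) (g : ext_aut L2 K) :
    intertwined f g -> keeps_copies (g : ext_aut L2 K).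
  by move=> fg i x; rewrite !fg indK.
split=> [[f ff']|[kf kfV]].
  by split; [exact: kc ff' | exact: kc (intertwinedV ff')].
have all (g : ext_aut L2 K) : keeps_copies (g : ext_aut L2 K) -> forall i x,
    (g : ext_aut L2 K) (ind i x) = ind i (res ((g : ext_aut L2 K) (ind i0 x))).
  move=> kg i.
  have gi k : ext_hom (g \o @ind K k) by exact/ext_hom_comp/ind_hom/ext_aut_hom.
  have E : (g \o ind i) =1 (ind i \o (@res K \o (g \o ind i0))).
    apply: ext_hom_eq => [//||x]; last exact: kg.
    exact: ext_hom_comp (@ind_hom K i) (ext_hom_comp (@res_hom K) (gi i0)).
  exact: E.
pose f := @res K \o (f' \o @ind K i0); pose g := @res K \o ((f'^-1%g : ext_aut L2 K) \o @ind K i0).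
have fH : ext_hom f.
  exact: ext_hom_comp (@res_hom K) (ext_hom_comp (ext_aut_hom _) (@ind_hom K i0)).
have gH : ext_hom g.
  exact: ext_hom_comp (@res_hom K) (ext_hom_comp (ext_aut_hom _) (@ind_hom K i0)).
have fK : cancel f g by move=> x; rewrite /f /g /= -all // ext_aut_invE indK.
have gK : cancel g f by move=> x; rewrite /f /g /= -all // ext_aut_Vinv indK.
have aut : is_ext_aut (Defs.Bij fK gK) by apply/asboolP; split; [exact: fH | exact: gH].
by exists (exist _ (Defs.Bij fK gK) aut) => i x; exact: all.
Qed.
End Descent.

Lemma closed_condition_and (K : comAlgType rat)
    (P Q : forall K' : comAlgType rat, {lrmorphism K -> K'} -> Prop) :
  closed_condition P -> closed_condition Q ->
  closed_condition (fun K' phi => P K' phi /\ Q K' phi).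
Proof.
move=> Pc Qc; apply: (closed_condition_iff (Q := fun K' phi => forall b : bool,
  (if b then P else Q) K' phi)); last by apply: closed_condition_all => -[].
by move=> K' phi; split=> [[p q] []//|H]; split; [exact: (H true) | exact: (H false)].
Qed.

Lemma keeps_relations_closed (K : comAlgType rat) (f : ext_aut L1 K) :
  closed_condition (fun K' (phi : {lrmorphism K -> K'}) =>
    keeps_relations (base_change phi f)).
Proof.
pose z m w := lie_eval (in_alg K) (fun t : I * L1 => ind t.1 ((f : ext_aut L1 K) (ext_of K t.2))) w m.
apply: (closed_condition_iff (Q := fun K' phi => forall j : {mw : nat * lie_term (I * L1) | lcs mw.1 (ev mw.2)},
  tens_map idfun phi (z (sval j).1 (sval j).2) = 0)).
  move=> K' phi.
  have E m w : lie_eval (in_alg K') (fun t : I * L1 => ind t.1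
      ((base_change phi f) (ext_of K' t.2))) w m = tens_map idfun phi (z m w).
    rewrite -[RHS]/(ext_map phi (lie_eval _ _ w) m) lie_eval_map.
    congr (ext_at (lie_eval _ _ _) m); apply/funext => t.
    by rewrite -(ext_map_of phi) [X in ind _ X]base_changeE ext_map_induced.
  split=> [H [[m w] /= mw]|H m w mw]; first by rewrite -E; exact: H.
  by rewrite E; exact: H (exist _ (m, w) mw).
by apply: closed_condition_all => j; exact: tens_vanishing.
Qed.

Lemma keeps_copies_closed (K : comAlgType rat) (f' : ext_aut L2 K) :
  closed_condition (fun K' (phi : {lrmorphism K -> K'}) =>
    keeps_copies (base_change phi f')).
Proof.
pose z i x : ext L2 K := (f' : ext_aut L2 K) (ind i (ext_of K x)) -
  ind i (res ((f' : ext_aut L2 K) (ind i0 (ext_of K x)))).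
apply: (closed_condition_iff (Q := fun K' phi => forall j : I * L1 * nat,
  tens_map idfun phi (z j.1.1 j.1.2 j.2) = 0)).
  move=> K' phi.
  have E i x : (base_change phi f') (ind i (ext_of K' x)) -
      ind i (res ((base_change phi f') (ind i0 (ext_of K' x)))) = ext_map phi (z i x).
    rewrite -(ext_map_of phi) -!ext_map_ind !base_changeE -ext_map_res -ext_map_ind.
    by rewrite /z ext_mapD -[- ind _ _ in RHS]scaleN1r ext_mapZ rmorphN1 scaleN1r.
  split=> [H [[i x] m] /=|H i x]; first by rewrite -[LHS]/(ext_map phi (z i x) m) -E H subrr.
  by apply/eqP; rewrite -subr_eq0 E; apply/eqP/extP => m; exact: (H (i, x, m)).
by apply: closed_condition_all => j; exact: tens_vanishing.
Qed.

Lemma base_changeV (L : lieAlgType rat) (K K' : comAlgType rat) (phi : {lrmorphism K -> K'})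
  (f : ext_aut L K) : base_change phi f^-1%g = (base_change phi f)^-1%g.
Proof. exact: gmulfV'. Qed.

Definition intertwined_points (K : comAlgType rat) (f : aut_functor L1 K)
  (f' : aut_functor L2 K) : Prop := intertwined (f : ext_aut L1 K) (f' : ext_aut L2 K).

Lemma intertwined_correspondence : correspondence intertwined_points.
Proof.
split.
- exact: intertwined1.
- exact: intertwinedM.
- exact: intertwinedV.
- exact: intertwined_map.
- exact: intertwined_fun.
move=> K f.
apply: (closed_condition_iff (Q := fun K' phi =>
  keeps_relations (base_change phi (f : ext_aut L1 K)) /\
  keeps_relations (base_change phi (f^-1%g : ext_aut L1 K)))) => [K' phi|].
  by rewrite base_changeV; exact: intertwined_domain.
by apply: closed_condition_and; exact: keeps_relations_closed.
Qed.

Lemma intertwined_correspondenceV :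
  correspondence (fun K (x : aut_functor L2 K) (y : aut_functor L1 K) => intertwined_points y x).
Proof.
split.
- exact: intertwined1.
- by move=> K x y x' y'; exact: intertwinedM.
- by move=> K x x'; exact: intertwinedV.
- by move=> K K' phi x x'; exact: intertwined_map.
- by move=> K x x' y'; exact: intertwined_inj.
move=> K f.
apply: (closed_condition_iff (Q := fun K' phi =>
  keeps_copies (base_change phi (f : ext_aut L2 K)) /\
  keeps_copies (base_change phi (f^-1%g : ext_aut L2 K)))) => [K' phi|].
  by rewrite base_changeV; exact: intertwined_range.
by apply: closed_condition_and; exact: keeps_copies_closed.
Qed.

Lemma intertwined_closure_iso (Gamma : groupType)
    (rho1 : {multiplicative Gamma -> aut_functor L1 rat^o})
    (rho2 : {multiplicative Gamma -> aut_functor L2 rat^o}) :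
  (forall b i x, (rho2 b : ext_aut L2 rat^o) (ext_of rat^o (iota i x)) =
    ind i ((rho1 b : ext_aut L1 rat^o) (ext_of rat^o x))) ->
  exists F : groupFunctorIso (zariski_closure rho1) (zariski_closure rho2),
    forall b, F rat^o (to_zariski rho1 b) = to_zariski rho2 b.
Proof.
move=> H; apply: (zariski_closure_iso intertwined_correspondence intertwined_correspondenceV).
by move=> b; apply: intertwinedP => i x; exact: H.
Qed.
End Intertwining.

(** * Functions on groups and the Malcev Lie algebra *)

Section PolynomialSequences.
Variable F : numFieldType.
Implicit Types (a b : nat -> F) (p q : {poly F}).

Definition interpolates p a : Prop := forall k : nat, p.[k%:R] = a k.

Lemma poly_eq_on_nat p q : (forall k : nat, p.[k%:R] = q.[k%:R]) -> p = q.
Proof.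
move=> pq; apply/eqP; rewrite -subr_eq0; apply/eqP.
pose s := [seq (k%:R : F) | k <- iota 0 (size (p - q))].
apply: (@roots_geq_poly_eq0 _ (p - q) s).
- by apply/allP => _ /mapP[k _ ->]; rewrite rootE !hornerE pq subrr.
- by rewrite map_inj_uniq ?iota_uniq // => i j /eqP; rewrite Num.Theory.eqr_nat => /eqP.
- by rewrite size_map size_iota.
Qed.

Lemma interpolates_uniq p q a : interpolates p a -> interpolates q a -> p = q.
Proof. by move=> pa qa; apply: poly_eq_on_nat => k; rewrite pa qa. Qed.

(* The derivative at 0 of the interpolating polynomial; 0 when there is none. *)
Definition slope a : F :=
  if pselect (exists p, interpolates p a) is left e then (projT1 (cid e))^`().[0] else 0.

Lemma slopeE p a : interpolates p a -> slope a = p^`().[0].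
Proof.
move=> pa; rewrite /slope; case: pselect => [e|[]]; last by exists p.
by case: cid => q qa /=; rewrite (interpolates_uniq qa pa).
Qed.

Definition polynomial_seq a : Prop := exists p, interpolates p a.

Lemma polynomial_cst (c : F) : polynomial_seq (fun=> c).
Proof. by exists c%:P => k; rewrite hornerC. Qed.
Lemma polynomialD a b : polynomial_seq a -> polynomial_seq b -> polynomial_seq (fun k => a k + b k).
Proof. by move=> [p pa] [q qb]; exists (p + q) => k; rewrite hornerD pa qb. Qed.
Lemma polynomialM a b : polynomial_seq a -> polynomial_seq b -> polynomial_seq (fun k => a k * b k).
Proof. by move=> [p pa] [q qb]; exists (p * q) => k; rewrite hornerM pa qb. Qed.
Lemma polynomial_sum N (a : nat -> nat -> F) :
  (forall i, polynomial_seq (a i)) -> polynomial_seq (fun k => \sum_(i < N) a i k).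
Proof.
move=> pa; elim: N => [|N IH].
  by apply: (eq_ind _ polynomial_seq (polynomial_cst 0)); apply/funext => k; rewrite big_ord0.
apply: (eq_ind _ polynomial_seq (polynomialD IH (pa N))).
by apply/funext => k; rewrite big_ord_recr.
Qed.

Lemma slopeD a b : polynomial_seq a -> polynomial_seq b ->
  slope (fun k => a k + b k) = slope a + slope b.
Proof.
move=> [p pa] [q qb]; rewrite (slopeE pa) (slopeE qb).
by rewrite (@slopeE (p + q)) ?derivD ?hornerD // => k; rewrite hornerD pa qb.
Qed.
Lemma slopeZ c a : polynomial_seq a -> slope (fun k => c * a k) = c * slope a.
Proof.
move=> [p pa]; rewrite (slopeE pa).
by rewrite (@slopeE (c *: p)) ?derivZ ?hornerZ // => k; rewrite hornerZ pa.
Qed.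
Lemma slopeM a b : polynomial_seq a -> polynomial_seq b ->
  slope (fun k => a k * b k) = a 0%N * slope b + slope a * b 0%N.
Proof.
move=> [p pa] [q qb]; rewrite (slopeE pa) (slopeE qb) -(pa 0%N) -(qb 0%N).
rewrite (@slopeE (p * q)) => [|k]; last by rewrite hornerM pa qb.
by rewrite derivM hornerD !hornerM addrC.
Qed.
Lemma slope_cst (c : F) : slope (fun=> c) = 0.
Proof.
by rewrite (@slopeE c%:P) => [|k]; rewrite ?derivC ?horner0 ?hornerC.
Qed.
Lemma slope_linear c : slope (fun k => k%:R * c) = c.
Proof.
rewrite (@slopeE (c *: 'X)) => [|k]; last by rewrite hornerZ hornerX mulrC.
by rewrite derivZ derivX hornerZ hornerC mulr1.
Qed.

Lemma slope_dilate a l : polynomial_seq a -> slope (fun k => a (l * k)%N) = l%:R * slope a.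
Proof.
move=> [p pa]; rewrite (slopeE pa).
rewrite (@slopeE (p \Po ('X *+ l))) => [|k].
  rewrite deriv_comp hornerM horner_comp derivMn derivX !hornerMn hornerX mul0rn.
  by rewrite -[1](rmorph1 (@polyC F)) hornerC mulrC.
by rewrite horner_comp hornerMn hornerX -mulr_natr -natrM mulnC pa.
Qed.

Lemma polynomial_shift a t : polynomial_seq a -> polynomial_seq (fun k => a (t + k)%N).
Proof.
move=> [p pa]; exists (p \Po ('X + t%:R%:P)) => k.
by rewrite horner_comp !hornerE -natrD pa addnC.
Qed.

(** The slopes of the shifts are the values of the derivative at the natural numbers. So the
    derivative is the zero polynomial, and in characteristic 0 the polynomial is constant. *)
Lemma slope_shift_const a : polynomial_seq a ->
  (forall t, slope (fun k => a (t + k)%N) = 0) -> forall k, a k = a 0%N.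
Proof.
move=> [p pa] da.
have p'0 : p^`() = 0.
  apply: poly_eq_on_nat => t; rewrite horner0 -(da t).
  rewrite (@slopeE (p \Po ('X + t%:R%:P))) => [|k]; last first.
    by rewrite horner_comp !hornerE -natrD pa addnC.
  rewrite deriv_comp derivD derivX derivC addr0 mulr1 horner_comp.
  by rewrite [in RHS]hornerD [in RHS]hornerX [in RHS]hornerC add0r.
have sz : (size p <= 1)%N.
  rewrite leqNgt; apply/negP => sp.
  have /eqP := congr1 (fun q : {poly F} => q`_(size p).-2) p'0.
  rewrite coef_deriv coef0 -mulr_natr mulf_eq0 Num.Theory.pnatr_eq0 orbF.
  rewrite prednK; last by case: (size p) sp => [|[]].
  by rewrite -lead_coefE lead_coef_eq0 => /eqP p0; move: sp; rewrite p0 size_poly0.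
by move=> k; rewrite -!pa (size1_polyC sz) !hornerC.
Qed.

(** Extrapolation to 0, for identities that can only be divided by [k] when [k] is positive. *)
Lemma polynomial_const_pos a : polynomial_seq a -> (forall k, a k.+1 = a 1%N) -> a 0%N = a 1%N.
Proof.
move=> [p pa] ak; rewrite -!pa.
have [q qE] : exists q, q = p \Po ('X + 1%:P) by eexists.
have e : q = (a 1%N)%:P.
  apply: poly_eq_on_nat => k.
  by rewrite qE horner_comp hornerD hornerX !hornerC natr1 pa ak.
have -> : p = q \Po ('X - 1%:P).
  by rewrite qE -comp_polyA comp_polyD comp_polyX comp_polyC subrK comp_polyXr.
by rewrite e comp_polyC !hornerC.
Qed.
End PolynomialSequences.

Lemma polynomial_binomial (F : numFieldType) j : polynomial_seq (fun k => ('C(k, j))%:R : F).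
Proof.
exists ((j`!%:R)^-1 *: \prod_(i < j) ('X - i%:R%:P)) => k.
rewrite hornerZ horner_prod.
have -> : \prod_(i < j) ('X - i%:R%:P).[k%:R] = (k ^_ j)%:R :> F.
  elim: j => [|j IH]; first by rewrite big_ord0.
  rewrite big_ord_recr /= IH ffactnSr natrM hornerD hornerN hornerX hornerC.
  have [jk|kj] := leqP j k; first by rewrite natrB.
  by rewrite ffact_small // !mul0r.
rewrite -bin_ffact natrM mulrC mulfK //.
by rewrite Num.Theory.pnatr_eq0 -lt0n fact_gt0.
Qed.

(** * Finiteness properties of unipotent functions *)

Section UnipotentFunctions.
Variable Gamma : groupType.
Implicit Types f g : Gamma -> rat.

Lemma killed_transr m c f : killed m f -> killed m (fun x => f (x * c)%g).
Proof.
elim: m f => [|m IH] f /= fm; first by move=> x; rewrite fm.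
move=> a; apply: killed_ext (IH _ (fm a)) => x /=.
by rewrite mulgA.
Qed.

(** [killed] is defined by left differences; right ones lower the degree too, the powers of the
    augmentation ideal being two-sided. *)
Lemma killed_diffr m c f : killed m.+1 f -> killed m (fun x => f (x * c)%g - f x).
Proof.
elim: m f => [|m IH] f fm.
  have f1 x : f x = f 1%g by apply/eqP; have := fm x 1%g; rewrite mulg1 => /eqP; rewrite subr_eq0.
  by move=> x; rewrite !f1 subrr.
move=> a; apply: killed_ext (IH _ (fm a)) => x /=.
by rewrite mulgA; ring.
Qed.

Lemma killed_inv m f : killed m f -> killed m (fun x => f x^-1%g).
Proof.
elim: m f => [|m IH] f fm; first by move=> x; rewrite fm.
move=> a; apply: killed_ext (IH _ (killed_diffr a^-1%g fm)) => x /=.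
by rewrite invgM.
Qed.

Lemma unip_cst (c : rat) : unip (fun _ : Gamma => c).
Proof. by exists 1%N => a x; rewrite subrr. Qed.
Lemma unip_inv f : unip f -> unip (fun x => f x^-1%g).
Proof. by move=> [m fm]; exists m; exact: killed_inv. Qed.
Lemma unip_transr c f : unip f -> unip (fun x => f (x * c)%g).
Proof. by move=> [m fm]; exists m; exact: killed_transr. Qed.
Lemma unip_sum N (F : nat -> Gamma -> rat) :
  (forall k, unip (F k)) -> unip (fun x => \sum_(k < N) F k x).
Proof.
move=> uF; elim: N => [|N IH].
  by apply: (eq_ind _ (@unip _) (unip_cst 0)); apply/funext => x; rewrite big_ord0.
apply: (eq_ind _ (@unip _) (unipD IH (uF N))).
by apply/funext => x; rewrite big_ord_recr.
Qed.
Lemma unip_ext f g : f =1 g -> unip f -> unip g. Proof. by move=> /funext ->. Qed.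

Lemma malcev_cst (D : malcev Gamma) c : D (fun=> c) = 0.
Proof.
have D1 : D (fun=> 1) = 0.
  have := malcevM D (unip_cst 1) (unip_cst 1).
  under eq_fun do rewrite mulr1.
  by rewrite mul1r mulr1 => /eqP; rewrite -subr_eq0 opprD addrA subrr sub0r oppr_eq0 => /eqP.
by have := malcevZ D c (unip_cst 1); under eq_fun do rewrite mulr1; rewrite D1 mulr0.
Qed.
Lemma malcev_sum (D : malcev Gamma) N (F : nat -> Gamma -> rat) :
  (forall k, unip (F k)) -> D (fun x => \sum_(k < N) F k x) = \sum_(k < N) D (F k).
Proof.
move=> uF; elim: N => [|N IH].
  by under eq_fun do rewrite big_ord0; rewrite malcev_cst big_ord0.
under eq_fun do rewrite big_ord_recr /=.
by rewrite malcevD ?IH ?big_ord_recr //; exact: unip_sum.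
Qed.
Lemma malcevZr (D : malcev Gamma) f c : unip f -> D (fun x => f x * c) = D f * c.
Proof. by move=> uf; under eq_fun do rewrite mulrC; rewrite malcevZ // mulrC. Qed.

(* Gamma is generated by us, as far as functions Gamma -> rat can detect. *)
Definition generated_by (us : seq Gamma) : Prop := forall f,
  (forall u, u \in us -> forall x, f (u * x)%g = f x) -> forall x, f x = f 1%g.

Section FinitelyGenerated.
Variable us : seq Gamma.
Hypothesis gen : generated_by us.

(** The difference of [f] along a generator [u] has lower degree, hence vanishes once [f] does on
    [ps] and on its translate by [u]. Then [f] is invariant under all generators, so it equals its
    value at 1. *)
Lemma killed_determined m : exists ps : seq Gamma,
  forall f, killed m f -> (forall p, p \in ps -> f p = 0) -> forall x, f x = 0.
Proof.
elim: m => [|m [ps IH]]; first by exists [::] => f.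
exists (1%g :: ps ++ [seq (u * p)%g | u <- us, p <- ps]) => f fm f0 x.
rewrite (gen (f := f)) => [|u uus y]; first by apply: f0; rewrite inE eqxx.
apply/eqP; rewrite -subr_eq0; apply/eqP.
apply: (IH _ (fm u)) => p pps; rewrite !f0 ?subrr //; rewrite inE mem_cat.
  by rewrite pps orbT.
by apply/orP; right; apply/orP; right; apply/allpairsP; exists (u, p).
Qed.

Lemma killed_basis m : exists N (p : nat -> Gamma) (l : nat -> Gamma -> rat),
  (forall k, killed m (l k)) /\ forall f, killed m f -> forall x, f x = \sum_(k < N) f (p k) * l k x.
Proof.
have [ps psP] := killed_determined m.
(* The empty list is generalised to a list [z] of points where [f] vanishes. A further point [p]
   either imposes nothing new, or some [f0] vanishes on [z] with value 1 at [p], and then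
   [f - f p * f0] falls under the case of [p :: z]. *)
suff [N [p [l [lm lP]]]] : exists N (p : nat -> Gamma) (l : nat -> Gamma -> rat),
    (forall k, killed m (l k)) /\
    forall f, killed m f /\ (forall q, q \in [::] -> f q = 0) ->
      forall x, f x = \sum_(k < N) f (p k) * l k x.
  by exists N, p, l; split=> // f fm; apply: lP.
have: forall f, killed m f /\ (forall q, q \in [::] -> f q = 0) ->
    (forall p, p \in ps -> f p = 0) -> forall x, f x = 0 by move=> f [fm _]; exact: psP.
elim: ps [::] {psP} => [|p ps IH] z psP.
  exists 0%N, (fun=> 1%g), (fun=> fun=> 0); split=> [k|f fm x]; first exact: killed0.
  by rewrite big_ord0 psP.
have [f fm f0|N [q [l [lm lP]]]] := IH (p :: z).
  apply: psP; first by case: fm => fm fz; split=> // r rz; apply: fz; rewrite inE rz orbT.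
  move=> r; rewrite inE => /predU1P[->|]; last exact: f0.
  by apply: fm.2; rewrite inE eqxx.
have [[f0 [[f0m f0z] f0p]]|nf0] :=
    pselect (exists f0, (killed m f0 /\ (forall q, q \in z -> f0 q = 0)) /\ f0 p = 1); last first.
  exists N, q, l; split=> // f [fm fz]; apply: lP; split=> // r.
  rewrite inE => /predU1P[->|]; last exact: fz.
  apply: contrapT => fp; apply: nf0; exists (fun x => (f p)^-1 * f x).
  split; last by rewrite mulVf //; exact/eqP.
  by split=> [|s sz]; [exact: killedZ | rewrite (fz _ sz) mulr0].
exists N.+1, (fun k => if k is k'.+1 then q k' else p).
pose l0 x := f0 x - \sum_(k < N) f0 (q k) * l k x.
exists (fun k => if k is k'.+1 then l k' else l0); split.
  case=> [|k] //; apply: killed_ext (killedD f0m (killedZ (-1) _)) => [x|].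
    by rewrite /l0 mulN1r.
  elim: (N) => [|N' IHN]; first by under eq_fun do rewrite big_ord0; exact: killed0.
  by under eq_fun do rewrite big_ord_recr /=; apply: killedD => //; exact: killedZ.
move=> f [fm fz] x; rewrite big_ord_recl /=.
have : killed m (fun y => f y + - f p * f0 y) /\
    forall r, r \in p :: z -> f r + - f p * f0 r = 0.
  split=> [|r]; first exact/killedD/killedZ.
  rewrite inE => /predU1P[->|rz]; first by rewrite f0p mulr1 subrr.
  by rewrite (fz _ rz) (f0z _ rz) mulr0 addr0.
move=> /lP /(_ x) /eqP; rewrite mulNr subr_eq => /eqP ->.
rewrite /l0 mulrBr addrC -addrA; congr (_ + _).
rewrite mulr_sumr -sumrN -big_split /=; apply: eq_bigr => k _.
by rewrite /bump /=; ring.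
Qed.

(* The coproduct f |-> ((x, y) |-> f (x * y)) lands in the tensor square. *)
Lemma unip_coproduct f : unip f -> exists N (a b : nat -> Gamma -> rat),
  [/\ forall k, unip (a k), forall k, unip (b k)
    & forall x y, f (x * y)%g = \sum_(k < N) a k x * b k y].
Proof.
move=> [m fm]; have [N [p [l [lm lP]]]] := killed_basis m.
exists N, l, (fun k y => f (p k * y)%g); split=> [k|k|x y].
- by exists m.
- by exists m; exact: killed_trans.
- rewrite (lP (fun x => f (x * y)%g)); last exact: killed_transr.
  by apply: eq_bigr => k _; rewrite mulrC.
Qed.
End FinitelyGenerated.
End UnipotentFunctions.

(** * Powers of a group element and logarithms *)

Section Newton.
Variables (Gamma : groupType) (g : Gamma).
Implicit Types f : Gamma -> rat.

Definition diff f : Gamma -> rat := fun x => f (g * x)%g - f x.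

Lemma newton f k x : f (g ^+ k * x)%g = \sum_(j < k.+1) ('C(k, j))%:R * iter j diff f x.
Proof.
elim: k f x => [|k IH] f x.
  by rewrite big_ord_recl big_ord0 expg0 mul1g mul1r addr0.
have -> : f (g ^+ k.+1 * x)%g = f (g ^+ k * x)%g + diff f (g ^+ k * x)%g.
  by rewrite /diff addrC subrK expgS mulgA.
rewrite !IH big_ord_recl /= bin0 mul1r [in RHS]big_ord_recl /= bin0 mul1r -addrA; congr (_ + _).
under [in RHS]eq_bigr => j _ do rewrite /bump /= add1n binS natrD mulrDl.
rewrite big_split /= [X in _ = X + _]big_ord_recr /= bin_small // mul0r addr0.
by congr (_ + _); apply: eq_bigr => j _; rewrite ?add1n -?iterSr.
Qed.

(** The number of terms no longer depends on [k], so the values of [f] on the powers of [g] form a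
    polynomial sequence. *)
Lemma newton_killed m f k x : killed m f ->
  f (g ^+ k * x)%g = \sum_(j < m) ('C(k, j))%:R * iter j diff f x.
Proof.
elim: m f k x => [|m IH] f k x fm; first by rewrite big_ord0 fm.
elim: k => [|k IHk].
  rewrite expg0 mul1g big_ord_recl bin0 mul1r big1 ?addr0 // => j _.
  by rewrite bin_small ?mul0r.
have -> : f (g ^+ k.+1 * x)%g = f (g ^+ k * x)%g + diff f (g ^+ k * x)%g.
  by rewrite /diff addrC subrK expgS mulgA.
rewrite IHk (IH (diff f)); last exact: fm.
rewrite !big_ord_recl /= !bin0 !mul1r -addrA; congr (_ + _).
rewrite -big_split /=; apply: eq_bigr => j _.
by rewrite /bump /= add1n binS natrD mulrDl -iterSr.
Qed.
End Newton.

Section Logarithm.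
Variable Gamma : groupType.
Implicit Types f : Gamma -> rat.

Lemma unip_polynomial f g : unip f -> polynomial_seq (fun k => f (g ^+ k)%g).
Proof.
move=> [m fm].
have -> : (fun k => f (g ^+ k)%g) =
    fun k => \sum_(j < m) ('C(k, j))%:R * iter j (diff g) f 1%g.
  by apply/funext => k; rewrite -(newton_killed g k 1 fm) mulg1.
apply: (@polynomial_sum rat m (fun j k => ('C(k, j))%:R * iter j (diff g) f 1%g)) => j.
exact: polynomialM (polynomial_binomial rat j) (polynomial_cst (F := rat) _).
Qed.

(** The derivative at t = 0 along the one-parameter subgroup t |-> g^t of the prounipotent
    completion, obtained by interpolating the integral powers. *)
Definition log_fun (g : Gamma) : (Gamma -> rat) -> rat^o :=
  fun f => if `[< unip f >] then slope (fun k => f (g ^+ k)%g) else 0.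

Fact log_subproof g : tangent (log_fun g).
Proof.
have E f : unip f -> log_fun g f = slope (fun k => f (g ^+ k)%g).
  by move=> uf; rewrite /log_fun asboolT.
apply/asboolP; split=> [f nf|f h uf uh|c f uf|f h uf uh].
- by rewrite /log_fun asboolF.
- by rewrite !E; [rewrite slopeD //; exact: unip_polynomial | | | exact: unipD].
- by rewrite !E; [rewrite slopeZ //; exact: unip_polynomial | | exact: unipZ].
- by rewrite !E; [rewrite slopeM //; exact: unip_polynomial | | | exact: unipM].
Qed.
Definition log (g : Gamma) : malcev Gamma := exist _ (log_fun g) (log_subproof g).

Lemma logE g f : unip f -> log g f = slope (fun k => f (g ^+ k)%g).
Proof. by move=> uf; rewrite /log /malcev_fun /= /log_fun asboolT. Qed.

End Logarithm.

Lemma log_map (Gamma H : groupType) (h : {multiplicative Gamma -> H}) g :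
  malcev_map h (log g) = log (h g).
Proof.
apply: malcevP => f uf; rewrite malcev_mapE // !logE //; last exact: unip_comp.
congr slope; apply/funext => k /=; congr f.
by elim: k => [|k IH]; rewrite ?expg0 ?gmulf1' // !expgS gmulfM IH.
Qed.

(** * Differential calculus with tangent vectors *)

Section Calculus.
Variables (Gamma : groupType) (us : seq Gamma).
Hypothesis gen : generated_by us.
Implicit Types (f : Gamma -> rat) (D E : malcev Gamma).

Section TwoSlots.
Variables u v : Gamma -> Gamma.
Hypothesis uu : forall f, unip f -> unip (f \o u).
Hypothesis uv : forall f, unip f -> unip (f \o v).

Lemma unip_two_slots f : unip f -> unip (fun x => f (u x * v x)%g).
Proof.
move=> /(unip_coproduct gen)[N [a [b [ua ub fE]]]].
apply: (unip_ext (f := fun x => \sum_(k < N) a k (u x) * b k (v x))) => [x|]; first by rewrite fE.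
by apply: (unip_sum N (F := fun k x => a k (u x) * b k (v x))) => k; apply: unipM; [exact: uu | exact: uv].
Qed.

(** The product rule for two occurrences of the variable: the coproduct turns [f] of a product into
    a finite sum of products, to which the derivation property applies. *)
Lemma malcev_two_slots D f : unip f -> D (fun x => f (u x * v x)%g) =
  D (fun x => f (u x * v 1)%g) + D (fun x => f (u 1 * v x)%g).
Proof.
move=> /(unip_coproduct gen)[N [a [b [ua ub fE]]]].
under eq_fun do rewrite fE; under [in X in _ = X + _]eq_fun do rewrite fE.
under [in X in _ = _ + X]eq_fun do rewrite fE.
have uau k : unip (fun x => a k (u x)) by exact: uu.
have ubv k : unip (fun x => b k (v x)) by exact: uv.
rewrite (malcev_sum D N (F := fun k x => a k (u x) * b k (v x))); last by move=> k; exact: unipM.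
rewrite (malcev_sum D N (F := fun k x => a k (u x) * b k (v 1%g))); last first.
  by move=> k; apply: unipM => //; exact: unip_cst.
rewrite (malcev_sum D N (F := fun k x => a k (u 1%g) * b k (v x))); last first.
  by move=> k; apply: unipM => //; exact: unip_cst.
rewrite -big_split /=; apply: eq_bigr => k _.
by rewrite malcevM // malcevZr // malcevZ // addrC.
Qed.
End TwoSlots.

Lemma unip_pow f c k : unip f -> unip (fun x => f ((x * c) ^+ k)%g).
Proof.
elim: k f => [|k IH] f uf; first by under eq_fun do rewrite expg0; exact: unip_cst.
under eq_fun do rewrite expgS.
apply: (unip_two_slots (u := fun x => (x * c)%g) (v := fun x => ((x * c) ^+ k)%g)) => // h uh.
exact: unip_transr.
Qed.

Lemma malcev_pow D f c k : unip f -> D (fun x => f ((x * c) ^+ k)%g) =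
  \sum_(i < k) D (fun x => f (c ^+ i * x * c ^+ (k - i))%g).
Proof.
elim: k f => [|k IH] f uf.
  by rewrite big_ord0; under eq_fun do rewrite expg0; rewrite malcev_cst.
under eq_fun do rewrite expgS.
have ut h : unip h -> unip (h \o (fun x => (x * c)%g)) by exact: unip_transr.
have up h : unip h -> unip (h \o (fun x => ((x * c) ^+ k)%g)) by exact: unip_pow.
rewrite (malcev_two_slots ut up D uf).
rewrite big_ord_recl /= subn0; congr (_ + _).
  by congr malcev_fun; apply/funext => x; rewrite !mul1g expgS mulgA.
rewrite (IH (fun y => f (1 * c * y)%g)); last exact: unip_trans.
apply: eq_bigr => i _; rewrite /bump /= add1n subSS; congr malcev_fun.
by apply/funext => x; rewrite mul1g expgS !mulgA.
Qed.

Lemma malcev_inv D f : unip f -> D (fun x => f x^-1%g) = - D f.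
Proof.
move=> uf.
have := malcev_two_slots (u := id) (v := fun x => x^-1%g) (fun _ => id) (@unip_inv Gamma) D uf.
have -> : (fun x => f (id x * x^-1)%g) = fun=> f 1%g by apply/funext => x; rewrite mulgV.
have -> : (fun x => f (id x * 1^-1)%g) = f by apply/funext => x; rewrite invg1 mulg1.
have -> : (fun x => f (id 1 * x^-1)%g) = fun x => f x^-1%g by apply/funext => x; rewrite mul1g.
by rewrite malcev_cst => /esym/eqP; rewrite addrC addr_eq0 => /eqP.
Qed.

Lemma unip_malcevr E f : unip f -> unip (fun z => E (fun y => f (y * z)%g)).
Proof.
move=> /(unip_coproduct gen)[N [a [b [ua ub fE]]]].
apply: (unip_ext (f := fun x => \sum_(k < N) E (a k) * b k x)) => [x|].
  under [in RHS]eq_fun do rewrite fE.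
  rewrite (malcev_sum E N (F := fun k y => a k y * b k x)); last first.
    by move=> k; apply: unipM => //; exact: unip_cst.
  by apply: eq_bigr => k _; rewrite malcevZr.
by apply: (unip_sum N (F := fun k x => E (a k) * b k x)) => k; exact: unipZ.
Qed.

(** [D] and [E] act on different variables, and the finite coproduct separates these. *)
Lemma malcev_exchange D E f : unip f ->
  D (fun z => E (fun y => f (y * z)%g)) = E (fun y => D (fun z => f (y * z)%g)).
Proof.
move=> /(unip_coproduct gen)[N [a [b [ua ub fE]]]].
transitivity (\sum_(k < N) E (a k) * D (b k)).
  have -> : \sum_(k < N) E (a k) * D (b k) = \sum_(k < N) D (fun z => E (a k) * b k z).
    by apply: eq_bigr => k _; rewrite malcevZ.
  rewrite -(malcev_sum D N (F := fun k z => E (a k) * b k z)); last by move=> k; exact: unipZ.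
  congr malcev_fun; apply/funext => z; under eq_fun do rewrite fE.
  rewrite (malcev_sum E N (F := fun k y => a k y * b k z)); last first.
    by move=> k; apply: unipM => //; exact: unip_cst.
  by apply: eq_bigr => k _; rewrite malcevZr.
have -> : \sum_(k < N) E (a k) * D (b k) = \sum_(k < N) E (fun y => a k y * D (b k)).
  by apply: eq_bigr => k _; rewrite malcevZr.
rewrite -(malcev_sum E N (F := fun k y => a k y * D (b k))); last first.
  by move=> k; apply: unipM => //; exact: unip_cst.
congr malcev_fun; apply/funext => y; under [in RHS]eq_fun do rewrite fE.
rewrite (malcev_sum D N (F := fun k z => a k y * b k z)); last by move=> k; exact: unipZ.
by apply: eq_bigr => k _; rewrite malcevZ.
Qed.

(** The value at [f] of Ad(z) E, as a function of [z]. *)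
Definition conjugated E f : Gamma -> rat := fun z => E (fun y => f (z * y * z^-1)%g).

(** The derivative of Ad at 1 is ad. The factor [z] contributes [conv D E f], and the factor [z^-1]
    contributes [- conv E D f]. *)
Lemma lie_conjugated D E f : unip f ->
  unip (conjugated E f) /\ D (conjugated E f) = (lie D E : malcev Gamma) f.
Proof.
move=> uf; have [N [a [b [ua ub fE]]]] := unip_coproduct gen uf.
pose c k z := E (fun y => b k (y * z)%g).
have uc k : unip (c k) by exact: unip_malcevr.
have ucV k : unip (fun z => c k z^-1%g) by exact: unip_inv.
have -> : conjugated E f = fun z => \sum_(k < N) a k z * c k z^-1%g.
  apply/funext => z; rewrite /conjugated; under eq_fun do rewrite -mulgA fE.
  rewrite (malcev_sum E N (F := fun k y => a k z * b k (y * z^-1)%g)); last first.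
    by move=> k; apply/unipZ/unip_transr.
  by apply: eq_bigr => k _; rewrite malcevZ //; exact: unip_transr.
split; first by apply: (unip_sum N (F := fun k z => a k z * c k z^-1%g)) => k; exact: unipM.
rewrite (malcev_sum D N (F := fun k z => a k z * c k z^-1%g)); last by move=> k; exact: unipM.
rewrite malcev_lieE //.
have -> : conv D E f = \sum_(k < N) D (a k) * c k 1%g.
  have -> : \sum_(k < N) D (a k) * c k 1%g = \sum_(k < N) D (fun x => a k x * c k 1%g).
    by apply: eq_bigr => k _; rewrite malcevZr.
  rewrite -(malcev_sum D N (F := fun k x => a k x * c k 1%g)); last first.
    by move=> k; apply: unipM => //; exact: unip_cst.
  congr malcev_fun; apply/funext => x; under eq_fun do rewrite fE.
  rewrite (malcev_sum E N (F := fun k y => a k x * b k y)); last by move=> k; exact: unipZ.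
  apply: eq_bigr => k _; rewrite malcevZ // /c; congr (_ * malcev_fun _ _).
  by apply/funext => y; rewrite mulg1.
have -> : conv E D f = \sum_(k < N) a k 1%g * D (c k).
  rewrite /conv -malcev_exchange //.
  have -> : \sum_(k < N) a k 1%g * D (c k) = \sum_(k < N) D (fun z => a k 1%g * c k z).
    by apply: eq_bigr => k _; rewrite malcevZ.
  rewrite -(malcev_sum D N (F := fun k x => a k 1%g * c k x)); last by move=> k; exact: unipZ.
  congr malcev_fun; apply/funext => z.
  have -> : \sum_(k < N) a k 1%g * c k z = \sum_(k < N) E (fun y => a k 1%g * b k (y * z)%g).
    by apply: eq_bigr => k _; rewrite malcevZ //; exact: unip_transr.
  rewrite -(malcev_sum E N (F := fun k y => a k 1%g * b k (y * z)%g)); last first.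
    by move=> k; apply/unipZ/unip_transr.
  by congr malcev_fun; apply/funext => y; rewrite -fE mul1g.
rewrite -sumrB; apply: eq_bigr => k _.
by rewrite malcevM // invg1 malcev_inv // mulrN addrC.
Qed.
End Calculus.

Section Conjugation.
Variables (G : groupType) (z : G).
Definition conj_by (x : G) : G := (z * x * z^-1)%g.
Fact conj_byM : {morph conj_by : x y / (x * y)%g}.
Proof. by move=> x y; rewrite /conj_by !mulgA mulgVK. Qed.
HB.instance Definition _ := isMultiplicative.Build G G conj_by conj_byM.
End Conjugation.

(** * Tangent vectors vanishing on additive functions *)

Section LogFunction.
Variables (Gamma : groupType) (us : seq Gamma).
Hypothesis gen : generated_by us.
Implicit Types (f : Gamma -> rat) (D E : malcev Gamma).

Let taylor f j (g : Gamma) : rat := iter j (diff g) f 1%g.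

(** Newton's formula at [k = j] expresses the coefficient of index [j] through [f (g ^+ j)] and the
    earlier ones. *)
Lemma unip_taylor f j : unip f -> unip (taylor f j).
Proof.
move=> uf; elim/ltn_ind: j => j IH.
pose F i g := if (i < j)%N then ('C(j, i))%:R * taylor f i g else 0.
have uF i : unip (F i).
  by rewrite /F; case: (ltnP i j) => ij; [exact/unipZ/IH | exact: unip_cst].
apply: (unip_ext (f := fun g => f ((g * 1) ^+ j)%g - \sum_(i < j) F i g)) => [g|]; last first.
  by apply: unipB; [exact: (unip_pow gen) | exact: unip_sum].
have := newton g f j 1%g; rewrite !mulg1 big_ord_recr /= binn mul1r => ->.
rewrite addrC (eq_bigr (fun i : 'I_j => F i g)) ?addrK // => i _.
by rewrite /F ltn_ord.
Qed.

(** The logarithm series: the slope of ['C(k, j)] is (-1)^(j-1)/j for positive [j], and 0 for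
    [j = 0]. *)
Let log_taylor f m g : killed m f ->
  log g f = \sum_(j < m) slope (fun k => ('C(k, j))%:R) * taylor f j g.
Proof.
move=> fm; rewrite logE; last by exists m.
have -> : (fun k => f (g ^+ k)%g) = fun k => \sum_(j < m) ('C(k, j))%:R * taylor f j g.
  by apply/funext => k; rewrite -(newton_killed g k 1 fm) mulg1.
elim: (m) => [|N IH]; first by under eq_fun do rewrite big_ord0; rewrite big_ord0 slope_cst.
under eq_fun do rewrite big_ord_recr /=.
have pol j : polynomial_seq (fun k => ('C(k, j))%:R * taylor f j g).
  exact: polynomialM (polynomial_binomial rat j) (polynomial_cst (F := rat) _).
rewrite slopeD ?IH ?big_ord_recr //; last exact: (polynomial_sum _ pol).
congr (_ + _); under eq_fun do rewrite mulrC.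
by rewrite slopeZ 1?mulrC //; exact: polynomial_binomial.
Qed.

Lemma unip_log f : unip f -> unip (fun g => log g f).
Proof.
move=> uf; have [m fm] := uf; under eq_fun do rewrite (log_taylor _ fm).
apply: (unip_sum m (F := fun j g => slope (fun k => ('C(k, j))%:R) * taylor f j g)) => j.
exact/unipZ/unip_taylor.
Qed.

(* x |-> x^k acts on the tangent space as multiplication by k. *)
Lemma malcev_log D f : unip f -> D (fun g => log g f) = D f.
Proof.
move=> uf; have [m fm] := uf; under eq_fun do rewrite (log_taylor _ fm).
rewrite (malcev_sum D m (F := fun j g => slope (fun k => ('C(k, j))%:R) * taylor f j g)); last first.
  by move=> j; exact/unipZ/unip_taylor.
have pol j : polynomial_seq (fun k => ('C(k, j))%:R * D (taylor f j)).
  exact: polynomialM (polynomial_binomial rat j) (polynomial_cst (F := rat) _).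
transitivity (slope (fun k => \sum_(j < m) ('C(k, j))%:R * D (taylor f j))).
  elim: (m) => [|N IH]; first by under [in RHS]eq_fun do rewrite big_ord0; rewrite big_ord0 slope_cst.
  under [in RHS]eq_fun do rewrite big_ord_recr /=.
  rewrite slopeD ?big_ord_recr //=; last exact: (polynomial_sum _ pol).
  rewrite IH malcevZ; last exact: unip_taylor.
  congr (_ + _); under [in RHS]eq_fun do rewrite mulrC.
  by rewrite slopeZ 1?mulrC //; exact: polynomial_binomial.
rewrite -[RHS]slope_linear; congr slope; apply/funext => k.
transitivity (D (fun g => f ((g * 1) ^+ k)%g)).
  transitivity (D (fun g => \sum_(j < m) ('C(k, j))%:R * taylor f j g)).
    rewrite (malcev_sum D m (F := fun j g => ('C(k, j))%:R * taylor f j g)).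
      by apply: eq_bigr => j _; rewrite malcevZ //; exact: unip_taylor.
    by move=> j; exact/unipZ/unip_taylor.
  by congr malcev_fun; apply/funext => g; rewrite -(newton_killed g k 1 fm) !mulg1.
rewrite (malcev_pow gen) //.
rewrite (eq_bigr (fun=> D f)) => [|i _]; first by rewrite sumr_const card_ord mulr_natl.
by congr malcev_fun; apply/funext => x; rewrite !expg1n mul1g mulg1.
Qed.

Lemma log_expg f x k : unip f -> log (x ^+ k)%g f = k%:R * log x f.
Proof.
move=> uf; rewrite !logE // -slope_dilate; last exact: unip_polynomial.
by congr slope; apply/funext => j; rewrite expgM.
Qed.

Lemma unip_conj f z : unip f -> unip (fun y => f (z * y * z^-1)%g).
Proof. by move=> uf; have := unip_transr z^-1%g uf => /(unip_trans z). Qed.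

Lemma conjugated_log f x z : unip f -> conjugated (log x) f z = log (z * x * z^-1)%g f.
Proof.
move=> uf; rewrite -[(z * x * z^-1)%g]/(conj_by z x) -log_map malcev_mapE //.
Qed.

Section InvariantFunction.
Variable f : Gamma -> rat.
Hypothesis uf : unip f.
Hypothesis f_inv : forall u, u \in us -> forall E, (lie (log u) E : malcev Gamma) f = 0.

Let h (g : Gamma) : rat := log g f.
Let uh : unip h. Proof. exact: unip_log. Qed.

(** Along the powers of [u] the slope at [t] is the value at [f] of the bracket of [log u] with
    Ad(u^t) E, which is 0 by [f_inv]. *)
Lemma conjugated_const u E : u \in us -> conjugated E f u = conjugated E f 1%g.
Proof.
move=> uus.
have := @slope_shift_const rat (fun k => conjugated E f (u ^+ k)%g) _ _ 1.
rewrite expg1 expg0; apply.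
  by apply: unip_polynomial; have [] := lie_conjugated gen E E uf.
move=> t; pose E' := malcev_map (conj_by (u ^+ t)%g : {multiplicative Gamma -> Gamma}) E.
have [uc elie] := lie_conjugated gen (log u) E' uf.
rewrite -(f_inv uus E') -elie logE //; congr slope; apply/funext => k.
rewrite /conjugated malcev_mapE; last exact: unip_conj.
by congr malcev_fun; apply/funext => y; rewrite /= /conj_by addnC expgnDr invgM !mulgA.
Qed.

(** Taking E to be the logarithm of a conjugate of [x] in [conjugated_const] gives invariance in [z]
    under each generator, so [h] is a class function. *)
Lemma log_conj z x : h (z * x * z^-1)%g = h x.
Proof.
have := gen (f := fun z => h (z * x * z^-1)%g) _ z.
rewrite !mul1g invg1 mulg1; apply => u uus y.
have := conjugated_const (log (y * x * y^-1)%g) uus.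
by rewrite !conjugated_log // mul1g invg1 mulg1 /h invgM !mulgA.
Qed.

Lemma log_swap p q : h (p * q)%g = h (q * p)%g.
Proof. by rewrite -(log_conj q (p * q)%g) !mulgA mulgK. Qed.

Lemma log_log b : log b h = h b.
Proof.
rewrite logE // -[RHS]slope_linear; congr slope; apply/funext => k.
exact: log_expg.
Qed.

(* Differentiating h ((x a^t)^k) = k h (x a^t) at x = 1 along b shows that
   t |-> log b (x |-> h (x a^t)) takes the same value at t and k t. *)
Lemma log_transr a b : log b (fun x => h (x * a)%g) = h b.
Proof.
pose g t := log b (fun x => h (x * a ^+ t)%g).
have gk k : g k.+1 = g 1%N.
  have := malcev_pow gen (log b) a k.+1 uh.
  have -> : (fun x => h ((x * a) ^+ k.+1)%g) = fun x => k.+1%:R * h (x * a)%g.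
    by apply/funext => x; exact: log_expg.
  rewrite malcevZ; last exact: unip_transr.
  rewrite (eq_bigr (fun=> g k.+1)) => [|i _]; last first.
    congr malcev_fun; apply/funext => x.
    by rewrite -mulgA [in LHS]log_swap -mulgA -expgnDr subnK // ltnW.
  have nz : k.+1%:R != 0 :> rat by rewrite Num.Theory.pnatr_eq0.
  by rewrite sumr_const card_ord -[g _ *+ _]mulr_natl /g expg1 => /(mulfI nz) ->.
have := @polynomial_const_pos rat g _ gk; rewrite /g expg0 expg1 => <-.
  by under eq_fun do rewrite mulg1; exact: log_log.
exact: (unip_polynomial _ (unip_malcevr gen (log b) uh)).
Qed.

(** By [log_transr] the polynomial sequence [h (b ^+ k * a) - k%:R * h b] has slope 0 at every
    shift, hence is constant; it is compared at 0 and 1. *)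
Lemma log_additive b a : h (b * a)%g = h b + h a.
Proof.
have pol : polynomial_seq (fun k => h (b ^+ k * a)%g).
  exact: (unip_polynomial _ (unip_transr a uh)).
have pol1 c : polynomial_seq (fun k => - (k%:R * c) : rat).
  by exists (- (c *: 'X)) => k; rewrite hornerN hornerZ hornerX mulrC.
have := @slope_shift_const rat (fun k => h (b ^+ k * a)%g - k%:R * h b) _ _ 1.
rewrite expg1 expg0 mul1g mul0r subr0 mul1r => <-; first by rewrite addrC subrK.
  exact: (polynomialD pol (pol1 (h b))).
move=> t; rewrite slopeD.
- have -> : (fun k => h (b ^+ (t + k) * a)%g) = fun k => h (b ^+ k * (b ^+ t * a))%g.
    by apply/funext => k; rewrite addnC expgnDr mulgA.
  rewrite -(logE _ (unip_transr (b ^+ t * a)%g uh)) log_transr.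
  under eq_fun do rewrite natrD mulrDl opprD.
  rewrite slopeD ?slope_cst //; last exact: polynomial_cst.
  under eq_fun do rewrite -mulrN.
  by rewrite slope_linear add0r subrr.
- exact: (polynomial_shift t pol).
- exact: (polynomial_shift t (pol1 (h b))).
Qed.

Lemma invariant_is_additive : exists2 chi : Gamma -> rat,
  unip chi /\ (forall x y, chi (x * y)%g = chi x + chi y) & forall D, D f = D chi.
Proof.
by exists h => [|D]; [split=> //; exact: log_additive | rewrite malcev_log].
Qed.
End InvariantFunction.

(* Every D killing the additive functions is a sum of brackets with the logarithms of
   the generators: this is the transpose of the previous lemma, which says that a
   function pairing to 0 with all these brackets pairs with D like an additive one. *)
Lemma malcev_commutator D :
  (forall chi, unip chi -> (forall x y, chi (x * y)%g = chi x + chi y) -> D chi = 0) ->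
  lcs 1 D.
Proof.
move=> Dadd.
pose I := 'I_(size us).
pose u (i : I) := tnth (in_tuple us) i.
pose V := I -> Gamma -> rat^o.
pose T (i : I) f : Gamma -> rat := fun z =>
  log (u i) (fun x => f (x * z)%g) - log (u i) (fun x => f (z * x)%g).
have uT i f : unip f -> unip (T i f).
  by move=> uf; apply: unipB; [exact: (unip_malcevr gen) | exact: unip_malcev].
have TE i f E : unip f -> E (T i f) = (lie (log (u i)) E : malcev Gamma) f.
  move=> uf; rewrite malcev_lieE // malcevB; last exact: unip_malcev.
    by rewrite /conv (malcev_exchange gen).
  exact: (unip_malcevr gen).
(* Null functions are put into the graph so that the extended functional kills them. One of them is
   [g k - g(1) k - k(1) g], whence the Leibniz rule for each component of the functional. *)
pose null (b : Gamma -> rat) := unip b /\ forall E, E b = 0.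
pose G : set (V * rat) := [set p | exists f b, [/\ unip f, forall i, null (b i),
  p.1 = (fun i z => T i f z + b i z) & p.2 = D f]]%classic.
have GG : functional_graph G.
  split.
  - exists (fun=> 0), (fun=> fun=> 0); split=> [|i||].
    + exact: unip_cst.
    + by split=> [|E]; [exact: unip_cst | rewrite malcev_cst].
    + by apply/funext => i; apply/funext => z; rewrite /T /= !malcev_cst.
    + by rewrite malcev_cst.
  - move=> a [_ _] [_ _] [f [b [uf nb /= -> ->]]] [g [c [ug nc /= -> ->]]].
    exists (fun x => a * f x + g x), (fun i x => a * b i x + c i x); split=> /=.
    + by apply: unipD => //; exact: unipZ.
    + move=> i; have [[ub b0] [uc c0]] := (nb i, nc i).
      split=> [|E]; first by apply: unipD => //; exact: unipZ.
      by rewrite malcevD ?malcevZ ?b0 ?c0 ?mulr0 ?addr0 //; exact: unipZ.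
    + apply/funext => i; apply/funext => z; rewrite /T.
      rewrite !malcevD ?malcevZ //; try exact/unipZ/unip_trans; try exact/unip_trans;
        try exact/unipZ/unip_transr; try exact/unip_transr.
      rewrite -[LHS]/(a * (log (u i) (fun x => f (x * z)%g) - log (u i) (fun x => f (z * x)%g) + b i z)
        + (log (u i) (fun x => g (x * z)%g) - log (u i) (fun x => g (z * x)%g) + c i z)).
      by ring.
    + by rewrite malcevD ?malcevZ //; exact: unipZ.
  (* The graph is single-valued: if all [T i f] are null, every bracket with a [log (u i)] kills
     [f], so [D] agrees on [f] with its value on an additive function, which is 0. *)
  - move=> c [f [b [uf nb /= e0 ->]]].
    have f_inv v : v \in us -> forall E, (lie (log v) E : malcev Gamma) f = 0.
      move=> /(tnthP (in_tuple us))[i ->] E; have [ub b0] := nb i.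
      rewrite -TE //; have := congr1 (fun w : V => E (w i)) e0.
      rewrite malcevD ?b0 ?addr0 //; last exact: uT.
      by rewrite malcev_cst.
    have [chi [uchi addchi] ->] := invariant_is_additive uf f_inv.
    exact: Dadd.
have [phi phiG] := functional_extension GG.
pose single i (g : Gamma -> rat) : V := fun j z => if j == i then g z else 0.
have phi_null i b : null b -> phi (single i b) = 0.
  move=> [ub b0]; apply: phiG; exists (fun=> 0), (fun j => single i b j); split=> /=.
  - exact: unip_cst.
  - move=> j; rewrite /single; case: eqP => _; first by split.
    by split=> [|E]; [exact: unip_cst | rewrite malcev_cst].
  - apply/funext => j; apply/funext => z; rewrite /T /= !malcev_cst subrr.
    by rewrite add0r.
  - by rewrite malcev_cst.
have singleL i : linear (single i : (Gamma -> rat^o) -> V).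
  move=> a g1 g2; apply/funext => j; apply/funext => z.
  rewrite /single -[RHS]/(a * (if j == i then g1 z else 0) + (if j == i then g2 z else 0)).
  by case: eqP => _ //; rewrite mulr0 addr0.
(* The component of index [i] of the extended functional; its pairing with [T i f] is the bracket of
   [log (u i)] with it, evaluated at [f]. *)
pose Ef i (g : Gamma -> rat) : rat^o := if `[< unip g >] then phi (single i g) else 0.
have EfE i g : unip g -> Ef i g = phi (single i g) by move=> ug; rewrite /Ef asboolT.
have EfL i a g1 g2 : phi (single i (fun x => a * g1 x + g2 x)) =
    a * phi (single i g1) + phi (single i g2).
  by rewrite -[X in single i X]/(a *: (g1 : Gamma -> rat^o) + g2) singleL linearP.
have phi0 i : phi (single i (fun=> 0)) = 0.
  by apply: phi_null; split=> [|E]; [exact: unip_cst | rewrite malcev_cst].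
have Ef_tangent i : tangent (Ef i).
  apply/asboolP; split=> [g ng|g k ug uk|c g ug|g k ug uk].
  - by rewrite /Ef asboolF.
  - rewrite !EfE //; last exact: unipD.
    have := EfL i 1 g k; under eq_fun do rewrite mul1r.
    by rewrite mul1r.
  - rewrite !EfE //; last exact: unipZ.
    have := EfL i c g (fun=> 0); under eq_fun do rewrite addr0.
    by move=> ->; rewrite phi0 addr0.
  - rewrite !EfE //; last exact: unipM.
    pose n x := g x * k x - (g 1%g * k x + k 1%g * g x).
    have nn : null n.
      have um := unipM ug uk; have ul := unipD (unipZ (g 1%g) uk) (unipZ (k 1%g) ug).
      split=> [|E]; first exact: unipB.
      rewrite /n malcevB // malcevM // malcevD ?malcevZ //; try exact: unipZ.
      by rewrite [E g * _]mulrC subrr.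
    have -> : (fun x => g x * k x) = (fun x => 1 * n x + (g 1%g * k x + k 1%g * g x)).
      by apply/funext => x; rewrite /n mul1r subrK.
    rewrite EfL (phi_null _ _ nn) mulr0 add0r EfL.
    have := EfL i (k 1%g) g (fun=> 0); under eq_fun do rewrite addr0.
    by move=> ->; rewrite phi0 addr0 [k 1%g * _]mulrC.
pose E i : malcev Gamma := exist _ (Ef i) (Ef_tangent i).
exists [seq (log (u i), E i) | i <- enum I]; split=> //.
rewrite big_map big_enum /=; apply: malcevP => f uf.
have sumE (s : seq I) : (\sum_(i <- s) lie (log (u i)) (E i) : malcev Gamma) f =
    \sum_(i <- s) E i (T i f).
  elim: s => [|i s IH]; first by rewrite !big_nil.
  by rewrite !big_cons TE // -IH.
rewrite sumE -[LHS](phiG (fun i => T i f)); last first.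
  exists f, (fun=> fun=> 0); split=> //=.
    by move=> i; split=> [|E0]; [exact: unip_cst | rewrite malcev_cst].
  by apply/funext => i; apply/funext => z; rewrite addr0.
transitivity (\sum_(i : I) phi (single i (T i f))); last first.
  by apply: eq_bigr => i _; rewrite -EfE //; exact: uT.
rewrite -linear_sum; congr (phi _); apply/funext => j; apply/funext => z.
transitivity (\sum_i single i (T i f) j z).
  rewrite (bigD1 j) //= /single eqxx big1 ?addr0 // => i ij.
  by rewrite eq_sym (negPf ij).
by elim/big_rec2: _ => // i y x _ ->.
Qed.
End LogFunction.

(** * The pure elliptic braid group *)

Section PureGenerators.
Variable n : nat.
Local Open Scope group_scope.
Local Notation B := (ell_braid n).
Local Notation gX e := (ell_X n e).

Definition ell_sigma (k : nat) : B := geval (pres_gen (@ell_rel n)) (sig n true k).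
Local Notation s := ell_sigma.

Lemma ell_sigma_gen (i : 'I_n.-1) : s i = pres_gen _ (EllSigma i).
Proof.
by rewrite /ell_sigma /sig insubT ?ltn_ord // => iN /=; congr (pres_gen _ (EllSigma _)); exact: val_inj.
Qed.

Lemma ell_sigma_sys : ell_sys n s (gX true) (gX false).
Proof. exact: ell_braid_sys. Qed.

Lemma ell_braid_ind (P : B -> Prop) : P 1 -> (forall k, (k < n.-1)%N -> P (s k)) ->
  (forall e, P (gX e)) -> (forall x y, P x -> P y -> P (x * y)) -> (forall x, P x -> P x^-1) ->
  forall x, P x.
Proof.
move=> P1 Ps PX PM PV; elim/pres_ind => t; rewrite -geval_pres_gen.
elim: t => [[i|e]||u Pu v Pv|u Pu] //=; [|exact: PX|exact: PM|exact: PV].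
by rewrite -ell_sigma_gen; exact: Ps.
Qed.

Definition B3_fixed (g : B) : Prop := forall b, gaut_fun (B3_ell_braid n b) g = g.

Lemma B3_fixedP (g : B) :
  (forall e : bool, gaut_fun (if e then ell_plus n else ell_minus n) g = g) -> B3_fixed g.
Proof.
move=> H; elim/pres_ind => t; rewrite -geval_pres_gen.
rewrite (morph_geval _ _ (h := B3_ell_braid n)); last exact: gmulfM.
elim: t => [e||u IHu v IHv|u IHu] //=.
- by rewrite pres_lift_gen; exact: H.
- exact: etrans (congr1 _ IHv) IHu.
- set f := geval _ u in IHu *.
  by rewrite -[in LHS]IHu; exact: (bijK (val f)).
Qed.

Lemma B3_fixed_sigma k : B3_fixed (s k).
Proof.
have fix1 e i : gaut_fun (if e then ell_plus n else ell_minus n) (pres_gen _ (EllSigma i)) =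
    pres_gen _ (EllSigma i) by case: e; exact: pres_aut_gen.
apply: B3_fixedP => e; rewrite /ell_sigma /sig; case: insubP => [i _ _|_] /=.
  exact: fix1.
exact: gmulf1'.
Qed.

Lemma B3_fixedM g h : B3_fixed g -> B3_fixed h -> B3_fixed (g * h).
Proof. by move=> gF hF b; rewrite gmulfM gF hF. Qed.
Lemma B3_fixedV g : B3_fixed g -> B3_fixed g^-1.
Proof. by move=> gF b; rewrite gmulfV' gF. Qed.
Lemma B3_fixed1 : B3_fixed 1.
Proof. by move=> b; exact: gmulf1'. Qed.

Inductive conjX : B -> Prop :=
  | ConjXGen g e : B3_fixed g -> conjX (g * gX e * g^-1)
  | ConjX1 : conjX 1
  | ConjXM x y : conjX x -> conjX y -> conjX (x * y)
  | ConjXV x : conjX x -> conjX x^-1.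

(** Conjugation by a [B3_fixed] element permutes the generators, and conjugation by [X_1^+] or
    [X_1^-] is inner; the sigmas and these two generate the group. *)
Lemma conjX_normal b x : conjX x -> conjX (b * x * b^-1).
Proof.
(* Both directions are carried along, so that the induction on [b] passes through inverses. *)
suff H : (forall x, conjX x -> conjX (b * x * b^-1)) /\ (forall x, conjX x -> conjX (b^-1 * x * b)).
  by case: H => H _; exact: H.
have fixN g y : B3_fixed g -> conjX y -> conjX (g * y * g^-1).
  move=> gF; elim=> [h e hF||u v _ Hu _ Hv|u _ Hu].
  - have -> : g * (h * gX e * h^-1) * g^-1 = (g * h) * gX e * (g * h)^-1.
      by rewrite invgM !mulgA.
    exact/ConjXGen/B3_fixedM.
  - by rewrite mulg1 mulgV; exact: ConjX1.
  - have -> : g * (u * v) * g^-1 = (g * u * g^-1) * (g * v * g^-1).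
      by rewrite !mulgA mulgVK.
    exact: ConjXM.
  - have -> : g * u^-1 * g^-1 = (g * u * g^-1)^-1 by rewrite !invgM invgK mulgA.
    exact: ConjXV.
have XN e : conjX (gX e).
  by have := ConjXGen e B3_fixed1; rewrite mul1g invg1 mulg1.
elim/ell_braid_ind: b {x} => [|k _|e|a b [aN aV] [bN bV]|b [bN bV]].
- by split=> x xN; rewrite invg1 mul1g mulg1.
- split=> x xN; first exact/fixN/xN/B3_fixed_sigma.
  by have := fixN (s k)^-1 x (B3_fixedV (B3_fixed_sigma k)) xN; rewrite invgK.
- by split=> x xN; do ?[apply: ConjXM | apply: ConjXV] => //; exact: XN.
- split=> x xN; rewrite invgM.
    by have := aN _ (bN _ xN); rewrite !mulgA.
  by have := bV _ (aV _ xN); rewrite !mulgA.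
- by split=> x xN; rewrite ?invgK; [exact: bV | exact: bN].
Qed.

Lemma conjX_perm x : conjX x -> ell_perm n x = 1.
Proof.
elim=> [g e _||u v _ Hu _ Hv|u _ Hu].
- have XE : ell_perm n (gX e) = 1 by exact: pres_lift_gen.
  by rewrite !gmulfM gmulfV' XE mulg1 mulgV.
- exact: gmulf1'.
- by rewrite gmulfM Hu Hv mulg1.
- by rewrite gmulfV' Hu invg1.
Qed.

Definition congX (x y : B) : Prop := conjX (x * y^-1).

Lemma congX_refl x : congX x x.
Proof. by rewrite /congX mulgV; exact: ConjX1. Qed.
Lemma congX_trans x y z : congX x y -> congX y z -> congX x z.
Proof. by move=> xy yz; have := ConjXM xy yz; rewrite mulgA mulgVK. Qed.
Lemma congX_mul x x' y y' : congX x x' -> congX y y' -> congX (x * y) (x' * y').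
Proof.
move=> xx' yy'; have := ConjXM (conjX_normal x yy') xx'.
by rewrite /congX invgM !mulgA mulgVK.
Qed.
Lemma congX_inv x x' : congX x x' -> congX x^-1 x'^-1.
Proof.
move=> /ConjXV/(conjX_normal x^-1); rewrite /congX invgM !invgK => H.
by have := H; rewrite -!mulgA mulVg mulg1.
Qed.

(** For [k = 0] the relation [EllPure] writes the square as [X_1^-] times a conjugate of its
    inverse; afterwards the braid relation makes each square a conjugate of the previous one. *)
Lemma sigma_sq k : (k < n.-1)%N -> congX (s k * s k) 1.
Proof.
have [[br _] _ _ pureR] := ell_sigma_sys.
elim: k => [|k IH] kN.
  rewrite /congX invg1 mulg1 -pureR; last by lia.
  set u := chain _ _ _; have XN e : conjX (gX e).
    by have := ConjXGen e B3_fixed1; rewrite mul1g invg1 mulg1.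
  rewrite -2!mulgA; apply: ConjXM; first exact: XN.
  have := conjX_normal u^-1 (ConjXV (XN false)).
  by rewrite invgK !mulgA.
have e : s k.+1 * s k.+1 = (s k * s k.+1) * (s k * s k) * (s k * s k.+1)^-1.
  apply: (mulIg (s k * s k.+1)); rewrite mulgVK.
  have b := br k kN.
  transitivity (s k.+1 * (s k.+1 * s k * s k.+1)); first by rewrite !mulgA.
  by rewrite -b !mulgA -b.
rewrite /congX invg1 mulg1 e; apply: conjX_normal.
by have := IH (ltnW kN); rewrite /congX invg1 mulg1.
Qed.

(* sigma_m sigma_(m-1) ... sigma_(m-d+1) *)
Fixpoint descent (m d : nat) : B := if d is d'.+1 then descent m d' * s (m - d') else 1.

Lemma descent_comm m d i : (m < n.-1)%N -> (i + d < m)%N ->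
  descent m d * s i = s i * descent m d.
Proof.
have [[_ far] _ _ _] := ell_sigma_sys.
move=> mN; elim: d => [|d IH] id /=; first by rewrite mul1g mulg1.
rewrite -mulgA -far; last by lia.
by rewrite mulgA IH; [rewrite mulgA | lia].
Qed.

Lemma descent_shift m d i : (m < n.-1)%N -> (i.+1 <= m)%N -> (d <= m.+1)%N -> (m < i + d)%N ->
  descent m d * s i.+1 = s i * descent m d.
Proof.
have [[br far] _ _ _] := ell_sigma_sys.
move=> mN im; elim: d => [|d IH] dm id; first by lia.
have [id'|id'] := ltnP m (i + d).
  rewrite /= -mulgA far; last by lia.
  by rewrite mulgA IH ?mulgA //; lia.
case: d IH dm id id' => [|d] IH dm id id'; first by lia.
have e1 : (m - d = i.+1)%N by lia.
have e2 : (m - d.+1 = i)%N by lia.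
rewrite /= e1 e2 -!mulgA [s i.+1 * _]mulgA -br; last by lia.
by rewrite !mulgA descent_comm //; lia.
Qed.

Lemma descent_next m d : descent m d * s (m - d) = descent m d.+1.
Proof. by []. Qed.

Fixpoint sigma_word (w : seq nat) : B := if w is k :: w' then s k * sigma_word w' else 1.

Lemma sigma_word_cat w w' : sigma_word (w ++ w') = sigma_word w * sigma_word w'.
Proof. by elim: w => [|k w IH] /=; rewrite ?mul1g // IH mulgA. Qed.
Lemma sigma_word_rcons w k : sigma_word (rcons w k) = sigma_word w * s k.
Proof. by rewrite -cats1 sigma_word_cat /= mulg1. Qed.

(** The descents represent the cosets of the subgroup generated by the letters below [m]. A letter
    [i] appended to [descent m d] commutes past it if i < m - d, lengthens it if i = m - d, cancels
    its last letter modulo [conjX] if i = m - d + 1, and otherwise passes through it as [i - 1]. *)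
Lemma sigma_normal_form m w : (m < n.-1)%N -> all (ltn^~ m.+1) w ->
  exists w' d, [/\ all (ltn^~ m) w', (d <= m.+1)%N
    & congX (sigma_word w) (sigma_word w' * descent m d)].
Proof.
move=> mN; elim/last_ind: w => [|w i IH].
  by exists [::], 0%N; split=> //=; rewrite mulg1; exact: congX_refl.
rewrite all_rcons => /andP[im /IH[w' [d [w'm dm ww']]]] {IH}.
rewrite sigma_word_rcons; have /= {}im : (i < m.+1)%N := im.
have ws u : congX (sigma_word w' * descent m d * s i) u -> congX (sigma_word w * s i) u.
  by apply: congX_trans; exact: congX_mul (congX_refl _).
have [id|id] := ltnP (i + d) m.
  exists (rcons w' i), d; split=> //; first by rewrite all_rcons /= w'm andbT; lia.
  apply: ws; rewrite sigma_word_rcons -!mulgA descent_comm //; exact: congX_refl.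
have [id'|id'] := leqP (i + d) m.
  exists w', d.+1; split=> //; first by lia.
  apply: ws; rewrite -descent_next (_ : m - d = i)%N; last by lia.
  by rewrite !mulgA; exact: congX_refl.
have [id''|id''] := ltnP m.+1 (i + d).
  case: i im {id id'} ws id'' => [|i] im ws id''; first by lia.
  exists (rcons w' i), d; split=> //; first by rewrite all_rcons /= w'm andbT; lia.
  apply: ws; rewrite sigma_word_rcons -!mulgA descent_shift //; try by lia.
  exact: congX_refl.
case: d dm ww' ws {id} id' id'' => [|d] dm ww' ws id' id''; first by lia.
exists w', d; split=> //; first by lia.
apply: ws; rewrite /= (_ : m - d = i)%N; last by lia.
rewrite -!mulgA; apply: congX_mul; first exact: congX_refl.
rewrite -[X in congX _ X]mulg1; apply: congX_mul; first exact: congX_refl.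
by apply: sigma_sq; lia.
Qed.

Lemma ell_perm_sigma k (k1 : (k < n)%N) (k2 : (k.+1 < n)%N) :
  ell_perm n (s k) = tperm (Ordinal k1) (Ordinal k2).
Proof.
have kN : (k < n.-1)%N by lia.
rewrite -[k]/(val (Ordinal kN)) ell_sigma_gen /ell_perm [LHS]pres_lift_gen /=.
by congr tperm; exact: val_inj.
Qed.

Lemma ell_perm_sigma_fix k (p : 'I_n) : (k < n.-1)%N -> (k.+1 < p)%N -> ell_perm n (s k) p = p.
Proof.
move=> kN kp; have k2 : (k.+1 < n)%N by lia.
rewrite (ell_perm_sigma (ltnW k2) k2) tpermD // -val_eqE /= neq_ltn ?kp //.
by rewrite (ltnW kp).
Qed.

Lemma ell_perm_word m w (p : 'I_n) : (m <= n.-1)%N -> all (ltn^~ m) w -> (m < p)%N ->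
  ell_perm n (sigma_word w) p = p.
Proof.
move=> mN + mp; elim: w => [|k w IH] /=; first by rewrite gmulf1' perm1.
move=> /andP[km /IH Hw]; rewrite gmulfM permM.
by rewrite ell_perm_sigma_fix //; have {}km : (k < m)%N := km; lia.
Qed.

(** The point [m.+1], fixed by all words in letters below [m], thus recovers [d] from the
    permutation. *)
Lemma ell_perm_descent m d (p : 'I_n) : (m < n.-1)%N -> (d <= m.+1)%N -> p = m.+1 :> nat ->
  ell_perm n (descent m d) p = (m.+1 - d)%N :> nat.
Proof.
move=> mN; elim: d => [|d IH] dm pm /=; first by rewrite gmulf1' perm1 subn0.
have k2 : ((m - d).+1 < n)%N by lia.
rewrite gmulfM permM (ell_perm_sigma (ltnW k2) k2).
have -> : ell_perm n (descent m d) p = Ordinal k2.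
  by apply: val_inj; rewrite /= IH //; lia.
by rewrite tpermR /=; lia.
Qed.

(* Coxeter normal forms: modulo conjX the sigma_k satisfy the Coxeter relations, so a
   word in them is determined by its permutation. *)
Lemma sigma_word_pure m w : (m <= n.-1)%N -> all (ltn^~ m) w ->
  ell_perm n (sigma_word w) = 1 -> conjX (sigma_word w).
Proof.
elim: m w => [|m IH] w mN wm w1.
  by case: w wm {w1} => [_|k w /andP[]//]; exact: ConjX1.
have [w' [d [w'm dm ww']]] := sigma_normal_form mN wm.
have e1 : ell_perm n (sigma_word w' * descent m d) = 1.
  have := conjX_perm ww'; rewrite gmulfM gmulfV' w1 mul1g => /(congr1 (fun x => x^-1)).
  by rewrite invgK invg1.
have mp : (m.+1 < n)%N by lia.
have d0 : d = 0%N.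
  have := congr1 (fun u : 'S_n => nat_of_ord (u (Ordinal mp))) e1; rewrite gmulfM permM perm1.
  rewrite (ell_perm_word (m := m)) //; last by lia.
  by rewrite ell_perm_descent //=; lia.
move: e1 ww'; rewrite d0 /= mulg1 => e1 ww'.
have := ConjXM ww' (IH w' (ltnW mN) w'm e1).
by rewrite mulgVK.
Qed.

Lemma congX_word b : exists2 w, all (ltn^~ n.-1) w & congX b (sigma_word w).
Proof.
elim/ell_braid_ind: b => [|k kN|e|x y [u uN xu] [v vN yv]|x [u uN xu]].
- by exists [::] => //; exact: congX_refl.
- by exists [:: k]; rewrite /= ?kN // mulg1; exact: congX_refl.
- exists [::] => //; rewrite /congX /= invg1 mulg1.
  by have := ConjXGen e B3_fixed1; rewrite mul1g invg1 mulg1.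
- exists (u ++ v); first by rewrite all_cat uN vN.
  by rewrite sigma_word_cat; exact: congX_mul.
- exists (rev u); first by rewrite all_rev.
  apply: congX_trans (congX_inv xu) _; elim: u uN {xu} => [|k u IH] /=.
    by rewrite invg1 => _; exact: congX_refl.
  move=> /andP[kN /IH uu]; rewrite invgM rev_cons sigma_word_rcons.
  apply: congX_mul => //; have := congX_inv (sigma_sq kN).
  by rewrite /congX !invgM !invg1 !mulg1.
Qed.

Lemma pure_conjX b : ell_perm n b = 1 -> conjX b.
Proof.
move=> b1; have [w wN bw] := congX_word b.
have w1 : ell_perm n (sigma_word w) = 1.
  have := conjX_perm bw; rewrite gmulfM gmulfV' b1 mul1g => /(congr1 (fun x => x^-1)).
  by rewrite invgK invg1.
have := ConjXM bw (sigma_word_pure (leqnn _) wN w1).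
by rewrite mulgVK.
Qed.
End PureGenerators.

(* Schreier: a transversal of the kernel of ell_perm yields finitely many generators. *)
Section Schreier.
Variable n : nat.
Local Open Scope group_scope.
Local Notation B := (ell_braid n).

Definition perm_section (p : 'S_n) : B :=
  if pselect (exists b, ell_perm n b = p) is left e then projT1 (cid e) else 1.

Lemma perm_sectionP b : ell_perm n (perm_section (ell_perm n b)) = ell_perm n b.
Proof.
rewrite /perm_section; case: pselect => [e|[]]; last by exists b.
by case: cid.
Qed.

Definition schreier (p : 'S_n) (b : B) : B :=
  perm_section p * b * (perm_section (p * ell_perm n b))^-1.

Lemma schreier_pure a b : ell_pure_pred (schreier (ell_perm n a) b).
Proof.
have E (u v : B) : ell_perm n (u * b * v^-1) = ell_perm n u * ell_perm n b * (ell_perm n v)^-1.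
  by rewrite !gmulfM gmulfV'.
by apply/eqP; rewrite /schreier -gmulfM E !perm_sectionP gmulfM mulgV.
Qed.

Definition ell_letters : seq B :=
  ell_X n true :: ell_X n false :: [seq ell_sigma n k | k <- iota 0 n.-1].

(** The default 1 of [insubd] can only occur for a [p] outside the image of [ell_perm], by
    [schreier_pure]. *)
Definition schreier_generators : seq (ell_pure n) :=
  [seq insubd (1 : ell_pure n) (schreier p b) | p <- enum [set: 'S_n], b <- ell_letters].

Lemma ell_pure_generated : generated_by schreier_generators.
Proof.
move=> f f_inv.
pose H (x : B) := exists2 p : ell_pure n, val p = x & forall y, f (p * y) = f y.
have H1 : H 1 by exists 1 => // y; rewrite mul1g.
have HM x y : H x -> H y -> H (x * y).
  by move=> [p <- pf] [q <- qf]; exists (p * q) => // z; rewrite -mulgA pf qf.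
have HV x : H x -> H x^-1.
  by move=> [p <- pf]; exists p^-1 => // z; rewrite -[LHS]pf mulgA mulgV mul1g.
have Hgen a b : b \in ell_letters -> H (schreier (ell_perm n a) b).
  move=> bl; pose q := insubd (1 : ell_pure n) (schreier (ell_perm n a) b).
  exists q => [|y]; first by rewrite insubdK //; exact: schreier_pure.
  apply: f_inv; apply/allpairsP; exists (ell_perm n a, b).
  by rewrite mem_enum inE.
have Hall b a : H (schreier (ell_perm n a) b).
  elim/ell_braid_ind: b a => [|k kN|e|x y Hx Hy|x Hx] a.
  - by rewrite /schreier gmulf1' !mulg1 mulgV.
  - by apply: Hgen; rewrite !inE map_f ?orbT // mem_iota.
  - by apply: Hgen; rewrite !inE; case: e; rewrite eqxx ?orbT.
  - have -> : schreier (ell_perm n a) (x * y) =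
        schreier (ell_perm n a) x * schreier (ell_perm n (a * x)) y.
      by rewrite /schreier !gmulfM !mulgA mulgVK.
    exact: HM.
  - have -> : schreier (ell_perm n a) x^-1 = (schreier (ell_perm n (a * x^-1)) x)^-1.
      by rewrite /schreier !gmulfM gmulfV' mulgVK !invgM invgK !mulgA.
    exact: HV.
move=> y; rewrite -[y in LHS]mulg1.
(* The section at 1 is some pure element, possibly different from 1. Only conjugates by it are
   reached at first; the element [y] is then obtained from [t^-1 * y * t]. *)
have ty (z : ell_pure n) : H (perm_section 1 * val z * (perm_section 1)^-1).
  have := Hall (val z) 1; rewrite /schreier gmulf1' mul1g.
  by have /eqP -> := valP z.
have t1 : ell_perm n (perm_section 1) = 1.
  by have := perm_sectionP (1 : B); rewrite gmulf1'.
have tP : ell_pure_pred (perm_section 1) by apply/eqP.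
pose t : ell_pure n := exist (fun x => ell_pure_pred x) _ tP.
have [p ep pf] := ty (t^-1 * y * t).
have -> : y = p; last exact: pf.
by apply: val_inj; rewrite ep /= !mulgA mulgV mul1g mulgK.
Qed.
End Schreier.

(* Forgetting all but two marked strands, at positions p and q: the state (p, q, w)
   records the positions and the loop w of the first marked strand around the second. *)
Section Retraction.
Variable n : nat.
Local Open Scope group_scope.
Local Notation X := F2_X.
Local Notation Y := F2_Y.
Definition strand_state : Type := (nat * nat * F2)%type.

Definition swap (k p : nat) : nat := if p == k then k.+1 else if p == k.+1 then k else p.

Lemma swapK k : involutive (swap k).
Proof. by move=> p; rewrite /swap; do ![case: eqP => //=]; lia. Qed.

(** The two factors are adjusted to [EllPure]: a full twist starting from positions 0 and 1
    multiplies the loop by Y X Y^-1 X^-1, which is also the effect of the left-hand side of that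
    relation. *)
Definition cross (k p q : nat) : F2 :=
  if (p == k) && (q == k.+1) then Y^-1 * X^-1
  else if (p == k.+1) && (q == k) then Y * X else 1.

(** Only the relative motion counts, so moving the second marked strand gives [z^-1]. Coinciding or
    out-of-range positions are left alone, which lets the relations hold on all states. *)
Definition turn (z : F2) (p q : nat) : F2 :=
  if [|| p == q, n <= p | n <= q]%N then 1
  else if p == 0%N then z else if q == 0%N then z^-1 else 1.

Definition strand_sigma_fun (k : nat) (u : strand_state) : strand_state :=
  (swap k u.1.1, swap k u.1.2, cross k u.1.1 u.1.2 * u.2).
Definition strand_sigma_inv (k : nat) (u : strand_state) : strand_state :=
  (swap k u.1.1, swap k u.1.2, (cross k (swap k u.1.1) (swap k u.1.2))^-1 * u.2).

Fact strand_sigmaK k : cancel (strand_sigma_fun k) (strand_sigma_inv k).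
Proof. by case=> -[p q] w; rewrite /strand_sigma_inv /= !swapK mulVT. Qed.
Fact strand_sigmaKV k : cancel (strand_sigma_inv k) (strand_sigma_fun k).
Proof. by case=> -[p q] w; rewrite /strand_sigma_fun /= !swapK mulTV. Qed.
Definition strand_sigma k : Defs.bij strand_state := Defs.Bij (@strand_sigmaK k) (@strand_sigmaKV k).

Definition strand_turn_fun (z : F2) (u : strand_state) : strand_state := (u.1, turn z u.1.1 u.1.2 * u.2).
Definition strand_turn_inv (z : F2) (u : strand_state) : strand_state := (u.1, (turn z u.1.1 u.1.2)^-1 * u.2).
Fact strand_turnK z : cancel (strand_turn_fun z) (strand_turn_inv z).
Proof. by case=> -[p q] w; rewrite /strand_turn_inv /= mulVT. Qed.
Fact strand_turnKV z : cancel (strand_turn_inv z) (strand_turn_fun z).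
Proof. by case=> -[p q] w; rewrite /strand_turn_fun /= mulTV. Qed.
Definition strand_turn z : Defs.bij strand_state := Defs.Bij (@strand_turnK z) (@strand_turnKV z).

Lemma strand_turnE z p q w : strand_turn z (p, q, w) = (p, q, turn z p q * w).
Proof. by []. Qed.
Lemma strand_turnVE z p q w : (strand_turn z)^-1 (p, q, w) = (p, q, (turn z p q)^-1 * w).
Proof. by []. Qed.

(* X_(k+1)^+ and X_(k+1)^- move the strand at position k. *)
Definition turn_at (z : F2) (k p q : nat) : F2 :=
  if [|| p == q, n <= p | n <= q]%N then 1
  else if p == k then z else if q == k then z^-1 else 1.

Local Ltac compare_with p k := have [?|?] := eqVneq p k; [subst p|].
Local Ltac decide_nat :=
  repeat (match goal with
  | |- context [@eq_op _ ?a ?b] =>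
    first [have -> : (a == b) = true by lia | have -> : (a == b) = false by lia]
  | |- context [(?a <= ?b)%N] =>
    first [have -> : (a <= b)%N = true by lia | have -> : (a <= b)%N = false by lia]
  end; rewrite ?orbT ?orbF /=).
Local Ltac split_nat :=
  repeat (match goal with
  | |- context [(?a <= ?b)%N] => case: (leqP a b) => ?
  | |- context [@eq_op _ ?a ?b] => case: (@eqP _ a b) => ?
  end; rewrite ?orbT ?orbF /=; try lia).
Local Ltac free_group := rewrite ?(mul1g, mulg1, invgM, invgK, invg1) ?mulgA
    ?(mulgK, mulgVK, mulgV, mulVg, mul1g, mulg1, invgM, invgK, invg1, mulgA) //.

Local Ltac place p k := compare_with p k; [|compare_with p k.+1].
Local Ltac strands := decide_nat; split_nat; free_group.

Definition strand_braid (k : nat) : Defs.bij strand_state :=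
  if (k < n.-1)%N then strand_sigma k else 1.

Lemma strand_braidE k p q w : (k < n.-1)%N ->
  strand_braid k (p, q, w) = (swap k p, swap k q, cross k p q * w).
Proof. by rewrite /strand_braid => ->. Qed.
Lemma strand_braidVE k p q w : (k < n.-1)%N -> (strand_braid k)^-1 (p, q, w) =
  (swap k p, swap k q, (cross k (swap k p) (swap k q))^-1 * w).
Proof. by rewrite /strand_braid => ->. Qed.

Lemma chain_strand_plus k p q w : (k < n)%N ->
  chain strand_braid (strand_turn X) k (p, q, w) = (p, q, turn_at X k p q * w).
Proof.
elim: k p q w => [|k IH] p q w kn //.
rewrite [chain _ _ _]/= !bij_mulE strand_braidE ?IH ?strand_braidE; try by lia.
rewrite !swapK; congr (_, _, _).
rewrite !mulgA; congr (_ * _); rewrite /cross /turn_at /swap.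
by place p k; place q k; strands.
Qed.

Lemma chain_strand_minus k p q w : (k < n)%N ->
  chain (fun i => (strand_braid i)^-1) (strand_turn Y) k (p, q, w) =
  (p, q, turn_at Y k p q * w).
Proof.
elim: k p q w => [|k IH] p q w kn //.
rewrite [chain _ _ _]/= !bij_mulE strand_braidVE ?IH ?strand_braidVE; try by lia.
rewrite !swapK; congr (_, _, _).
rewrite !mulgA; congr (_ * _); rewrite /cross /turn_at /swap.
by place p k; place q k; strands.
Qed.

(** The effect of the first [k] factors of the product of the X_i; at [k = n] the contributions [z]
    and [z^-1] of the two marked strands cancel, as [EllProd] demands. *)
Definition turn_below (z : F2) (k p q : nat) : F2 :=
  if [|| p == q, n <= p | n <= q]%N then 1
  else (if (p < k)%N then z else 1) * (if (q < k)%N then z^-1 else 1).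

Lemma turn_belowS z k p q : turn_below z k p q * turn_at z k p q = turn_below z k.+1 p q.
Proof. by rewrite /turn_below /turn_at; compare_with p k; compare_with q k; strands. Qed.

Lemma turn_below_all z p q : turn_below z n p q = 1.
Proof. by rewrite /turn_below; strands. Qed.

Lemma chain_prod_strand (t : nat -> Defs.bij strand_state) (z : F2) :
  (forall k p q w, (k < n)%N ->
    chain t (strand_turn z) k (p, q, w) = (p, q, turn_at z k p q * w)) ->
  chain_prod t (strand_turn z) n = 1.
Proof.
move=> H; suff E k p q w : (k <= n)%N ->
    chain_prod t (strand_turn z) k (p, q, w) = (p, q, turn_below z k p q * w).
  by apply: bijP => -[[p q] w]; rewrite E // turn_below_all mul1g.
elim: k p q w => [|k IH] p q w kn.
  by rewrite /turn_below !ltn0 mul1g if_same mul1g.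
rewrite [chain_prod _ _ _]/= bij_mulE H // IH; last exact: ltnW.
by rewrite mulgA turn_belowS.
Qed.

Lemma strand_sys : ell_sys n strand_braid (strand_turn X) (strand_turn Y).
Proof.
have turn_comm z i : (0 < i < n.-1)%N -> strand_turn z * strand_braid i = strand_braid i * strand_turn z.
  move=> iN; apply: bijP => -[[p q] w]; rewrite !bij_mulE !strand_turnE !strand_braidE; try by lia.
  rewrite !strand_turnE !mulgA; congr (_, _, _ * _); rewrite /cross /turn /swap.
  by place p i; place q i; strands.
split; [split|split|split|].
- move=> i iN; apply: bijP => -[[p q] w]; rewrite !bij_mulE !strand_braidE; try by lia.
  rewrite !mulgA; congr (_, _, _ * _); rewrite /cross /swap.
  + by place p i; [..|compare_with p i.+2]; strands.
  + by place q i; [..|compare_with q i.+2]; strands.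
  + by place p i; [..|compare_with p i.+2]; (place q i; [..|compare_with q i.+2]); strands.
- move=> i j ij; apply: bijP => -[[p q] w]; rewrite !bij_mulE !strand_braidE; try by lia.
  rewrite !mulgA; congr (_, _, _ * _); rewrite /cross /swap.
  + by place p i; [..|place p j]; strands.
  + by place q i; [..|place q j]; strands.
  + by place p i; [..|place p j]; (place q i; [..|place q j]); strands.
- move=> n1; apply: bijP => -[[p q] w].
  rewrite !bij_mulE !(strand_turnE, strand_braidE); try by lia.
  rewrite ?(strand_turnE, strand_braidE); try by lia.
  rewrite ?strand_turnE !mulgA; congr (_, _, _ * _); rewrite /cross /turn /swap.
  by place p 0%N; place q 0%N; strands.
- exact: turn_comm.
- exact: (chain_prod_strand chain_strand_plus).
- move=> n1; apply: bijP => -[[p q] w].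
  rewrite !bij_mulE !(strand_turnE, strand_braidVE); try by lia.
  rewrite ?(strand_turnE, strand_braidVE); try by lia.
  rewrite ?strand_turnE !mulgA; congr (_, _, _ * _); rewrite /cross /turn /swap.
  by place p 0%N; place q 0%N; strands.
- by move=> i iN; apply/esym/commV/esym/turn_comm.
- exact: (chain_prod_strand chain_strand_minus).
- move=> n1.
  have xV p q w : (chain strand_braid (strand_turn X) 1)^-1 (p, q, w) =
      (p, q, (turn_at X 1 p q)^-1 * w).
    apply: (can_inj (bijK (chain strand_braid (strand_turn X) 1))).
    by rewrite [LHS](bijKV (chain strand_braid (strand_turn X) 1)) chain_strand_plus // mulTV.
  have xE p q w : chain strand_braid (strand_turn X) 1 (p, q, w) = (p, q, turn_at X 1 p q * w).
    exact: chain_strand_plus.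
  apply: bijP => -[[p q] w]; move: (chain _ _ 1) xV xE => u xV xE.
  rewrite !bij_mulE xE strand_turnVE xV strand_turnE !strand_braidE; try by lia.
  rewrite !mulgA; congr (_, _, _ * _); rewrite /cross /turn /turn_at /swap.
  + by place p 0%N; strands.
  + by place q 0%N; strands.
  + by place p 0%N; place q 0%N; strands.
Qed.
End Retraction.

Section StrandAction.
Variable n : nat.
Local Open Scope group_scope.
Local Notation B := (ell_braid n).

Definition strand_val (t : ell_gen n) : Defs.bij strand_state :=
  match t with
  | EllSigma i => strand_sigma i
  | EllX e => strand_turn n (if e then F2_X else F2_Y)
  end.

Lemma strand_val_sigma k : geval strand_val (sig n true k) = strand_braid n k.
Proof.
by rewrite /sig /strand_braid; case: insubP => [i kn <-|/negPf ->] /=; rewrite ?kn ?ltn_ord.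
Qed.

Fact strand_valP : satisfies (@ell_rel n) strand_val.
Proof.
apply/ell_satisfiesP; rewrite (_ : (fun k => _) = strand_braid n).
  exact: strand_sys.
by apply/funext => k; exact: strand_val_sigma.
Qed.

Definition strand_action : {multiplicative B -> Defs.bij strand_state} := pres_lift strand_valP.

Lemma strand_action_sigma k : strand_action (ell_sigma n k) = strand_braid n k.
Proof.
rewrite /ell_sigma (morph_geval _ _ (h := strand_action)); last exact: gmulfM.
rewrite -strand_val_sigma; elim: (sig n true k) => //= [t|u -> v ->|u ->] //.
exact: pres_lift_gen.
Qed.
Lemma strand_action_X e : strand_action (ell_X n e) = strand_turn n (if e then F2_X else F2_Y).
Proof. exact: pres_lift_gen. Qed.

Definition strand_transr (u : strand_state) (v : F2) : strand_state := (u.1, u.2 * v).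

(** All generators multiply the loop on the left. This is what makes the loop reached from 1
    multiplicative on pure braids. *)
Lemma strand_action_transr b u v :
  strand_action b (strand_transr u v) = strand_transr (strand_action b u) v.
Proof.
elim/ell_braid_ind: b u => [|k kN|e|x y Hx Hy|x Hx] u.
- by rewrite gmulf1'.
- rewrite strand_action_sigma; case: u => -[p q] w.
  by rewrite /strand_transr /= !strand_braidE //= mulgA.
- rewrite strand_action_X; case: u => -[p q] w.
  by apply: (congr1 (fun z : F2 => (p, q, z))); exact: mulgA.
- by rewrite gmulfM !bij_mulE Hy Hx.
- rewrite gmulfV'; apply: (can_inj (bijK (strand_action x))).
  by rewrite Hx [LHS](bijKV (strand_action x)) [in RHS](bijKV (strand_action x)).
Qed.

Lemma swap_perm k (kN : (k < n.-1)%N) (i : 'I_n) : swap k i = (ell_perm n (ell_sigma n k))^-1 i.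
Proof.
have k2 : (k.+1 < n)%N by lia.
rewrite (ell_perm_sigma (ltnW k2) k2) tpermV /swap.
case: tpermP => [->|->|] /=; first by rewrite eqxx.
  by rewrite eqxx; case: eqP => //; lia.
by move=> /eqP; rewrite -val_eqE => /negPf /= -> /eqP; rewrite -val_eqE => /negPf /= ->.
Qed.

(** The inverse reconciles two conventions: permutations multiply from left to right, bijections by
    composition. *)
Lemma strand_action_pos b (i j : 'I_n) w :
  (strand_action b (nat_of_ord i, nat_of_ord j, w)).1 =
  (nat_of_ord ((ell_perm n b)^-1 i), nat_of_ord ((ell_perm n b)^-1 j)).
Proof.
elim/ell_braid_ind: b i j w => [|k kN|e|x y Hx Hy|x Hx] i j w.
- by rewrite !gmulf1' invg1 !perm1.
- by rewrite strand_action_sigma strand_braidE //= !swap_perm.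
- have -> : ell_perm n (ell_X n e) = 1 by exact: pres_lift_gen.
  by rewrite strand_action_X invg1 !perm1.
- rewrite !gmulfM invgM !permM bij_mulE.
  by case: (strand_action y _) (Hy i j w) => [_ w'] /= ->; rewrite Hx.
- rewrite !gmulfV' invgK; set i' := ell_perm n x i; set j' := ell_perm n x j.
  case E : (strand_action x (nat_of_ord i', nat_of_ord j', 1)) (Hx i' j' 1) => [pq c] /=.
  rewrite !permK => epq; suff H : (strand_action x)^-1 (nat_of_ord i, nat_of_ord j, w) =
      (nat_of_ord i', nat_of_ord j', c^-1 * w) by exact: (congr1 fst H).
  apply: (can_inj (bijK (strand_action x))).
  have := strand_action_transr x (nat_of_ord i', nat_of_ord j', 1) (c^-1 * w).
  rewrite E /strand_transr /= mul1g mulTV epq => ->.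
  exact: (bijKV (strand_action x)).
Qed.
End StrandAction.

(** * The copies of F_2 in the pure group and their retraction *)

Section PureMaps.
Variable n : nat.
Hypothesis hn : (2 <= n)%N.
Local Open Scope group_scope.
Local Notation B := (ell_braid n).
Local Notation P := (ell_pure n).

Definition forget_strands (p : P) : F2 := (strand_action n (val p) (0%N, 1%N, 1)).2.

Lemma strand_action_pure (p : P) w :
  strand_action n (val p) (0%N, 1%N, w) = (0%N, 1%N, forget_strands p * w).
Proof.
have n1 : (0 < n)%N by lia.
have := strand_action_transr (val p) (0%N, 1%N, 1) w; rewrite /strand_transr /= mul1g => ->.
congr (_, _); have /eqP p1 := valP p.
have := strand_action_pos (val p) (Ordinal n1) (Ordinal hn) 1.
by rewrite p1 invg1 !perm1.
Qed.

Fact forget_strandsM : {morph forget_strands : p q / p * q}.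
Proof.
move=> p q; rewrite {1}/forget_strands [val _](_ : _ = val p * val q) //.
by rewrite gmulfM bij_mulE !strand_action_pure mulg1.
Qed.
HB.instance Definition _ := isMultiplicative.Build P F2 forget_strands forget_strandsM.

Definition forget_hom : {multiplicative P -> F2} := forget_strands.

Definition fixed_index : Type := {g : B | B3_fixed g}.

Fact conj_X_pure (g : fixed_index) e : ell_pure_pred (sval g * ell_X n e * (sval g)^-1).
Proof. exact/eqP/conjX_perm/ConjXGen/(svalP g). Qed.

Definition handle_val (g : fixed_index) (e : bool) : P :=
  exist (fun x => ell_pure_pred x) _ (conj_X_pure g e).

Definition handle (g : fixed_index) : {multiplicative F2 -> P} :=
  @pres_lift bool no_rel P (handle_val g) (fun _ _ => False_ind _).

Lemma handle_gen g e : handle g (pres_gen no_rel e) = handle_val g e.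
Proof. exact: pres_lift_gen. Qed.

Definition fixed_one : fixed_index := exist _ 1 (B3_fixed1 n).

Lemma handleK : cancel (handle fixed_one) forget_strands.
Proof.
apply: (pres_hom_eq (h := forget_strands \o handle fixed_one) (k := id)) => [x y|//|e].
  by rewrite /= !gmulfM.
rewrite /= handle_gen /forget_strands /= mul1g invg1 mulg1 strand_action_X strand_turnE /turn.
have -> /= : [|| 0 == 1, n <= 0 | n <= 1]%N = false by lia.
by rewrite mulg1; case: e.
Qed.

Lemma B3_handle b g x :
  gaut_fun (B3_pure n b) (handle g x) = handle g (gaut_fun (B3_F2 b) x).
Proof.
apply: val_inj; rewrite -[LHS]/(gaut_fun (B3_ell_braid n b) (val (handle g x))).
have valX e : val (handle g (pres_gen no_rel e)) = sval g * ell_X n e * (sval g)^-1.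
  by rewrite handle_gen.
have valM u v : val (handle g (u * v)) = val (handle g u) * val (handle g v).
  by rewrite gmulfM.
have valV u : val (handle g u^-1) = (val (handle g u))^-1 by rewrite gmulfV'.
have genP (e : bool) y : gaut_fun (if e then ell_plus n else ell_minus n) (val (handle g y)) =
    val (handle g (gaut_fun (if e then F2_plus else F2_minus) y)).
  have fixg : gaut_fun (if e then ell_plus n else ell_minus n) (sval g) = sval g.
    have := svalP g (pres_gen _ e).
    by rewrite /B3_ell_braid /= pres_lift_gen.
  pose lhs z := gaut_fun (if e then ell_plus n else ell_minus n) (val (handle g z)).
  pose rhs z := val (handle g (gaut_fun (if e then F2_plus else F2_minus) z)).
  apply: (pres_hom_eq (h := lhs) (k := rhs)) => [u v|u v|d].
  - by rewrite /lhs valM gmulfM.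
  - by rewrite /rhs gmulfM valM.
  rewrite /lhs /rhs valX !gmulfM gmulfV' fixg.
  by case: e d {fixg lhs rhs} => -[]; rewrite !pres_aut_gen /= ?valM ?valV !valX ?invgM ?invgK
    ?mulgA ?mulgVK.
elim/pres_ind: b x => t x; rewrite -geval_pres_gen.
rewrite (morph_geval _ _ (h := B3_ell_braid n)) ?(morph_geval _ _ (h := B3_F2));
  try exact: gmulfM.
elim: t x => [e||u IHu v IHv|u IHu] x.
- by rewrite /= !pres_lift_gen genP.
- by [].
- exact: etrans (congr1 _ (IHv x)) (IHu _).
- set a := geval _ u in IHu *; set c := geval _ u in IHu *.
  apply: (can_inj (bijK (val a))); apply: etrans (bijKV (val a) _) _.
  apply: etrans _ (esym (IHu _)); congr (val (handle g _)).
  exact/esym/(bijKV (val c)).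
Qed.
End PureMaps.

(** By [malcev_commutator] only values on additive functions matter. These are killed in degree 2,
    where evaluations at finitely many [p k] are coordinates, so [D] acts on them as the rational
    combination of evaluations at [p k] with weights [D (l k)]. *)
Lemma malcev_generation (Gamma : groupType) (us : seq Gamma) (T : Type) (s : T -> malcev Gamma) :
  generated_by us ->
  (forall p, exists w, forall chi : Gamma -> rat, unip chi ->
    (forall x y, chi (x * y)%g = chi x + chi y) -> (lie_eval id s w : malcev Gamma) chi = chi p) ->
  forall D : malcev Gamma, exists w, lcs 1 (D - lie_eval id s w).
Proof.
move=> gen sP D; have [N [p [l [lm lP]]]] := killed_basis gen 2.
have [w wP] : exists w, forall chi : Gamma -> rat, unip chi ->
    (forall x y, chi (x * y)%g = chi x + chi y) ->
    (lie_eval id s w : malcev Gamma) chi = \sum_(k < N) D (l k) * chi (p k).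
  elim: (N) => [|M [w wP]]; first by exists LieZero => chi _ _; rewrite big_ord0.
  have [w' w'P] := sP (p M); exists (LieAdd w (LieScale (D (l M)) w')) => chi uc ac.
  by rewrite big_ord_recr /= -wP // -[chi (p M)]w'P.
exists w; apply: (malcev_commutator gen) => chi uc ac.
have c2 : killed 2 chi.
  by move=> a b x; rewrite !ac addrK addrK subrr.
rewrite -[LHS]/(D chi - (lie_eval id s w : malcev Gamma) chi) wP //.
have -> : D chi = D (fun x => \sum_(k < N) chi (p k) * l k x).
  by congr malcev_fun; apply/funext => x; exact: lP.
have ul k : unip (l k) by exists 2.
rewrite (malcev_sum D N (F := fun k x => chi (p k) * l k x)); last by move=> k; exact: unipZ.
rewrite -sumrB big1 // => k _; rewrite malcevZ //.
by rewrite [X in _ - X]mulrC subrr.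
Qed.

Lemma log_additive_fun (Gamma : groupType) (chi : Gamma -> rat) g : unip chi ->
  (forall x y, chi (x * y)%g = chi x + chi y) -> log g chi = chi g.
Proof.
move=> uc ac; have c1 : chi 1%g = 0.
  by apply/eqP; have := ac 1%g 1%g; rewrite mulg1 => /eqP; rewrite -subr_eq0 opprD addNKr oppr_eq0.
rewrite logE // -[RHS]slope_linear; congr slope; apply/funext.
elim=> [|k IH]; first by rewrite expg0 c1 mul0r.
by rewrite expgS ac IH -natr1 mulrDl mul1r addrC.
Qed.

(** Evaluating an additive function at [p] is the same as applying [log p] to it, so a product of
    generators of [conjX] becomes a sum of logarithms, each coming from Lie F_2 through a handle. *)
Lemma handles_generate (n : nat) (hn : (2 <= n)%N) (m : nat) (D : malcev (ell_pure n)) :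
  exists w, lcs m (D - lie_eval id
    (fun t : fixed_index n * malcev F2 => malcev_map (handle t.1) t.2) w).
Proof.
apply: lie_generation m D => D; apply: malcev_generation (@ell_pure_generated n) _ D => p.
set ev := lie_eval _ _.
suff H (b : ell_braid n) : conjX b -> forall p : ell_pure n, val p = b -> exists w, forall chi,
    unip chi -> (forall x y, chi (x * y)%g = chi x + chi y) -> (ev w : malcev _) chi = chi p.
  by apply: (H (val p)) => //; apply: pure_conjX; exact/eqP/(valP p).
have chi1 (chi : ell_pure n -> rat) : (forall x y, chi (x * y)%g = chi x + chi y) -> chi 1%g = 0.
  move=> ac; apply/eqP; have := ac 1%g 1%g.
  by rewrite mulg1 => /eqP; rewrite -subr_eq0 opprD addNKr oppr_eq0.
elim=> [g e gF||x y xX Hx yX Hy|x xX Hx] {}p ep.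
- exists (LieVar (exist _ g gF : fixed_index n, log (pres_gen no_rel e))) => chi uc ac.
  rewrite /ev /= log_map handle_gen log_additive_fun //; congr chi.
  exact: val_inj.
- exists LieZero => chi uc ac.
  have -> : p = 1%g by exact: val_inj.
  by rewrite chi1.
- have [px ex] : exists q : ell_pure n, val q = x.
    by exists (exist (fun x => ell_pure_pred x) x (introT eqP (conjX_perm xX))).
  have [py ey] : exists q : ell_pure n, val q = y.
    by exists (exist (fun x => ell_pure_pred x) y (introT eqP (conjX_perm yX))).
  have [wx wxP] := Hx _ ex; have [wy wyP] := Hy _ ey.
  exists (LieAdd wx wy) => chi uc ac.
  have -> : p = (px * py)%g by apply: val_inj; exact: etrans ep (congr2 _ (esym ex) (esym ey)).
  by rewrite ac -wxP // -wyP.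
- have [px ex] : exists q : ell_pure n, val q = x.
    by exists (exist (fun x => ell_pure_pred x) x (introT eqP (conjX_perm xX))).
  have [wx wxP] := Hx _ ex.
  exists (LieScale (-1) wx) => chi uc ac.
  have -> : p = (px^-1)%g by apply: val_inj; exact: etrans ep (congr1 _ (esym ex)).
  apply: etrans (_ : - chi px = _); first by rewrite -wxP //; exact: mulN1r.
  by apply/eqP; rewrite eq_sym -addr_eq0 -ac mulVg chi1.
Qed.

(** The retraction needs two strands. For [n = 1] the pure group is trivial by [ell_pure1], whereas
    B_3 acts nontrivially on Lie F_2. *)
Theorem theorem6p2 (n : nat) (hn : (2 <= n)%N) :
  exists F : groupFunctorIso (zariski_closure rho_F2) (zariski_closure (rho_ell n)),
    forall b : B3, F rat^o%R (to_zariski rho_F2 b) = to_zariski (rho_ell n) b.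
Proof.
have rK : cancel (malcev_map (handle (fixed_one n))) (malcev_map (forget_hom hn)).
  move=> D; apply: malcevP => f uf; rewrite !malcev_mapE //; last exact: unip_comp.
  by congr malcev_fun; apply/funext => x /=; rewrite handleK.
apply: (@intertwined_closure_iso (malcev F2) (malcev (ell_pure n)) (fixed_index n)
  (fun g => malcev_map (handle g)) (malcev_map (forget_hom hn)) (fixed_one n)
  (fun g => malcev_map_linear (handle g)) (fun g => malcev_map_lie (handle g))
  (malcev_map_linear _) (malcev_map_lie _) rK (handles_generate hn)).
move=> b g D; rewrite [LHS]gaut_malcev_of [in RHS]gaut_malcev_of ext_induced_of.
congr ext_of; apply: malcevP => f uf; rewrite !malcev_mapE //; try exact: unip_comp.
by congr malcev_fun; apply/funext => x; apply: (congr1 f); exact: B3_handle.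
Qed.
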